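(* Let $a,q\in C^\infty(\mathbb R)$ be real-valued with $a\ge 0$, $q\ge 0$, and assume that for some $x_0>0$: (i) $\lim_{|x|\to+\infty}a(x)=+\infty$; (ii) for every $n\in\mathbb N$ there is $C_n>0$ such that $|a^{(n)}(x)|\le C_n(1+a(x))\langle x\rangle^{-n}$ for all $x\in\mathbb R$; (iii) for every $n\in\mathbb N$ there is $C_n'>0$ such that $|q^{(n)}(x)|\le C_n'(1+q(x))\langle x\rangle^{-n}$ for all $x\in\mathbb R$; (iv) there is $K_0>0$ such that $q(x)\le K_0\,a(x)$ for all $|x|>x_0$. Let $G$ be the generator of the damped wave equation with damping $a$ and potential $q$, acting in the Hilbert space $\mathcal H=\mathcal H_1\oplus\mathcal H_2$ (defined in the context). Let $K\subset[0,+\infty)$ be a bounded subset and let $\lambda:=-c+ib\in\mathbb C$ with $c\in K$ and $b\in\mathbb R\setminus\{0\}$. Then $$\|(G-\lambda)^{-1}\|\approx_K 1\qquad\text{as } |b|\to+\infty,$$ that is, there exist $b_0=b_0(K)>0$ and constants $0<m_K\le M_K<\infty$ such that for all $c\in K$ and all $b\in\mathbb R$ with $|b|\ge b_0$ one has $\lambda=-c+ib\in\rho(G)$ and $m_K\le\|(G-\lambda)^{-1}\|\le M_K$.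
   Context: Notation: $\langle x\rangle=(1+x^2)^{1/2}$; $\langle\cdot,\cdot\rangle$ and $\|\cdot\|$ are the $L^2(\mathbb R)$ inner product and norm (or the operator norm). $\rho(G)$ is the resolvent set. Spaces. $\mathcal H_1:=\mathcal W(\mathbb R)$ is the completion of $C_c^\infty(\mathbb R)$ with respect to the inner product $\langle f,g\rangle_{\mathcal W}=\int_{\mathbb R}f'\overline{g'}\,dx+\int_{\mathbb R}q f\overline g\,dx$; $\mathcal H_2:=L^2(\mathbb R)$; $\mathcal H:=\mathcal H_1\oplus\mathcal H_2$ is the Hilbert space direct sum. $\mathcal D_S:=\{f\in W^{1,2}(\mathbb R): q^{1/2}f\in L^2(\mathbb R),\ a^{1/2}f\in L^2(\mathbb R)\}$ with inner product $\langle f,g\rangle_S=\int f'\overline{g'}+\int qf\overline g+\int af\overline g+\int f\overline g$, and $\mathcal D_S^*$ is the space of bounded conjugate-linear functionals on $\mathcal D_S$. The embeddings $\mathcal D_S\subset\mathcal H_2\subset\mathcal D_S^*$ are continuous with dense range, $C_c^\infty(\mathbb R)$ is dense in $\mathcal D_S$, and $\mathcal D_S$ embeds continuously in $\mathcal H_1$. Operators. $\partial_x^2-q$ denotes the unique bounded extension $\mathcal H_1\to\mathcal D_S^*$ of $((\partial_x^2-q)f,g)_{\mathcal D_S^*\times\mathcal D_S}:=-\int_{\mathbb R}(f'\overline{g'}+qf\overline g)\,dx$, and $a$ denotes the unique bounded extension $\mathcal D_S\to\mathcal D_S^*$ of $(af,g)_{\mathcal D_S^*\times\mathcal D_S}:=\int_{\mathbb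 R}af\overline g\,dx$, $f,g\in C_c^\infty(\mathbb R)$. The operator $G$ in $\mathcal H$ is $$\mathrm{Dom}(G)=\{(u_1,u_2)^t\in\mathcal H_1\oplus\mathcal D_S:\ (\partial_x^2-q)u_1-2au_2\in\mathcal H_2\},\qquad G\begin{pmatrix}u_1 \\ u_2\end{pmatrix}=\begin{pmatrix}u_2 \\ (\partial_x^2-q)u_1-2au_2\end{pmatrix}.$$ It is known that $G$ is m-dissipative and densely defined in $\mathcal H$. *)

(* Defs.v *)
From HB Require Import structures.
From mathcomp Require Import all_boot all_order all_algebra.
From mathcomp Require Import all_classical all_reals all_analysis.
From mathcomp Require Import measurable_realfun complex.
Set Implicit Arguments.
Unset Strict Implicit.
Unset Printing Implicit Defensive.
Import Order.TTheory GRing.Theory Num.Theory.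
Import numFieldNormedType.Exports.
Local Open Scope complex_scope.
Local Open Scope ring_scope.
Local Open Scope quotient_scope.
Local Open Scope classical_set_scope.

Section complex_functions.
Context {R : realType}.
Implicit Types (f g : R -> R[i]) (c : R[i]).

Definition cintegral f : R[i] :=
  (\int[lebesgue_measure]_x complex.Re (f x)) +i*
  (\int[lebesgue_measure]_x complex.Im (f x)).

Definition cintegrable f :=
  lebesgue_measure.-integrable setT (EFin \o (fun x => complex.Re (f x))) /\
  lebesgue_measure.-integrable setT (EFin \o (fun x => complex.Im (f x))).

Definition L2fun : {pred R -> R[i]} := [pred f : R -> R[i] |
  ((fun x => complex.Re (f x)) \in Lfun lebesgue_measure 2%:E) &&
  ((fun x => complex.Im (f x)) \in Lfun lebesgue_measure 2%:E)].

Lemma L2fun_submod_closed : submod_closed L2fun.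
Proof.
have [L0 LD] := @Lfun_submod_closed _ _ R lebesgue_measure _ (lee1n 2 : (1 <= 2%:E)%E).
split.
  by apply/andP; split; exact: L0.
move=> c f g /andP[fr fi] /andP[gr gi]; rewrite inE /=; apply/andP; split.
  rewrite (_ : (fun x => _) = complex.Re c *: (fun x => complex.Re (f x)) +
      (- complex.Im c *: (fun x => complex.Im (f x)) + fun x => complex.Re (g x))).
    exact: LD fr (LD _ _ _ fi gr).
  apply/funext => x; rewrite !fctE /=.
  case: c (f x) (g x) => [c1 c2] [f1 f2] [g1 g2] /=.
  by rewrite /GRing.scale /= addrA mulNr.
rewrite (_ : (fun x => _) = complex.Re c *: (fun x => complex.Im (f x)) +
    (complex.Im c *: (fun x => complex.Re (f x)) + fun x => complex.Im (g x))).
  exact: LD fi (LD _ _ _ fr gi).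
apply/funext => x; rewrite !fctE /=.
case: c (f x) (g x) => [c1 c2] [f1 f2] [g1 g2] /=.
by rewrite /GRing.scale /= addrA.
Qed.

HB.instance Definition _ :=
  GRing.isSubmodClosed.Build _ _ L2fun L2fun_submod_closed.

Record sqint := Sqint { sqint_fun :> R -> R[i]; sqintP : sqint_fun \in L2fun }.
HB.instance Definition _ := [isSub for sqint_fun].
HB.instance Definition _ := gen_eqMixin sqint.
HB.instance Definition _ := gen_choiceMixin sqint.
HB.instance Definition _ := [SubChoice_isSubLmodule of sqint by <:].

Definition ae_null : {pred sqint} := fun f : sqint =>
  `[< {ae lebesgue_measure, forall x, f x = 0} >].

Lemma ae_null_submod_closed : submod_closed ae_null.
Proof.
split; first by apply/asboolP; apply: nearW => x.
move=> c f g /asboolP f0 /asboolP g0; apply/asboolP.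
have F := ae_filter_ringOfSetsType (@lebesgue_measure R).
by apply: (@filterS2 _ _ F _ _ _ _ f0 g0) => x /=; rewrite !fctE => -> ->; rewrite scaler0 addr0.
Qed.

HB.instance Definition _ :=
  GRing.isSubmodClosed.Build _ _ ae_null ae_null_submod_closed.

(* L^2(R; C): square-integrable functions modulo almost everywhere vanishing
   ones. All integrals below are independent of the chosen representative. *)
Definition L2 := Quotient.quot ae_null.
HB.instance Definition _ := GRing.Zmodule.on L2.
HB.instance Definition _ := EqQuotient.on L2.


Definition L2_scale (c : R[i]) (u : L2) : L2 := \pi_L2 (c *: repr u).

Lemma pi_L2_scale c : {morph \pi_L2 : f / c *: f >-> L2_scale c f}.
Proof.
move=> f; apply/eqP; rewrite -Quotient.idealrBE -scalerBr rpredZ//.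
by rewrite Quotient.idealrBE reprK.
Qed.

Canonical pi_L2_scale_morph c := PiMorph1 (pi_L2_scale c).

Fact L2_scaleA a b u : L2_scale a (L2_scale b u) = L2_scale (a * b) u.
Proof. by rewrite -[u]reprK !piE scalerA. Qed.
Fact L2_scale1 : left_id 1 L2_scale.
Proof. by move=> u; rewrite -[u]reprK !piE scale1r. Qed.
Fact L2_scaleDr : right_distributive L2_scale +%R.
Proof. by move=> c u v; rewrite -[u]reprK -[v]reprK !piE scalerDr. Qed.
Fact L2_scaleDl u : {morph L2_scale^~ u : a b / a + b}.
Proof. by move=> a b /=; rewrite -[u]reprK !piE scalerDl. Qed.
HB.instance Definition _ := GRing.Zmodule_isLmodule.Build R[i] L2
  L2_scaleA L2_scale1 L2_scaleDr L2_scaleDl.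

Lemma repr_L2P c (u v : L2) : {ae lebesgue_measure,
  forall x, repr (c *: u + v) x = c * repr u x + repr v x}.
Proof.
have /asboolP: repr (c *: u + v) - (c *: repr u + repr v) \in ae_null.
  rewrite Quotient.idealrBE reprK; apply/eqP.
  transitivity (c *: \pi_L2 (repr u) + \pi_L2 (repr v)); first by rewrite !reprK.
  by rewrite !piE.
have F := ae_filter_ringOfSetsType (@lebesgue_measure R).
by apply: filterS => x /=; rewrite !fctE => /eqP; rewrite subr_eq0 => /eqP.
Qed.

End complex_functions.
Arguments L2 R : clear implicits.
Arguments sqint R : clear implicits.

Section tests.
Context {R : realType}.

Definition smooth (g : R -> R) := forall n x, derivable (g^`(n)) x 1.

Definition bracket (x : R) : R := Num.sqrt (1 + x ^+ 2).

Definition symbol_like (g : R -> R) := forall n : nat,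
  exists2 C : R, 0 < C & forall x : R,
    `|(g^`(n))%classic x| <= C * (1 + g x) * bracket x ^- n.

(* Complex-valued functions of a real variable are handled through their real
   and imaginary parts. *)
Definition cderive (f : R -> R[i]) (x : R) : R[i] :=
  (fun y => complex.Re (f y))^`() x +i* (fun y => complex.Im (f y))^`() x.

Definition is_test : {pred R -> R[i]} := fun f =>
  `[< [/\ smooth (fun x => complex.Re (f x)), smooth (fun x => complex.Im (f x))
        & compact (closure [set x | f x != 0])] >].

Lemma derive1n_lin (c : R) (f g : R -> R) n : smooth f -> smooth g ->
  (c *: f + g)^`(n) = c *: (f^`(n))%classic + (g^`(n))%classic.
Proof.
move=> sf sg; elim: n => [|n IH]; first by [].
rewrite !derive1nS IH; apply/funext => x.
rewrite derive1E deriveD; [|exact/derivableZ|exact: sg].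
by rewrite deriveZ// -!derive1E.
Qed.

Lemma smooth_lin (c : R) (f g : R -> R) : smooth f -> smooth g ->
  smooth (c *: f + g).
Proof.
move=> sf sg n x; rewrite derive1n_lin//; apply: derivableD; last exact: sg.
exact/derivableZ.
Qed.

Lemma smooth0 : smooth (fun=> 0).
Proof.
move=> n x; suff -> : (fun=> 0 : R)^`(n) = (fun=> 0) by exact: derivable_cst.
elim: n => // n IH; rewrite derive1nS IH; apply/funext => y.
by rewrite derive1_cst.
Qed.

Lemma smooth_derive (g : R -> R) : smooth g -> smooth g^`().
Proof. by move=> sg n x; rewrite -derive1Sn; exact: sg. Qed.

Lemma smooth_continuous (g : R -> R) : smooth g -> continuous g.
Proof. by move=> sg x; apply: differentiable_continuous; exact/derivable1_diffP/(sg 0). Qed.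

Lemma is_test_submod_closed : submod_closed is_test.
Proof.
split.
  apply/asboolP; split; [exact: smooth0|exact: smooth0|].
  rewrite (_ : [set x | _] = set0) ?closure0; first exact: compact0.
  by apply/seteqP; split => x //=; rewrite eqxx.
move=> c f g /asboolP[fr fi fc] /asboolP[gr gi gc]; apply/asboolP; split.
- rewrite (_ : (fun x => _) = complex.Re c *: (fun x => complex.Re (f x)) +
      (- complex.Im c *: (fun x => complex.Im (f x)) + fun x => complex.Re (g x))).
    by apply: smooth_lin => //; exact: smooth_lin.
  apply/funext => x; rewrite !fctE /=.
  case: c (f x) (g x) => [c1 c2] [f1 f2] [g1 g2] /=.
  by rewrite /GRing.scale /= addrA mulNr.
- rewrite (_ : (fun x => _) = complex.Re c *: (fun x => complex.Im (f x)) +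
    (complex.Im c *: (fun x => complex.Re (f x)) + fun x => complex.Im (g x))).
    by apply: smooth_lin => //; exact: smooth_lin.
  apply/funext => x; rewrite !fctE /=.
  case: c (f x) (g x) => [c1 c2] [f1 f2] [g1 g2] /=.
  by rewrite /GRing.scale /= addrA.
- apply: (subclosed_compact _ (compactU fc gc)); first exact: closed_closure.
  rewrite -closureU; apply: closure_subset => x /=; rewrite !fctE => fg0.
  have [fx0|fx0] := eqVneq (f x) 0; [right|by left].
  by move: fg0; rewrite fx0 scaler0 add0r.
Qed.

HB.instance Definition _ :=
  GRing.isSubmodClosed.Build _ _ is_test is_test_submod_closed.

Record test := Test { test_fun :> R -> R[i]; testP : test_fun \in is_test }.
HB.instance Definition _ := [isSub for test_fun].
HB.instance Definition _ := gen_eqMixin test.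
HB.instance Definition _ := gen_choiceMixin test.
HB.instance Definition _ := [SubChoice_isSubLmodule of test by <:].

Lemma bounded_support (f : R -> R[i]) : compact (closure [set x | f x != 0]) ->
  exists2 M : R, 0 < M & forall x, M <= `|x| -> f x = 0.
Proof.
move=> /compact_bounded[M [Mr Mb]].
exists (`|M| + 1); first by rewrite ltr_wpDl.
move=> x Mx; apply/eqP; apply: contraTT isT => fx0.
have /= := Mb (`|M| + 2^-1) _ x (@subset_closure _ [set y | f y != 0] x fx0).
rewrite (le_lt_trans (ler_norm _))// ?ltrDl// => /(_ isT) Mx2.
have := le_trans Mx Mx2; rewrite lerD2l invf_ge1// => h.
by move: h; rewrite -[1]/(1%:R) ler_nat.
Qed.

Lemma zero_outside_L2 (g : R -> R) (M : R) : continuous g ->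
  (forall x, M <= `|x| -> g x = 0) -> g \in Lfun lebesgue_measure 2%:E.
Proof.
move=> cg g0.
have mg : measurable_fun [set: R] g by exact: continuous_measurable_fun.
apply/andP; split; rewrite inE//=.
rewrite /finite_norm unlock poweR_lty//.
under eq_integral => x _ do rewrite poweR_EFin powR_mulrn//.
have -> : (\int[lebesgue_measure]_x (`|g x| ^+ 2)%R%:E =
   \int[lebesgue_measure]_(x in `[(- M)%R, M]) (`|g x| ^+ 2)%R%:E)%E.
  rewrite [RHS]integral_mkcond; apply: eq_integral => x _.
  rewrite /patch; case: ifPn => // /negP xM; rewrite g0 ?normr0 ?expr0n//=.
  rewrite leNgt; apply/negP => xM'; apply: xM; rewrite inE /= in_itv /=.
  by rewrite -ler_norml ltW.
have := @continuous_compact_integrable R (fun x => `|g x| ^+ 2) `[- M, M]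
  (@segment_compact _ _ _).
move=> h; apply: integrable_lty => //; apply: h.
apply: continuous_subspaceT => x.
by apply: (@continuous_comp _ _ _ (fun x => `|g x|) (fun y : R => y ^+ 2));
  [exact: continuous_comp (cg x) (@norm_continuous _ _ _)|exact: exprn_continuous].
Qed.

End tests.
Arguments test R : clear implicits.

Section DS.
Context {R : realType}.
Local Notation mu := (@lebesgue_measure R).

Lemma test_bound (f : test R) : exists2 M : R, 0 < M & forall x, M <= `|x| -> f x = 0.
Proof.
have /asboolP[_ _ fc] := testP f.
exact: bounded_support.
Qed.

Lemma zero_outside_L2fun (f : R -> R[i]) (M : R) :
  continuous (fun x => complex.Re (f x)) -> continuous (fun x => complex.Im (f x)) ->
  (forall x, M <= `|x| -> f x = 0) -> f \in L2fun.
Proof.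
move=> cr ci f0; apply/andP; split; apply: (@zero_outside_L2 _ _ M) => // x /f0 ->//.
Qed.

Lemma test_L2fun (f : test R) : (f : R -> R[i]) \in L2fun.
Proof.
have /asboolP[fr fi _] := testP f; have [M _ f0] := test_bound f.
by apply: zero_outside_L2fun f0; exact: smooth_continuous.
Qed.

Lemma derive1_outside (g : R -> R) (A : set R) : closed A ->
  (forall x, ~ A x -> g x = 0) -> forall x, ~ A x -> g^`() x = 0.
Proof.
move=> cA g0 x Ax; rewrite derive1E.
have -> : 'D_1 g x = 'D_1 (fun=> 0 : R) x.
  apply: near_eq_derive.
  have oA : open (~` A) by exact: closed_openC.
  by apply: filterS (open_nbhs_nbhs (conj oA Ax)) => y /g0.
by rewrite derive_cst.
Qed.

Lemma test_derive_subproof (f : test R) : cderive f \in is_test.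
Proof.
have /asboolP[fr fi fc] := testP f.
apply/asboolP; split; [exact: smooth_derive|exact: smooth_derive|].
apply: (subclosed_compact _ fc); first exact: closed_closure.
rewrite [X in _ `<=` X](closure_id _).1; last exact: closed_closure.
apply: closure_subset => x /= dfx; apply: contrapT => xA.
have f0 y : ~ closure [set x | f x != 0] y -> f y = 0.
  by move=> yA; apply/eqP/negPn/negP => fy; apply: yA; exact: subset_closure.
move: dfx; rewrite /cderive !(@derive1_outside _ (closure [set x | f x != 0])) ?eqxx//.
- exact: closed_closure.
- by move=> y /f0 ->.
- exact: closed_closure.
- by move=> y /f0 ->.
Qed.

Definition test_derive (f : test R) : test R := Test (test_derive_subproof f).

Lemma cintegrableM (f g : R -> R[i]) : f \in L2fun -> g \in L2fun ->
  cintegrable (fun x => f x * g x).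
Proof.
move=> /andP[fr fi] /andP[gr gi]; split.
  rewrite (_ : _ \o _ = (fun x => (complex.Re (f x) * complex.Re (g x))%:E -
      (complex.Im (f x) * complex.Im (g x))%:E)%E); last first.
    by apply/funext => x /=; case: (f x) (g x) => [? ?] [? ?].
  apply: integrableB => //.
    by have /Lfun1_integrable := Lfun2_mul_Lfun1 fr gr.
  by have /Lfun1_integrable := Lfun2_mul_Lfun1 fi gi.
rewrite (_ : _ \o _ = (fun x => (complex.Re (f x) * complex.Im (g x))%:E +
    (complex.Im (f x) * complex.Re (g x))%:E)%E); last first.
  by apply/funext => x /=; case: (f x) (g x) => [? ?] [? ?].
apply: integrableD => //.
  by have /Lfun1_integrable := Lfun2_mul_Lfun1 fr gi.
by have /Lfun1_integrable := Lfun2_mul_Lfun1 fi gr.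
Qed.

Lemma cintegral_lin c (f g : R -> R[i]) : cintegrable f -> cintegrable g ->
  cintegral (fun x => c * f x + g x) = c * cintegral f + cintegral g.
Proof.
move=> [fr fi] [gr gi]; rewrite /cintegral.
have Z k (h : R -> R) : mu.-integrable setT (EFin \o h) ->
    mu.-integrable setT (EFin \o (fun x => k * h x)).
  by move=> hi; have := @integrableZl _ _ _ mu setT measurableT k _ hi; apply: eq_integrable.
rewrite (_ : (fun x => complex.Re _) = fun x => complex.Re c * complex.Re (f x) +
    (- complex.Im c * complex.Im (f x) + complex.Re (g x))); last first.
  by apply/funext => x; case: c (f x) (g x) => [? ?] [? ?] [? ?] /=; rewrite addrA mulNr.
rewrite (_ : (fun x => complex.Im _) = fun x => complex.Re c * complex.Im (f x) +
    (complex.Im c * complex.Re (f x) + complex.Im (g x))); last first.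
  by apply/funext => x; case: c (f x) (g x) => [? ?] [? ?] [? ?] /=; rewrite addrA.
have D (h k : R -> R) : mu.-integrable setT (EFin \o h) ->
    mu.-integrable setT (EFin \o k) -> mu.-integrable setT (EFin \o (fun x => h x + k x)).
  by move=> hi ki; have := integrableD measurableT hi ki; apply: eq_integrable.
rewrite !RintegralD ?RintegralZl//; try by [exact: Z|apply: D => //; exact: Z].
case: c => c1 c2 /=; apply/eqP; rewrite eq_complex /=.
by rewrite !addrA !mulNr !eqxx.
Qed.

Lemma eq_cintegral (f g : R -> R[i]) :
  measurable_fun setT (fun x => complex.Re (f x)) ->
  measurable_fun setT (fun x => complex.Im (f x)) ->
  measurable_fun setT (fun x => complex.Re (g x)) ->
  measurable_fun setT (fun x => complex.Im (g x)) ->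
  {ae mu, forall x, f x = g x} -> cintegral f = cintegral g.
Proof.
move=> fr fi gr gi fg; have F := ae_filter_ringOfSetsType mu.
congr (_ +i* _); rewrite /Rintegral; congr fine; apply: ae_eq_integral => //;
  try exact/measurable_EFinP.
- by apply: (@filterS _ _ F _ _ _ fg) => x -> _.
- by apply: (@filterS _ _ F _ _ _ fg) => x -> _.
Qed.

Lemma derive_by_parts (g h : R -> R) (M : R) : 0 < M -> smooth g -> smooth h ->
  (forall x, M <= `|x| -> g x = 0) ->
  \int[mu]_x (g x * (h^`()%classic x)) = - \int[mu]_x (g^`()%classic x * h x).
Proof.
move=> M0 sg sh g0.
have g'0 x : M < `|x| -> g^`() x = 0.
  move=> Mx; apply: (@derive1_outside _ [set x | `|x| <= M]) => /=.
  - rewrite (_ : mkset _ = `[- M, M]); first exact: interval_closed.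
    by apply/seteqP; split => y /=; rewrite in_itv /= ler_norml.
  - by move=> y /negP; rewrite -ltNge => /ltW /g0.
  - by apply/negP; rewrite -ltNge.
have loc (k : R -> R) : (forall x, M < `|x| -> k x = 0) ->
    (\int[mu]_x (k x)%:E = \int[mu]_(x in `[(- M)%R, M]) (k x)%:E)%E.
  move=> k0; rewrite [RHS]integral_mkcond; apply: eq_integral => x _.
  rewrite /patch; case: ifPn => // /negP xM; rewrite k0//.
  rewrite ltNge; apply/negP => xM'; apply: xM; rewrite inE /= in_itv /=.
  by rewrite -ler_norml.
have NMM : - M < M by rewrite (lt_trans _ M0)// oppr_lt0.
have oo (k : R -> R) : smooth k -> derivable_oo_LRcontinuous k (- M) M.
  move=> sk; have ck := smooth_continuous sk; split.
  - by move=> x _; exact: (sk 0%N).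
  - by apply: cvg_at_right_filter; exact: ck.
  - by apply: cvg_at_left_filter; exact: ck.
rewrite /Rintegral loc; last by move=> x /ltW /g0 ->; rewrite mul0r.
rewrite loc; last by move=> x /g'0 ->; rewrite mul0r.
rewrite (@integration_by_parts _ g h g^`() h^`())//.
- have -> : g M = 0 by apply: g0; rewrite ler_norm.
  have -> : g (- M) = 0 by apply: g0; rewrite normrN ler_norm.
  by rewrite !mul0r subrr sub0e fineN.
- by apply: continuous_subspaceT => x; exact/smooth_continuous/smooth_derive.
- exact: oo.
- by apply: continuous_subspaceT => x; exact/smooth_continuous/smooth_derive.
- exact: oo.
Qed.
End DS.

Section spaces.
Context {R : realType}.
Local Notation mu := (@lebesgue_measure R).
Implicit Types (a q : R -> R) (u v w : L2 R) (f g phi : test R).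

Definition L2_ip u v : R[i] := cintegral (fun x => repr u x * (repr v x)^*%C).
Definition L2_norm u : R := Num.sqrt (complex.Re (L2_ip u u)).

Definition test_L2 f : L2 R := \pi_(L2 R) (Sqint (test_L2fun f)).

Lemma repr_test_L2 f : {ae mu, forall x, repr (test_L2 f) x = f x}.
Proof.
have /asboolP: repr (test_L2 f) - Sqint (test_L2fun f) \in ae_null.
  by rewrite Quotient.idealrBE reprK.
have F := ae_filter_ringOfSetsType mu.
by apply: filterS => x /=; rewrite !fctE => /eqP; rewrite subr_eq0 => /eqP.
Qed.

Definition weak_derivative u v := forall phi,
  cintegral (fun x => repr u x * cderive phi x) =
  - cintegral (fun x => repr v x * phi x).

Definition in_L2 (h : R -> R[i]) :=
  exists w, {ae mu, forall x, repr w x = h x}.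

Definition in_DS a q : {pred L2 R} := fun u =>
  `[< [/\ exists v, weak_derivative u v,
          in_L2 (fun x => (Num.sqrt (q x))%:C * repr u x)
        & in_L2 (fun x => (Num.sqrt (a x))%:C * repr u x)] >].

Lemma L2fun_measurable (h : R -> R[i]) : h \in L2fun ->
  measurable_fun setT (fun x => complex.Re (h x)) /\
  measurable_fun setT (fun x => complex.Im (h x)).
Proof. by move=> /andP[/andP[/[!inE]/= + _] /andP[/[!inE]/= + _]]. Qed.

Lemma cintegrable_measurable (h : R -> R[i]) : cintegrable h ->
  measurable_fun setT (fun x => complex.Re (h x)) /\
  measurable_fun setT (fun x => complex.Im (h x)).
Proof.
by move=> [/integrableP[/measurable_EFinP ? _] /integrableP[/measurable_EFinP ? _]].
Qed.

Lemma eq_cintegralM (h k l : R -> R[i]) : h \in L2fun -> k \in L2fun ->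
  l \in L2fun -> {ae mu, forall x, h x = k x} ->
  cintegral (fun x => h x * l x) = cintegral (fun x => k x * l x).
Proof.
move=> hL kL lL hk; have F := ae_filter_ringOfSetsType mu.
have [? ?] := cintegrable_measurable (cintegrableM hL lL).
have [? ?] := cintegrable_measurable (cintegrableM kL lL).
by apply: eq_cintegral => //; apply: (@filterS _ _ F _ _ _ hk) => x ->.
Qed.

Lemma cintegral_repr c u v (h : R -> R[i]) : h \in L2fun ->
  cintegral (fun x => repr (c *: u + v) x * h x) =
  c * cintegral (fun x => repr u x * h x) + cintegral (fun x => repr v x * h x).
Proof.
move=> hL; rewrite -cintegral_lin; try exact: cintegrableM (sqintP _) hL.
rewrite (@eq_cintegralM _ (fun x => c * repr u x + repr v x))//.
- by congr cintegral; apply/funext => x; rewrite mulrDl mulrA.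
- exact: sqintP.
- exact: (L2fun_submod_closed.2 c _ _ (sqintP (repr u)) (sqintP (repr v))).
- exact: repr_L2P.
Qed.

Lemma in_DS_submod_closed a q : submod_closed (in_DS a q).
Proof.
have F := ae_filter_ringOfSetsType mu.
have mulP (m : R -> R) c u v : in_L2 (fun x => (m x)%:C * repr u x) ->
    in_L2 (fun x => (m x)%:C * repr v x) ->
    in_L2 (fun x => (m x)%:C * repr (c *: u + v) x).
  move=> [u1 mu1] [v1 mv1]; exists (c *: u1 + v1).
  have h1 := @filterI _ _ F _ _ mu1 mv1.
  have h2 := @filterI _ _ F _ _ (repr_L2P c u1 v1) (repr_L2P c u v).
  apply: (@filterS2 _ _ F _ _ _ _ h1 h2) => x [e1 e2] [-> ->].
  by rewrite e1 e2 mulrDr mulrCA.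
have null (m : R -> R) : in_L2 (fun x => (m x)%:C * repr (0 : L2 R) x).
  have r0 : {ae mu, forall x, repr (0 : L2 R) x = 0}.
    have := repr_L2P (-1) 0 (0 : L2 R); rewrite scaler0 addr0.
    by apply: (@filterS _ _ F) => x ->; rewrite mulN1r addNr.
  by exists 0; apply: (@filterS _ _ F _ _ _ r0) => x ->; rewrite mulr0.
split.
  apply/asboolP; split; [|exact: null|exact: null].
  exists 0 => phi.
  have z (h : R -> R[i]) : h \in L2fun ->
      cintegral (fun x => repr (0 : L2 R) x * h x) = 0.
    move=> hL; have := cintegral_repr (-1) 0 0 hL.
    by rewrite scaler0 addr0 mulN1r addNr.
  by rewrite !z ?oppr0//; [exact: (test_L2fun (test_derive phi))|exact: (test_L2fun phi)].
move=> c u v /asboolP[[u' uu'] uq ua] /asboolP[[v' vv'] vq va].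
apply/asboolP; split; [|exact: mulP|exact: mulP].
exists (c *: u' + v') => phi.
rewrite !cintegral_repr ?uu' ?vv' ?mulrN ?opprD//; try exact: (test_L2fun phi);
  exact: (test_L2fun (test_derive phi)).
Qed.

HB.instance Definition _ a q :=
  GRing.isSubmodClosed.Build _ _ (in_DS a q) (in_DS_submod_closed a q).

Record DS a q := MkDS { DS_val :> L2 R; DSP : DS_val \in in_DS a q }.
HB.instance Definition _ a q := [isSub for @DS_val a q].
HB.instance Definition _ a q := gen_eqMixin (DS a q).
HB.instance Definition _ a q := gen_choiceMixin (DS a q).
HB.instance Definition _ a q := [SubChoice_isSubLmodule of DS a q by <:].

(* The embedding of test functions in DS: for smooth a and q the default value
   of insubd is never used, see test_DSE. *)
Definition test_DS a q f : DS a q := insubd 0 (test_L2 f).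

Lemma test_weak_derivative f : weak_derivative (test_L2 f) (test_L2 (test_derive f)).
Proof.
move=> phi.
rewrite (eq_cintegralM (sqintP _) (test_L2fun f) (test_L2fun (test_derive phi)) (repr_test_L2 f)).
rewrite (eq_cintegralM (sqintP _) (test_L2fun (test_derive f)) (test_L2fun phi) (repr_test_L2 _)).
have /asboolP[fr fi _] := testP f; have /asboolP[pr pi _] := testP phi.
have [M M0 f0] := test_bound f.
have fr0 x : M <= `|x| -> complex.Re (f x) = 0 by move=> /f0 ->.
have fi0 x : M <= `|x| -> complex.Im (f x) = 0 by move=> /f0 ->.
have I (h k : R -> R) : h \in Lfun mu 2%:E -> k \in Lfun mu 2%:E ->
  mu.-integrable setT (EFin \o (fun x => h x * k x)).
  by move=> hL kL; have /Lfun1_integrable := Lfun2_mul_Lfun1 hL kL.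
have /andP[f1 f2] := test_L2fun f.
have /andP[p1 p2] := test_L2fun phi.
have /andP[f1' f2'] := test_L2fun (test_derive f).
have /andP[p1' p2'] := test_L2fun (test_derive phi).
rewrite /cintegral.
rewrite (_ : (fun x => complex.Re (f x * _)) = fun x =>
  complex.Re (f x) * complex.Re (test_derive phi x) -
  complex.Im (f x) * complex.Im (test_derive phi x)); last first.
  by apply/funext => x /=; case: (f x).
rewrite (_ : (fun x => complex.Im (f x * _)) = fun x =>
  complex.Re (f x) * complex.Im (test_derive phi x) +
  complex.Im (f x) * complex.Re (test_derive phi x)); last first.
  by apply/funext => x /=; case: (f x).
rewrite (_ : (fun x => complex.Re (_ * phi x)) = fun x =>
  complex.Re (test_derive f x) * complex.Re (phi x) -
  complex.Im (test_derive f x) * complex.Im (phi x)); last first.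
  by apply/funext => x /=; case: (phi x).
rewrite (_ : (fun x => complex.Im (_ * phi x)) = fun x =>
  complex.Re (test_derive f x) * complex.Im (phi x) +
  complex.Im (test_derive f x) * complex.Re (phi x)); last first.
  by apply/funext => x /=; case: (phi x).
rewrite !RintegralB//; try exact: I; rewrite !RintegralD//; try exact: I.
rewrite /= (derive_by_parts M0 fr pr fr0) (derive_by_parts M0 fi pi fi0).
rewrite (derive_by_parts M0 fr pi fr0) (derive_by_parts M0 fi pr fi0).
by apply/eqP; rewrite eq_complex /= !opprD !eqxx.
Qed.

Lemma test_in_DS a q f : smooth a -> smooth q -> test_L2 f \in in_DS a q.
Proof.
move=> sa sq; have /asboolP[fr fi _] := testP f.
have [M M0 f0] := test_bound f.
have F := ae_filter_ringOfSetsType mu.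
have key (m : R -> R) : smooth m -> in_L2 (fun x => (Num.sqrt (m x))%:C * repr (test_L2 f) x).
  move=> sm.
  have mL : (fun x => (Num.sqrt (m x))%:C * f x) \in L2fun.
    have cm : continuous (fun x => Num.sqrt (m x)).
      by move=> x; apply: continuous_comp; [exact: smooth_continuous|exact: sqrt_continuous].
    have E (x : R) : (Num.sqrt (m x))%:C * f x =
       (Num.sqrt (m x) * complex.Re (f x)) +i* (Num.sqrt (m x) * complex.Im (f x)).
      by case: (f x) => b c; apply/eqP; rewrite eq_complex /= !mul0r subr0 addr0 !eqxx.
    apply: (@zero_outside_L2fun _ _ M).
    - rewrite (_ : (fun x => _) = (fun x => Num.sqrt (m x)) \* (fun x => complex.Re (f x))).
        by move=> x; apply: continuousM; [exact: cm|exact: smooth_continuous].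
      by apply/funext => x; rewrite E.
    - rewrite (_ : (fun x => _) = (fun x => Num.sqrt (m x)) \* (fun x => complex.Im (f x))).
        by move=> x; apply: continuousM; [exact: cm|exact: smooth_continuous].
      by apply/funext => x; rewrite E.
    - by move=> x /f0 ->; rewrite mulr0.
  exists (\pi_(L2 R) (Sqint mL)).
  have : {ae mu, forall x, repr (\pi_(L2 R) (Sqint mL)) x = (Num.sqrt (m x))%:C * f x}.
    have /asboolP: repr (\pi_(L2 R) (Sqint mL)) - Sqint mL \in ae_null.
      by rewrite Quotient.idealrBE reprK.
    by apply: (@filterS _ _ F) => x /=; rewrite !fctE => /eqP; rewrite subr_eq0 => /eqP.
  by move=> h; apply: (@filterS2 _ _ F _ _ _ _ h (repr_test_L2 f)) => x -> ->.
apply/asboolP; split; [|exact: key|exact: key].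
by exists (test_L2 (test_derive f)); exact: test_weak_derivative.
Qed.

Lemma test_DSE a q f : smooth a -> smooth q -> DS_val (test_DS a q f) = test_L2 f.
Proof.
by move=> sa sq; rewrite /test_DS -[LHS]/(val _) insubdK//; exact: test_in_DS.
Qed.
End spaces.

Section operators.
Context {R : realType}.

Section generic.
Context {X Y : lmodType R[i]} (nX : X -> R) (nY : Y -> R).

Definition bounded_linear (T : X -> Y) :=
  linear T /\ exists M : R, forall x, nY (T x) <= M * nX x.
End generic.

(* W is a completion of V: complete, and V embeds isometrically and densely.
   If nV is a pre-Hilbert norm, W is a Hilbert space. *)
Definition completion_of (V : lmodType R[i]) (nV : V -> R)
    (W : completeNormedModType R[i]) (iota : {linear V -> W}) :=
  (forall f, `|iota f| = (nV f)%:C) /\ dense (range iota).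

(* Only the values of opmap on opdom are meaningful. *)
Record operator (V : lmodType R[i]) :=
  Operator { opdom : set V; opmap :> V -> V }.

Section resolvent.
Context {V : lmodType R[i]} (nV : V -> R).

Definition opnorm (S : V -> V) : \bar R :=
  ereal_sup [set (nV (S x))%:E | x in [set x | nV x <= 1]].

Definition shifted (T : operator V) (z : R[i]) (x : V) : V := T x - z *: x.

Definition resolvent (T : operator V) (z : R[i]) : V -> V :=
  'pinv_(fun=> 0) (opdom T) (shifted T z).

Definition resolvent_set (T : operator V) : set R[i] :=
  [set z | set_bij (opdom T) setT (shifted T z) /\
           (opnorm (resolvent T z) < +oo)%E].
End resolvent.

Section spaces2.
Variables a q : R -> R.
Implicit Types (f g : test R) (d e : DS a q).

Definition weight_integral (m : R -> R) (h k : R -> R[i]) : R[i] :=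
  cintegral (fun x => (m x)%:C * (h x * (k x)^*%C)).

Definition W_ip f g : R[i] :=
  cintegral (fun x => cderive f x * (cderive g x)^*%C) + weight_integral q f g.
Definition W_norm f : R := Num.sqrt (complex.Re (W_ip f f)).

(* Weak derivatives are unique in L2; for u without one, the value 0 is junk. *)
Definition weak_der (u : L2 R) : L2 R := xget 0 [set v | weak_derivative u v].

Definition DS_ip d e : R[i] :=
  L2_ip (weak_der d) (weak_der e) + weight_integral q (repr (d : L2 R)) (repr (e : L2 R)) +
  weight_integral a (repr (d : L2 R)) (repr (e : L2 R)) + L2_ip d e.
Definition DS_norm d : R := Num.sqrt (complex.Re (DS_ip d d)).

Definition in_DSdual : {pred DS a q -> R[i]} := fun l =>
  `[< (forall c d e, l (c *: d + e) = c^*%C * l d + l e) /\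
      exists M : R, forall d, `|l d| <= (M * DS_norm d)%:C >].

Lemma in_DSdual_submod_closed : submod_closed in_DSdual.
Proof.
split.
  apply/asboolP; split; first by move=> c d e; rewrite mulr0 addr0.
  by exists 0 => d; rewrite normr0 mul0r.
move=> c k l /asboolP[kl [M kM]] /asboolP[ll [N lN]]; apply/asboolP; split.
  move=> b d e; rewrite !fctE kl ll /GRing.scale /=.
  by rewrite !mulrDr addrACA; congr (_ + _ + _); rewrite mulrCA.
exists (complex.Re `|c| * M + N) => d.
rewrite !fctE (le_trans (ler_normD _ _))// mulrDl rmorphD lerD//.
rewrite normrM -mulrA rmorphM ler_pM// ?RRe_real//.
Qed.

HB.instance Definition _ :=
  GRing.isSubmodClosed.Build _ _ in_DSdual in_DSdual_submod_closed.

Record DSdual := MkDSdual { DSdual_fun :> DS a q -> R[i];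
                            DSdualP : DSdual_fun \in in_DSdual }.
HB.instance Definition _ := [isSub for DSdual_fun].
HB.instance Definition _ := gen_eqMixin DSdual.
HB.instance Definition _ := gen_choiceMixin DSdual.
HB.instance Definition _ := [SubChoice_isSubLmodule of DSdual by <:].

Definition DSdual_norm (l : DSdual) : R :=
  sup [set complex.Re `|l d| | d in [set d | DS_norm d <= 1]].

(* l is the image of w under the embedding L2 -> DSdual. *)
Definition embeds_H2 (l : DSdual) (w : L2 R) := forall g : DS a q, l g = L2_ip w g.

Section generator.
Variables (H1 : completeNormedModType R[i]) (iota : {linear test R -> H1}).

Definition H1_norm (u : H1) : R := complex.Re `|u|.

(* dxxq, mul_a and DS_H1 are the unique bounded extensions, from test functions,
   of d^2/dx^2 - q, of multiplication by a, and of the embedding of DS in H1;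
   uniqueness holds because test functions are dense in H1 and in DS. *)
Definition dxxq : H1 -> DSdual := xget (fun=> 0)
  [set T | bounded_linear H1_norm DSdual_norm T /\
           forall f g, T (iota f) (test_DS a q g) = - W_ip f g].

Definition mul_a : DS a q -> DSdual := xget (fun=> 0)
  [set T | bounded_linear DS_norm DSdual_norm T /\
           forall f g, T (test_DS a q f) (test_DS a q g) = weight_integral a f g].

Definition DS_H1 : DS a q -> H1 := xget (fun=> 0)
  [set T | bounded_linear DS_norm H1_norm T /\
           forall f, T (test_DS a q f) = iota f].

Definition H_norm (u : H1 * L2 R) : R :=
  Num.sqrt (H1_norm u.1 ^+ 2 + L2_norm u.2 ^+ 2).

(* On the domain, d is the element of DS underlying u.2 and w the element of L2
   that represents (d^2/dx^2 - q) u.1 - 2 a u.2. *)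
Definition wave_generator : operator (H1 * L2 R)%type := Operator
  [set u | exists d : DS a q, DS_val d = u.2 /\
     exists w, embeds_H2 (dxxq u.1 - 2%:R *: mul_a d) w]
  (fun u => let d : DS a q := insubd 0 u.2 in
     (DS_H1 d, xget 0 [set w | embeds_H2 (dxxq u.1 - 2%:R *: mul_a d) w])).
End generator.
End spaces2.

End operators.

Arguments H_norm {R} H1 u.

(* Main.v *)
(* Upper bound. For u = (v, w) and (G - lambda) u = (F, g), put z = v' and y = sqrt q v. Testing
   the equation with w itself gives |z|^2 + |y|^2 = |w|^2 up to O(1/|b|),
   and bounds the L2 norm of sqrt a w, hence of w where a is large, that is near infinity. On
   bounded sets y = O(1/|b|), and the modulus of w +- z satisfies a transport equation with rate
   +-(a - c). Testing it against e^(+-h) chi, where the barrier h increases so fast where a is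
   not large that h' + 2 (a - c) >= 1 everywhere, and where chi is a slowly varying cut-off,
   bounds w +- z inside. The a priori bound being uniform in c, solvability is propagated from
   lambda = 1 by the continuity method.

   Lower bound. For a fixed test function phi and h = e^(ibx) phi, the vector (h, lambda h) has
   norm at least |lambda| |phi|, while (G - lambda) (h, lambda h) = (0, g) with g = O(|lambda|),
   because b^2 + lambda^2 = O(|lambda|). *)
Require Import Defs.
From HB Require Import structures.
From mathcomp Require Import all_boot all_order all_algebra.
From mathcomp Require Import all_classical all_reals all_analysis.
From mathcomp Require Import measurable_realfun complex.
From mathcomp Require Import ring lra.
Set Implicit Arguments.
Unset Strict Implicit.
Unset Printing Implicit Defensive.
Import Order.TTheory GRing.Theory Num.Theory.
Import numFieldNormedType.Exports.
Local Open Scope complex_scope.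
Local Open Scope ring_scope.
Local Open Scope quotient_scope.
Local Open Scope classical_set_scope.

(** * Smooth functions and cut-offs *)

Section smooth_functions.
Context {R : realType}.
Implicit Types f g : R -> R.

(** A compactly supported [m] makes [m z] an element of [DS] and turns [a], [q] and their roots into
    bounded factors; the price is a term in [m'].

    Two circularities have to be avoided. The weights [e^(+-h) chi] cost a factor [e^(2 sup |h|)],
    which the small slope of [chi] must beat: the barrier [h] is locally constant outside a fixed
    ball, so that its bound is known before the radius of [chi] is chosen. Moreover the errors have
    size [n^2 / |b| + n f], with [n] the norm of the solution and [f] that of the data; all
    contributions proportional to [n^2] must add up to a fraction of [n^2], whence the numerical
    shares 1/32 and 1/8, and the lower bound on [|b|] is imposed last. *)

Lemma is_derive_quad g (x l C d : R) : 0 < d ->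
  (forall h, `|h| < d -> `|g (x + h) - g x - l * h| <= C * h ^+ 2) ->
  is_derive x 1 g l.
Proof.
move=> d0 H.
have C0 : 0 <= C.
  have d2 : 0 < d / 2 by rewrite divr_gt0.
  have dd : `|d / 2| < d by rewrite gtr0_norm// ltr_pdivrMr// mulr_natr mulr2n ltrDl.
  by have := le_trans (normr_ge0 _) (H _ dd); rewrite pmulr_lge0// exprn_gt0.
have cv : h^-1 *: ((g \o shift x) (h *: 1) - g x) @[h --> 0^'] --> l.
  apply/cvgrPdist_le => e e0.
  near=> h.
  have h0 : h != 0 by near: h; exact: nbhs_dnbhs_neq.
  have hd : `|h| < d by near: h; apply: dnbhs0_lt.
  have hC : `|h| < e / (C + 1) by near: h; apply: dnbhs0_lt; rewrite divr_gt0// ltr_wpDl.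
  rewrite /GRing.scale /= mulr1 addrC [h + x]addrC.
  rewrite (_ : - _ + l = - (h^-1 * (g (x + h) - g x - l * h))); last first.
    by rewrite !mulrBr [l * h]mulrC mulKf//; ring.
  rewrite normrN normrM normfV ler_pdivrMl ?normr_gt0//.
  apply: le_trans (H _ hd) _; rewrite -[h ^+ 2]real_normK ?num_real// expr2.
  rewrite mulrCA ler_wpM2l//; apply: le_trans (ler_wpM2l C0 (ltW hC)) _.
  by rewrite mulrA ler_pdivrMr ?ltr_wpDl// mulrDr mulr1 mulrC lerDl ltW.
have dg : derivable g x 1 by apply/cvg_ex; exists l.
by split => //; apply/cvg_lim.
Unshelve. all: by end_near. Qed.

(** By induction every iterated derivative stays in the class [C]. Smoothness thus reduces to
    exhibiting a class stable under derivation, without any formula for derivatives of higher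
    order. *)
Lemma smooth_coind (C : (R -> R) -> Prop) :
  (forall g, C g -> exists2 g', C g' & forall x : R, is_derive x 1 g (g' x)) ->
  forall g, C g -> smooth g.
Proof.
move=> H g Cg.
have Cn n : C (g^`(n))%classic.
  elim: n => [//|n /H[g' Cg' dg']]; rewrite derive1nS.
  by rewrite (_ : _^`() = g')//; apply/funext => x; rewrite derive1E; apply: derive_val.
by move=> n x; have [g' _ dg'] := H _ (Cn n); have [] := dg' x.
Qed.

Lemma smooth_is_derive g (x : R) : smooth g -> is_derive x 1 g (g^`()%classic x).
Proof. by move=> sg; split; [exact: (sg 0%N)|rewrite derive1E]. Qed.

Local Opaque smooth.

Lemma is_derive_ext f g (x a b : R) : is_derive x 1 f a -> f =1 g -> a = b ->
  is_derive x 1 g b.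
Proof. by move=> + /funext <- <-. Qed.

(** Unlike single products, sums of products are stable under derivation, as [smooth_coind]
    requires. *)
Inductive prod_sums : (R -> R) -> Prop :=
| PSmul f g : smooth f -> smooth g -> prod_sums (fun x => f x * g x)
| PSadd f g : prod_sums f -> prod_sums g -> prod_sums (fun x => f x + g x).

Lemma smooth_prod_sums g : prod_sums g -> smooth g.
Proof.
apply: smooth_coind => {}g; elim => [{}f {}g sf sg|{}f {}g _ [f' Pf' df'] _ [g' Pg' dg']].
  exists (fun x => f x * g^`()%classic x + f^`()%classic x * g x).
    exact: (PSadd (PSmul sf (smooth_derive sg)) (PSmul (smooth_derive sf) sg)).
  move=> x; apply: (is_derive_ext (is_deriveM (smooth_is_derive x sf) (smooth_is_derive x sg))); first by [].
  by rewrite /GRing.scale /= [g x * _]mulrC.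
exists (fun x => f' x + g' x); first exact: PSadd.
by move=> x; exact: (is_derive_ext (is_deriveD (df' x) (dg' x))).
Qed.

Lemma smoothM f g : smooth f -> smooth g -> smooth (fun x => f x * g x).
Proof. by move=> sf sg; apply: smooth_prod_sums; exact: PSmul. Qed.

Lemma smooth_cst (c : R) : smooth (fun=> c).
Proof.
apply: (@smooth_coind (fun g => exists k, g = fun=> k)); last by exists c.
move=> _ [k ->]; exists (fun=> 0); first by exists 0.
by move=> x; exact: is_derive_cst.
Qed.

Lemma smoothD f g : smooth f -> smooth g -> smooth (fun x => f x + g x).
Proof.
move=> sf sg; have := smooth_lin (c := 1) sf sg; congr smooth.
by apply/funext => x; rewrite !fctE scale1r.
Qed.

Lemma smoothZ c f : smooth f -> smooth (fun x => c * f x).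
Proof. by move=> sf; exact: (smoothM (@smooth_cst c) sf). Qed.

Lemma smoothN f : smooth f -> smooth (fun x => - f x).
Proof.
by move=> /(@smoothZ (-1)); congr smooth; apply/funext => x; rewrite mulN1r.
Qed.

Lemma smoothB f g : smooth f -> smooth g -> smooth (fun x => f x - g x).
Proof. by move=> sf sg; exact: (smoothD sf (smoothN sg)). Qed.

Lemma smooth_affine f (al be : R) : smooth f -> smooth (fun x => f (al * x + be)).
Proof.
move=> sf.
(* The scalar [k] absorbs the powers of [al] that the chain rule produces. *)
apply: (@smooth_coind (fun g => exists k h, smooth h /\ g = fun x => k * h (al * x + be))); last first.
  by exists 1, f; split => //; apply/funext => x; rewrite mul1r.
move=> _ [k [h [sh ->]]]; exists (fun x => (k * al) * h^`()%classic (al * x + be)).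
  by exists (k * al), h^`()%classic; split; [exact: (smooth_derive sh)|].
move=> x.
have d1 : is_derive x 1 (fun y : R => al * y + be) al.
  apply: (is_derive_ext (is_deriveD (is_deriveZ al (is_derive_id x 1)) (is_derive_cst be x 1))); first by [].
  by rewrite addr0 /GRing.scale /= mulr1.
have D := is_deriveZ k (@is_derive1_comp R h (fun y => al * y + be) x _ _ (smooth_is_derive (al * x + be) sh) d1).
apply: (is_derive_ext D); first by [].
by rewrite /GRing.scale /=; ring.
Qed.

Lemma smooth_exp_comp h : smooth h -> smooth (fun x : R => expR (h x)).
Proof.
move=> sh.
apply: (@smooth_coind (fun g => exists2 f, smooth f & g = fun x => f x * expR (h x))); last first.
  by exists (fun=> 1); [exact: smooth_cst|apply/funext => x; rewrite mul1r].
move=> _ [f sf ->]; exists (fun x => (f^`()%classic x + f x * h^`()%classic x) * expR (h x)).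
  exists (fun x => f^`()%classic x + f x * h^`()%classic x); last by [].
  exact: (smoothD (smooth_derive sf) (smoothM sf (smooth_derive sh))).
move=> x; apply: (is_derive_ext (is_deriveM (smooth_is_derive x sf)
  (@is_derive1_comp R expR h x _ _ (is_derive_expR (h x)) (smooth_is_derive x sh)))) => //.
by rewrite /GRing.scale /=; ring.
Qed.

Lemma smooth_cos_sin : smooth (@cos R) /\ smooth (@sin R).
Proof.
suff H : forall g, (exists k l : R, g = fun x => k * cos x + l * sin x) -> smooth g.
  split; apply: H.
    by exists 1, 0; apply/funext => x; rewrite mul1r mul0r addr0.
  by exists 0, 1; apply/funext => x; rewrite mul1r mul0r add0r.
apply: smooth_coind => _ [k [l ->]].
exists (fun x => l * cos x + - k * sin x); first by exists l, (- k).
move=> x.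
apply: (is_derive_ext (is_deriveD (is_deriveZ k (is_derive_cos x)) (is_deriveZ l (is_derive_sin x)))); first by [].
by rewrite /GRing.scale /=; ring.
Qed.

(* The family P(1/x) e^(-1/x), P a polynomial, is stable under derivation: it consists
   of smooth functions flat at 0, the germ of every cut-off below. *)
Definition flat_at0 (P : {poly R}) (x : R) : R :=
  if 0 < x then P.[x^-1] * expR (- x^-1) else 0.

Lemma horner_le_pow (P : {poly R}) : exists2 A : R, 0 <= A &
  forall t, 1 <= t -> `|P.[t]| <= A * t ^+ size P.
Proof.
exists (\sum_(i < size P) `|P`_i|); first exact: sumr_ge0.
move=> t t1; rewrite horner_coef (le_trans (ler_norm_sum _ _ _))// mulr_suml.
apply: ler_sum => i _; rewrite normrM ler_wpM2l// normrX ger0_norm ?(le_trans _ t1)//.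
by rewrite ler_weXn2l// ltnW.
Qed.

(** With [t = 1/x], the single term of order [size P + 2] of the exponential series dominates
    [t^2 P(t)]. The quadratic bound yields derivability at 0, with derivative 0. *)
Lemma flat_at0_quad P : exists2 C : R, 0 <= C &
  forall x, x < 1 -> `|flat_at0 P x| <= C * x ^+ 2.
Proof.
have [A A0 HA] := horner_le_pow P.
set n := size P in HA.
exists (A * (n.+2)`!%:R); first by rewrite mulr_ge0.
move=> x x1; rewrite /flat_at0; case: ifPn => [x0|_]; last first.
  by rewrite normr0 mulr_ge0 ?sqr_ge0// mulr_ge0.
set t := x^-1; have t1 : 1 <= t by rewrite invf_ge1// ltW.
have t0 : 0 < t by rewrite invr_gt0.
rewrite normrM (ger0_norm (expR_ge0 _)) expRN ler_pdivrMr ?expR_gt0//.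
apply: (le_trans (HA _ t1)).
have : t ^+ n.+2 / (n.+2)`!%:R <= expR t.
  by apply: le_trans (expR_ge1Dxn n.+1 (ltW t0)); rewrite lerDr.
rewrite ler_pdivrMr ?ltr0n ?fact_gt0// => E.
have -> : x ^+ 2 = (t ^+ 2)^-1 by rewrite /t exprVn invrK.
rewrite -mulrA -mulrA ler_wpM2l// -mulrA mulrCA ler_pdivlMl ?exprn_gt0// -exprD add2n.
by rewrite [X in _ <= X]mulrC.
Qed.

Lemma flat_at0_derive (P : {poly R}) (x : R) :
  is_derive x 1 (flat_at0 P) (flat_at0 ('X ^+ 2 * (P - P^`())) x).
Proof.
have [x0|x0|x0] := ltgtP x 0.
- rewrite {2}/flat_at0 ltNge (ltW x0) /=.
  apply: (@is_derive_quad _ _ _ 0 (- x)); first by rewrite oppr_gt0.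
  move=> h hx; rewrite /flat_at0.
  have -> : (0 < x + h) = false.
    by apply/negP; rewrite -subr_lt0 => k; have := ler_norm h; lra.
  have -> : (0 < x) = false by apply/negP; lra.
  by rewrite !mul0r !subr0 normr0.
- rewrite {2}/flat_at0 x0.
  have xn0 : x != 0 by rewrite gt_eqF.
  have d1 : is_derive x 1 (fun y : R => y^-1) (- x ^- 2).
    apply: (is_derive_ext (is_deriveV (f := id) xn0 (is_derive_id x 1))); first by [].
    by rewrite /GRing.scale /= mulr1.
  have d2 := @is_derive1_comp R (horner P) (fun y => y^-1) x _ _ (is_derive_poly P x^-1) d1.
  have d3 := @is_derive1_comp R expR (fun y => - y^-1) x _ _ (is_derive_expR (- x^-1)) (is_deriveN d1).
  have D := is_deriveM d2 d3.
  have E : {near x, (fun y => P.[y^-1] * expR (- y^-1)) =1 flat_at0 P}.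
    near=> y; rewrite /flat_at0.
    have -> // : 0 < y by near: y; exact: lt_nbhsr.
  apply: (near_eq_is_derive E) => //.
  apply: (is_derive_ext D); first by [].
  rewrite /GRing.scale /= !(hornerE, hornerXn) /= -exprVn; ring.
- rewrite {2}/flat_at0 x0 ltxx.
  have [C C0 HC] := flat_at0_quad P.
  apply: (@is_derive_quad _ _ _ C 1) => // h h1.
  rewrite add0r mul0r subr0 /flat_at0 ltxx subr0.
  apply: HC; exact: le_lt_trans (ler_norm _) h1.
Unshelve. all: by end_near. Qed.

Lemma smooth_flat_at0 P : smooth (flat_at0 P).
Proof.
apply: (@smooth_coind (fun g => exists P, g = flat_at0 P)); last by exists P.
move=> _ [Q ->]; exists (flat_at0 ('X ^+ 2 * (Q - Q^`()))); first by eexists.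
by move=> x; exact: flat_at0_derive.
Qed.

End smooth_functions.

(** * Steps, cut-offs and barriers *)

Section cutoffs.
Context {R : realType}.
Local Notation mu := (@lebesgue_measure R).
Implicit Types f g : R -> R.
Local Opaque smooth.

Lemma derive1_is f (x l : R) : is_derive x 1 f l -> f^`()%classic x = l.
Proof. by move=> H; rewrite derive1E; exact: derive_val. Qed.

Lemma smooth_mono g (a b : R) : smooth g ->
  (forall x, a < x < b -> 0 <= g^`()%classic x) ->
  forall x y, a <= x -> x <= y -> y <= b -> g x <= g y.
Proof.
move=> sg g0; apply: ger0_derive1_ndecr.
- by move=> x _; have [] := smooth_is_derive x sg.
- by move=> x; rewrite in_itv /=; exact: g0.
- exact: (continuous_subspaceT (smooth_continuous sg)).
Qed.

Lemma smooth_const g (a b : R) : smooth g ->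
  (forall x, a < x < b -> g^`()%classic x = 0) ->
  forall x y, a <= x -> x <= y -> y <= b -> g x = g y.
Proof.
move=> sg g0 x y ax xy yb; apply/eqP; rewrite eq_le; apply/andP; split.
  by apply: (smooth_mono sg _ ax xy yb) => z /g0 ->.
rewrite -lerN2.
apply: (@smooth_mono (fun x => - g x) a b (smoothN sg) _ x y) => // z /g0 gz.
by rewrite (derive1_is (is_deriveN (smooth_is_derive z sg))) gz oppr0.
Qed.

Lemma integrable_itv g (a b : R) : continuous g ->
  mu.-integrable `[a, b] (EFin \o g).
Proof.
move=> cg; apply: continuous_compact_integrable; first exact: segment_compact.
exact: continuous_subspaceT.
Qed.

Lemma smooth_primitive g (m : R) : smooth g -> (forall x, x <= m -> g x = 0) ->
  exists G : R -> R, [/\ smooth G, forall x : R, G^`()%classic x = g x,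
    forall x, x <= m -> G x = 0 & forall x, G x = \int[mu]_(t in `[m - 1, x]) g t].
Proof.
(* The lower end [m - 1], instead of [m], keeps [x = m] in the interior of the interval of
   integration, where the fundamental theorem of calculus applies. *)
move=> sg g0; pose G x := \int[mu]_(t in `[m - 1, x]) g t; exists G.
have cg := smooth_continuous sg.
have G0 x : x <= m -> G x = 0.
  move=> xm; rewrite /G (@eq_Rintegral _ _ _ mu _ (fun=> 0)).
    by rewrite /Rintegral integral0.
  by move=> t; rewrite inE /= in_itv /= => /andP[_ tx]; rewrite g0// (le_trans tx).
have dG (x : R) : is_derive x 1 G (g x).
  have [xm|mx] := ltP x m.
    rewrite g0; last exact: ltW.
    apply: (near_eq_is_derive (f := (fun=> 0 : R))).
    near=> y; rewrite G0//; apply: ltW; near: y; exact: lt_nbhsl.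
  have [||d e] := @continuous_FTC1_closed R g (m - 1) x (x + 1) _ (integrable_itv _ _ cg) _ (cg x).
    by rewrite ltrDl.
    lra.
  by split; [exact: d|rewrite -derive1E; exact: e].
split; [|by move=> x; apply: derive1_is; exact: dG|exact: G0|by []].
apply: (@smooth_coind R (fun f => f = G \/ smooth f)); last by left.
move=> f [->|sf].
  by exists g; [right|exact: dG].
by exists f^`()%classic; [right; exact: smooth_derive|move=> x; exact: smooth_is_derive].
Unshelve. all: by end_near. Qed.

Lemma smooth_bump : exists2 g : R -> R, smooth g &
  [/\ forall x, 0 <= g x, forall x, 0 < x < 1 -> 0 < g x & forall x, ~~ (0 < x < 1) -> g x = 0].
Proof.
exists (fun x => flat_at0 1 x * flat_at0 1 (-1 * x + 1)).
  have sf := @smooth_flat_at0 R 1.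
  exact: (smoothM sf (smooth_affine sf)).
have E (x : R) : 0 < (-1 * x + 1) = (x < 1) by rewrite mulN1r addrC subr_gt0.
split => x; rewrite /flat_at0 E !hornerC !mul1r.
- by case: ifP => _; [case: ifP => _|]; rewrite ?mulr0 ?mul0r// mulr_ge0 ?expR_ge0.
- by move=> /andP[-> ->]; rewrite mulr_gt0 ?expR_gt0.
- by rewrite negb_and => /orP[/negPf ->|/negPf ->]; rewrite ?mul0r ?mulr0.
Qed.

(** A normalised primitive of a bump. *)
Lemma smooth_step : exists2 g : R -> R, smooth g &
  [/\ forall x, 0 <= g x <= 1, forall x, x <= 0 -> g x = 0 & forall x, 1 <= x -> g x = 1].
Proof.
have [be sb [b0 bp bz]] := smooth_bump.
have bz0 x : x <= 0 -> be x = 0 by move=> x0; rewrite bz// negb_and -leNgt x0.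
have [G [sG dG G0 _]] := smooth_primitive sb bz0.
have mono x y : x <= y -> G x <= G y.
  by move=> xy; apply: (@smooth_mono _ x y sG) => // z _; rewrite dG.
have cst x : 1 <= x -> G x = G 1.
  move=> x1; symmetry; apply: (@smooth_const _ 1 x sG) => // z /andP[z1 _].
  by rewrite dG bz// negb_and -!leNgt (ltW z1) orbT.
(* If [G 1] were 0, monotonicity would make [G] vanish on the unit interval and the bump would
   vanish at 1/2. *)
have G1 : 0 < G 1.
  rewrite lt_neqAle -{2}(G0 0 (lexx _)) mono// andbT eq_sym; apply/eqP => G10.
  have Gz : {near (2^-1 : R), G =1 fun=> 0}.
    near=> y; apply/eqP; rewrite eq_le -{1}G10 mono ?andTb; last first.
      by apply: ltW; near: y; apply: lt_nbhsl; lra.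
    rewrite -(G0 0)// mono//; apply: ltW; near: y; apply: lt_nbhsr; lra.
  have := dG (2^-1); rewrite derive1E (near_eq_derive _ Gz) derive_cst => E.
  have h : ((0 : R) < 2^-1) && ((2^-1 : R) < 1) by apply/andP; split; lra.
  by have := bp _ h; rewrite -E ltxx.
exists (fun x => (G 1)^-1 * G x); first exact: (smoothM (@smooth_cst _ _) sG).
split => x.
- rewrite mulr_ge0 ?invr_ge0 ?(ltW G1)//=; last first.
    have [x0|/ltW x0] := leP x 0; first by rewrite (G0 x x0).
    by have := mono 0 x x0; rewrite (G0 0 (lexx _)).
  rewrite ler_pdivrMl// mulr1; have [x1|/ltW/cst ->//] := leP x 1; exact: mono.
- by move=> /G0 ->; rewrite mulr0.
- by move=> /cst ->; rewrite mulVf// gt_eqF.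
Unshelve. all: by end_near. Qed.

Lemma continuous_bounded_outside g (M k : R) : continuous g ->
  (forall x, M <= `|x| -> `|g x| <= k) -> exists2 C : R, 0 < C & forall x, `|g x| <= C.
Proof.
move=> cg gk.
have cn : continuous (fun x => `|g x|).
  by move=> x; apply: continuous_comp (cg x) (@norm_continuous _ _ _).
have [|c _ Hc] := @compact_EVT_max _ R (fun x => `|g x|) `[- `|M|, `|M|] _ (@segment_compact _ _ _)
  (continuous_subspaceT cn).
  by exists 0; rewrite /= in_itv /= oppr_le0 normr_ge0.
exists (`|g c| + `|k| + 1); first by rewrite ltr_wpDl// addr_ge0.
move=> x; have [xM|xM] := leP `|x| `|M|.
  rewrite -addrA (le_trans (Hc x _))//; last by rewrite lerDl addr_ge0.
  by rewrite inE /= in_itv /= -ler_norml.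
apply: le_trans (gk x _) _; first exact: le_trans (ler_norm _) (ltW xM).
by rewrite (le_trans (ler_norm k))// addrAC lerDr addr_ge0.
Qed.

(** All cut-offs are dilations of one profile, so that [k] does not depend on [N] and the slope
    [k / N] is as small as desired. *)
Lemma smooth_cutoff : exists2 k : R, 0 < k & forall N : R, 0 < N ->
  exists2 g : R -> R, smooth g &
  [/\ forall x, 0 <= g x <= 1, forall x, `|x| <= N -> g x = 1,
      forall x, 2 * N <= `|x| -> g x = 0 & forall x, `|g^`()%classic x| <= k / N].
Proof.
have [st ss [s01 s0 s1]] := smooth_step.
pose u x := st (1 * x + 2) * st (-1 * x + 2).
have su : smooth u by exact: (smoothM (smooth_affine ss) (smooth_affine ss)).
have u1 x : `|x| <= 1 -> u x = 1.
  by rewrite ler_norml => /andP[x1 x2]; rewrite /u !s1 ?mulr1//; lra.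
have u0 x : 2 <= `|x| -> u x = 0.
  have [x0|x0] := leP 0 x.
    by rewrite ger0_norm// => x2; rewrite /u [X in _ * X]s0 ?mulr0//; lra.
  by rewrite ltr0_norm// => x2; rewrite /u s0 ?mul0r//; lra.
have u01 x : 0 <= u x <= 1.
  have /andP[a0 a1] := s01 (1 * x + 2); have /andP[b0 b1] := s01 (-1 * x + 2).
  by rewrite /u mulr_ge0//= mulr_ile1.
have u'0 x : 3 <= `|x| -> `|u^`()%classic x| <= 0.
  move=> x3; rewrite normr_le0; apply/eqP.
  apply: (@derive1_outside _ u [set x | `|x| <= 2]) => /=.
  - rewrite (_ : mkset _ = `[- 2, 2]); first exact: interval_closed.
    by apply/seteqP; split => y /=; rewrite in_itv /= ler_norml.
  - by move=> y /negP; rewrite -ltNge => /ltW /u0.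
  - by apply/negP; rewrite -ltNge; apply: lt_le_trans x3; rewrite ltr_nat.
have [k k0 Hk] := continuous_bounded_outside (smooth_continuous (smooth_derive su)) u'0.
exists k => // N N0.
exists (fun x => u (N^-1 * x + 0)); first exact: (smooth_affine su).
have nN x : `|N^-1 * x + 0| = `|x| / N by rewrite addr0 normrM gtr0_norm ?invr_gt0// mulrC.
split => x.
- exact: u01.
- by move=> xN; apply: u1; rewrite nN ler_pdivrMr// mul1r.
- by move=> xN; apply: u0; rewrite nN ler_pdivlMr.
- have d1 : is_derive x 1 (fun y : R => N^-1 * y + 0) N^-1.
    apply: (is_derive_ext (is_deriveD (is_deriveZ N^-1 (is_derive_id x 1)) (is_derive_cst 0 x 1))); first by [].
    by rewrite addr0 /GRing.scale /= mulr1.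
  have D := @is_derive1_comp R u (fun y => N^-1 * y + 0) x _ _ (smooth_is_derive _ su) d1.
  have -> := derive1_is D.
  by rewrite normrM (gtr0_norm (_ : 0 < N^-1)) ?invr_gt0// ler_wpM2r// invr_ge0 ltW.
Qed.

(** A primitive of [L] times a cut-off: it is constant on either side of a compact interval, hence
    bounded. It becomes the exponent of the multipliers in the interior estimate. *)
Lemma smooth_barrier (r L : R) : 0 < r -> 0 < L -> exists2 g : R -> R, smooth g &
  [/\ forall x, 0 <= g^`()%classic x, forall x, `|x| <= r -> L <= g^`()%classic x &
      exists2 H : R, 0 < H & forall x, `|g x| <= H].
Proof.
move=> r0 L0; have [k k0 /(_ r r0)[c sc [c01 c1 c0 _]]] := smooth_cutoff.
have sLc : smooth (fun x => L * c x) by exact: (smoothM (@smooth_cst _ _) sc).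
have z x : x <= - (2 * r) -> L * c x = 0.
  move=> xr; rewrite c0 ?mulr0// ler0_norm; last by apply: le_trans xr _; rewrite oppr_le0; lra.
  by rewrite lerNr.
have [G [sG dG G0 _]] := smooth_primitive sLc z.
exists G => //; split.
- by move=> x; rewrite dG mulr_ge0 ?(ltW L0)//; have /andP[] := c01 x.
- by move=> x xr; rewrite dG c1// mulr1.
- apply: (@continuous_bounded_outside _ (2 * r) `|G (2 * r)| (smooth_continuous sG)) => x.
  have [x0|x0] := leP 0 x.
    rewrite ger0_norm// => x2; rewrite (@smooth_const G (2 * r) x sG _ (2 * r) x)// => y /andP[y1 _].
    by rewrite dG c0 ?mulr0// ger0_norm ltW//; lra.
  by rewrite ltr0_norm// => x2; rewrite G0 ?normr0// lerNr.
Qed.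

End cutoffs.

(** * Pre-Hilbert spaces and the continuity method *)

Section complex_modulus.
Context {R : realType}.
Implicit Types c k : R[i].

(** The norm on [R[i]] takes values in [R[i]]; this is the same modulus in [R], where the order is
    total. *)
Definition cabs c : R := complex.Re `|c|.

Lemma cabsC c : `|c| = (cabs c)%:C.
Proof. by rewrite /cabs RRe_real// normr_real. Qed.

Lemma cabsE c : cabs c = Num.sqrt (complex.Re c ^+ 2 + complex.Im c ^+ 2).
Proof. by rewrite /cabs normc_def. Qed.

Lemma sqr_cabs c : cabs c ^+ 2 = complex.Re c ^+ 2 + complex.Im c ^+ 2.
Proof. by rewrite cabsE sqr_sqrtr// addr_ge0 ?sqr_ge0. Qed.

Lemma cabs_ge0 c : 0 <= cabs c.
Proof. by rewrite cabsE sqrtr_ge0. Qed.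

Lemma cabsM c k : cabs (c * k) = cabs c * cabs k.
Proof. by apply: complexI; rewrite -cabsC normrM !cabsC rmorphM. Qed.

Lemma cabsD c k : cabs (c + k) <= cabs c + cabs k.
Proof. by rewrite -lecR rmorphD /= -!cabsC ler_normD. Qed.

Lemma cabsN c : cabs (- c) = cabs c.
Proof. by rewrite /cabs normrN. Qed.

Lemma cabs_real (x : R) : cabs x%:C = `|x|.
Proof. by rewrite cabsE /= expr0n /= addr0 sqrtr_sqr. Qed.

Lemma cabs0 : cabs (0 : R[i]) = 0.
Proof. by rewrite /cabs normr0. Qed.

Lemma cabs_eq0 c : cabs c = 0 -> c = 0.
Proof. by move=> c0; apply/eqP; rewrite -normr_eq0 cabsC c0. Qed.

Lemma le_Re_cabs c : `|complex.Re c| <= cabs c.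
Proof. by rewrite cabsE -sqrtr_sqr ler_wsqrtr// lerDl sqr_ge0. Qed.

Lemma le_Im_cabs c : `|complex.Im c| <= cabs c.
Proof. by rewrite cabsE -sqrtr_sqr ler_wsqrtr// lerDr sqr_ge0. Qed.

Lemma cReD c k : complex.Re (c + k) = complex.Re c + complex.Re k.
Proof. by case: c k => [? ?] [? ?]. Qed.
Lemma cImD c k : complex.Im (c + k) = complex.Im c + complex.Im k.
Proof. by case: c k => [? ?] [? ?]. Qed.
Lemma cReN c : complex.Re (- c) = - complex.Re c.
Proof. by case: c. Qed.
Lemma cImN c : complex.Im (- c) = - complex.Im c.
Proof. by case: c. Qed.
Lemma cReM c k : complex.Re (c * k) =
  complex.Re c * complex.Re k - complex.Im c * complex.Im k.
Proof. by case: c k => [? ?] [? ?]. Qed.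
Lemma cImM c k : complex.Im (c * k) =
  complex.Re c * complex.Im k + complex.Im c * complex.Re k.
Proof. by case: c k => [? ?] [? ?]. Qed.
Lemma cReJ c : complex.Re c^*%C = complex.Re c.
Proof. by case: c. Qed.
Lemma cImJ c : complex.Im c^*%C = - complex.Im c.
Proof. by case: c. Qed.

Lemma cReZ (x : R) c : complex.Re (x%:C * c) = x * complex.Re c.
Proof. by rewrite [LHS]cReM /= mul0r subr0. Qed.
Lemma cImZ (x : R) c : complex.Im (x%:C * c) = x * complex.Im c.
Proof. by rewrite [LHS]cImM /= mul0r addr0. Qed.

Definition cReIm := (cReD, cImD, cReN, cImN, cReM, cImM, cReJ, cImJ).

Lemma complexP c k : complex.Re c = complex.Re k -> complex.Im c = complex.Im k -> c = k.
Proof. by case: c k => [? ?] [? ?] /= -> ->. Qed.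

End complex_modulus.

(** The discriminant argument behind Cauchy-Schwarz, for a complex coefficient [c1 + i c2]. The
    degenerate case [A = 0] belongs to it because the inner products below are only semi-definite; a
    large multiple of [(p1, p2)] then contradicts the hypothesis unless it is 0. *)
Lemma quad_discr (R : realFieldType) (A d p1 p2 : R) : 0 <= A ->
  (forall c1 c2, 0 <= d - 2 * (c1 * p1 + c2 * p2) + (c1 ^+ 2 + c2 ^+ 2) * A) ->
  p1 ^+ 2 + p2 ^+ 2 <= d * A.
Proof.
move=> A0 H; have [A_eq0|A_neq0] := eqVneq A 0.
  rewrite A_eq0 mulr0 leNgt; apply/negP => P0.
  set P := p1 ^+ 2 + p2 ^+ 2 in P0.
  pose t := (d + 1) / (2 * P).
  have := H (t * p1) (t * p2); rewrite A_eq0 mulr0 addr0.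
  rewrite (_ : 2 * _ = d + 1); first by lra.
  rewrite /t; have : P != 0 by rewrite gt_eqF.
  by rewrite /P => ?; field.
have Ap : 0 < A by rewrite lt_neqAle eq_sym A_neq0.
have := H (A^-1 * p1) (A^-1 * p2).
rewrite (_ : _ + _ * A = d - (p1 ^+ 2 + p2 ^+ 2) / A); last by field.
by rewrite subr_ge0 ler_pdivrMr.
Qed.

(** Stated for a bare function [n], since [L2], [DS] and [H1 * L2] carry their norms as plain
    real-valued functions. *)
Definition cauchy_complete {R : realType} {V : zmodType} (n : V -> R) :=
  forall u : nat -> V,
    (forall e, 0 < e -> exists N, forall i j, (N <= i)%N -> (N <= j)%N -> n (u i - u j) < e) ->
    exists l, forall e, 0 < e -> exists N, forall i, (N <= i)%N -> n (u i - l) < e.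

Section prehilbert.
Context {R : realType} {V : lmodType R[i]}.
Variable ip : V -> V -> R[i].

Record is_ip : Prop := IsIp {
  ip_lin : forall c u v w, ip (c *: u + v) w = c * ip u w + ip v w;
  ipC : forall u v, ip v u = (ip u v)^*%C;
  ip_ge0 : forall u, 0 <= complex.Re (ip u u) }.

Definition ipnorm u : R := Num.sqrt (complex.Re (ip u u)).

Hypothesis ipP : is_ip.

Lemma ip0l w : ip 0 w = 0.
Proof.
have := ip_lin ipP 1 0 0 w; rewrite scaler0 add0r mul1r => /eqP.
by rewrite -subr_eq0 opprD addrA subrr sub0r oppr_eq0 => /eqP.
Qed.
Lemma ipDl u v w : ip (u + v) w = ip u w + ip v w.
Proof. by have := ip_lin ipP 1 u v w; rewrite scale1r mul1r. Qed.
Lemma ipZl c u w : ip (c *: u) w = c * ip u w.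
Proof. by have := ip_lin ipP c u 0 w; rewrite addr0 ip0l addr0. Qed.
Lemma ipNl u w : ip (- u) w = - ip u w.
Proof. by rewrite -scaleN1r ipZl mulN1r. Qed.
Lemma ipBl u v w : ip (u - v) w = ip u w - ip v w.
Proof. by rewrite ipDl ipNl. Qed.
Lemma ipDr u v w : ip w (u + v) = ip w u + ip w v.
Proof. by rewrite ipC ?ipDl// rmorphD /= -!ipC. Qed.
Lemma ipZr c u w : ip w (c *: u) = c^*%C * ip w u.
Proof. by rewrite ipC ?ipZl// rmorphM /= -ipC. Qed.
Lemma ipNr u w : ip w (- u) = - ip w u.
Proof. by rewrite ipC ?ipNl// rmorphN /= -ipC. Qed.
Lemma ipBr u v w : ip w (u - v) = ip w u - ip w v.
Proof. by rewrite ipDr ipNr. Qed.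

Definition ipE := (ipDl, ipDr, ipNl, ipNr, ipZl, ipZr).

Lemma ip_Im0 u : complex.Im (ip u u) = 0.
Proof.
have := congr1 (fun c => complex.Im c) (ipC ipP u u); rewrite cImJ => /eqP.
by rewrite -subr_eq0 opprK -mulr2n mulrn_eq0 /= => /eqP.
Qed.

Lemma ipnorm_ge0 u : 0 <= ipnorm u.
Proof. exact: sqrtr_ge0. Qed.

Lemma sqr_ipnorm u : ipnorm u ^+ 2 = complex.Re (ip u u).
Proof. by rewrite sqr_sqrtr// ip_ge0. Qed.

Lemma ip_self u : ip u u = (ipnorm u ^+ 2)%:C.
Proof. by apply: complexP; rewrite /= ?sqr_ipnorm ?ip_Im0. Qed.

Lemma cauchy_schwarz u v : cabs (ip u v) <= ipnorm u * ipnorm v.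
Proof.
rewrite -ler_sqr ?nnegrE ?cabs_ge0 ?mulr_ge0 ?ipnorm_ge0//.
rewrite sqr_cabs exprMn !sqr_ipnorm.
apply: quad_discr; first exact: ip_ge0.
move=> c1 c2; have := ip_ge0 ipP (u - (c1 +i* c2) *: v).
rewrite !ipE (ipC ipP v u) !cReIm /=.
have := ip_Im0 v; have := ip_Im0 u; case: (ip u v) => p1 p2.
case: (ip u u) => ? ?; case: (ip v v) => ? ? /= _ ->; rewrite ?mulr0 ?subr0 ?addr0 => h.
apply: le_trans h _; rewrite le_eqVlt; apply/orP; left; apply/eqP; ring.
Qed.

Lemma Re_ip_le u v : `|complex.Re (ip u v)| <= ipnorm u * ipnorm v.
Proof. exact: le_trans (le_Re_cabs _) (cauchy_schwarz _ _). Qed.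

Lemma ipnormZ c u : ipnorm (c *: u) = cabs c * ipnorm u.
Proof.
rewrite /ipnorm cabsE -sqrtrM ?addr_ge0 ?sqr_ge0//; congr Num.sqrt.
rewrite !ipE !cReIm ip_Im0 /=; ring.
Qed.

Lemma ipnormN u : ipnorm (- u) = ipnorm u.
Proof. by rewrite /ipnorm !ipE opprK. Qed.

Lemma ipnormBC u v : ipnorm (u - v) = ipnorm (v - u).
Proof. by rewrite -ipnormN opprB. Qed.

Lemma ipnorm0 : ipnorm 0 = 0.
Proof. by rewrite /ipnorm ip0l sqrtr0. Qed.

Lemma ipnormD u v : ipnorm (u + v) <= ipnorm u + ipnorm v.
Proof.
rewrite -ler_sqr ?nnegrE ?addr_ge0 ?ipnorm_ge0// sqrrD !sqr_ipnorm.
rewrite !ipE !cReIm (ipC ipP u v) cReJ.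
have := le_trans (ler_norm _) (Re_ip_le u v); lra.
Qed.

Lemma ipnorm_tri w u v : ipnorm (u - v) <= ipnorm (u - w) + ipnorm (w - v).
Proof. by rewrite -(subrKA w u (- v)); exact: ipnormD. Qed.

Lemma parallelogram u v :
  ipnorm (u + v) ^+ 2 + ipnorm (u - v) ^+ 2 = 2 * (ipnorm u ^+ 2 + ipnorm v ^+ 2).
Proof. by rewrite !sqr_ipnorm !ipE !cReIm; ring. Qed.

Section projection.
Variable S : set V.
Hypothesis S0 : S 0.
Hypothesis SL : forall c u v, S u -> S v -> S (c *: u + v).
Hypothesis cV : cauchy_complete ipnorm.

(** The subspace [S] need not be closed: a minimising sequence is Cauchy by the parallelogram law,
    and its limit [m] lies in the closure of [S] only. Orthogonality is quantified before the limit: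
    [d - u k] nearly minimises the distance, so by the discriminant its product with [s] is at most
    [|s|] times the square root of [1/(k+1)]. *)
Lemma projection d : exists m,
  (forall e, 0 < e -> exists2 s, S s & ipnorm (s - m) < e) /\
  forall s, S s -> ip (d - m) s = 0.
Proof.
pose E := [set ipnorm (d - s) ^+ 2 | s in S].
have Einf : has_inf E.
  split; first by exists (ipnorm (d - 0) ^+ 2), 0.
  by exists 0 => _ [s _ <-]; exact: sqr_ge0.
have infE s : S s -> inf E <= ipnorm (d - s) ^+ 2.
  by move=> Ss; apply: ge_inf; [exact: Einf.2|exists s].
have near_inf k : exists s, S s /\ ipnorm (d - s) ^+ 2 < inf E + k.+1%:R^-1.
  have [|_ [s Ss <-] h] := @inf_adherent R E (k.+1%:R^-1) _ Einf.
    by rewrite invr_gt0.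
  by exists s.
pose u k := projT1 (cid (near_inf k)).
have uS k : S (u k) by rewrite /u; case: cid => ? [].
have uE k : ipnorm (d - u k) ^+ 2 < inf E + k.+1%:R^-1 by rewrite /u; case: cid => ? [].
have cauchy i j : ipnorm (u i - u j) ^+ 2 <= 2 * (i.+1%:R^-1 + j.+1%:R^-1).
  have := parallelogram (d - u i) (d - u j).
  have -> : d - u i - (d - u j) = u j - u i by rewrite opprB addrC addrA subrK.
  rewrite [ipnorm (u j - _)]ipnormBC.
  have -> : d - u i + (d - u j) = (2%:R : R[i]) *: (d - (2%:R^-1 *: u i + 2%:R^-1 *: u j)).
    rewrite scalerBr -scalerDr scalerA mulfV ?pnatr_eq0// scale1r.
    by rewrite scaler_nat mulr2n opprD addrACA.
  rewrite ipnormZ cabsE /=.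
  have -> : Num.sqrt ((1 + 1) ^+ 2 + (0 + 0) ^+ 2) = 2 :> R.
    by rewrite addr0 expr0n /= addr0 sqrtr_sqr ger0_norm.
  have Sm : S (2%:R^-1 *: u i + 2%:R^-1 *: u j).
    by apply: SL => //; rewrite -[_ *: _]addr0; exact: SL.
  have := infE _ Sm; have := uE i; have := uE j; rewrite exprMn; move: (i.+1%:R^-1) (j.+1%:R^-1) => ri rj; lra.
have [|m Hm] := cV (u := u).
  move=> e e0.
  have [N HN] : exists N, N.+1%:R^-1 < e ^+ 2 / 4.
    have e4 : 0 < e ^+ 2 / 4 by rewrite divr_gt0// exprn_gt0.
    by have [N] := ltr_add_invr e4; rewrite add0r; exists N.
  have inv k : (N <= k)%N -> k.+1%:R^-1 <= N.+1%:R^-1 :> R.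
    by move=> Nk; rewrite lef_pV2 ?posrE// ler_nat.
  exists N => i j /inv hi /inv hj.
  rewrite -ltr_sqr ?nnegrE ?ipnorm_ge0 ?(ltW e0)//.
  apply: le_lt_trans (cauchy i j) _; move: (i.+1%:R^-1) (j.+1%:R^-1) (N.+1%:R^-1) hi hj HN => ri rj rn; lra.
exists m; split.
  by move=> e /Hm[N HN]; exists (u N) => //; exact: HN.
move=> s Ss.
have orth k : cabs (ip (d - u k) s) ^+ 2 <= k.+1%:R^-1 * ipnorm s ^+ 2.
  rewrite sqr_cabs; apply: quad_discr; first exact: sqr_ge0.
  move=> c1 c2; have := infE ((c1 +i* c2) *: s + u k) (SL _ Ss (uS k)).
  rewrite opprD addrCA addrC; have := uE k; rewrite !sqr_ipnorm.
  move: (d - u k) => x; rewrite !ipE (ipC ipP x s) !cReIm /=.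
  have := ip_Im0 s; case: (ip s s) => ? ?; case: (ip x s) => ? ? /= ->.
  move: (k.+1%:R^-1) => rk; lra.
apply: cabs_eq0; apply/eqP; rewrite eq_le cabs_ge0 andbT; apply/ler_addgt0Pl => e e0.
rewrite addr0.
have n0 : 0 < ipnorm s + 1 by rewrite ltr_wpDl// ipnorm_ge0.
have [N1 HN1] := Hm _ (divr_gt0 e0 (mulr_gt0 (ltr0n R 2) n0)).
have [N2 HN2] : exists N, N.+1%:R^-1 < (e / (2 * (ipnorm s + 1))) ^+ 2.
  have e4 : 0 < (e / (2 * (ipnorm s + 1))) ^+ 2 by rewrite exprn_gt0// divr_gt0// mulr_gt0.
  by have [N] := ltr_add_invr e4; rewrite add0r; exists N.
pose k := maxn N1 N2.
have -> : d - m = (d - u k) + (u k - m) by rewrite addrA subrK.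
rewrite ipDl (le_trans (cabsD _ _))//.
have h1 := ltW (HN1 k (leq_maxl _ _)).
have h2 : cabs (ip (d - u k) s) <= e / (2 * (ipnorm s + 1)) * ipnorm s.
  have e1 : 0 <= e / (2 * (ipnorm s + 1)) by rewrite divr_ge0 ?(ltW e0)// mulr_ge0// ltW.
  rewrite -ler_sqr ?nnegrE ?cabs_ge0 ?(mulr_ge0 e1) ?ipnorm_ge0//.
  apply: le_trans (orth k) _; rewrite exprMn ler_wpM2r ?sqr_ge0// (le_trans _ (ltW HN2))//.
  by rewrite lef_pV2 ?posrE// ler_nat ltnS leq_maxr.
have h3 := le_trans (cauchy_schwarz (u k - m) s) (ler_wpM2r (ipnorm_ge0 s) h1).
apply: le_trans (lerD h2 h3) _.
set D := e / _; have -> : D * ipnorm s + D * ipnorm s = e * (ipnorm s / (ipnorm s + 1)).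
  by rewrite /D; field; rewrite gt_eqF.
by rewrite ler_piMr ?ltW// ltr_pdivrMr// mul1r ltrDl.
Qed.

End projection.

(** With [m] the projection of [d0] on the kernel of [l], the vector [z = d0 - m] is orthogonal to
    the kernel and a multiple of it represents [l]. *)
Lemma riesz (l : V -> R[i]) (M : R) : cauchy_complete ipnorm ->
  (forall c d e, l (c *: d + e) = c^*%C * l d + l e) ->
  (forall d, cabs (l d) <= M * ipnorm d) ->
  exists u, forall d, ip u d = l d.
Proof.
move=> cV lL lM.
have [l0|/existsNP[d0 /eqP ld0]] := pselect (forall d, l d = 0).
  by exists 0 => d; rewrite l0 ip0l.
have l00 : l 0 = 0.
  have := lL 1 0 0; rewrite scaler0 add0r rmorph1 mul1r => /eqP.
  by rewrite -subr_eq0 opprD addrA subrr sub0r oppr_eq0 => /eqP.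
have lZ c d : l (c *: d) = c^*%C * l d by have := lL c d 0; rewrite !addr0 l00 addr0.
have lD c d : l (c + d) = l c + l d by have := lL 1 c d; rewrite scale1r rmorph1 mul1r.
have lB c d : l (c - d) = l c - l d.
  by rewrite lD -scaleN1r lZ rmorphN1 mulN1r.
have SL c u v : l u = 0 -> l v = 0 -> l (c *: u + v) = 0.
  by rewrite lL => -> ->; rewrite mulr0 addr0.
have [m [mS mO]] := @projection [set d | l d = 0] l00 SL cV d0.
(* [m] is only a limit of elements of the kernel; boundedness of [l] puts it there. *)
have lm : l m = 0.
  apply: cabs_eq0; apply/eqP; rewrite eq_le cabs_ge0 andbT; apply/ler_addgt0Pl => e e0.
  have M1 : 0 < `|M| + 1 by rewrite ltr_wpDl.
  have [s /= ls sm] := mS _ (divr_gt0 e0 M1).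
  have -> : l m = - l (s - m) by rewrite lB ls sub0r opprK.
  rewrite addr0 cabsN (le_trans (lM _))//.
  apply: le_trans (ler_wpM2r (ipnorm_ge0 _) (ler_norm M)) _.
  apply: le_trans (ler_wpM2l (normr_ge0 M) (ltW sm)) _.
  by rewrite mulrCA ler_piMr ?ltW// ltr_pdivrMr// mul1r ltrDl.
pose z := d0 - m.
have lz : l z != 0 by rewrite lB lm subr0.
(* The inner product is not assumed definite: [z] has positive norm because [l] is bounded and [l z]
   is nonzero. *)
have nz : ip z z != 0.
  rewrite ip_self; apply: contra lz => /eqP[/eqP]; rewrite sqrf_eq0 => /eqP n0.
  by apply/eqP/cabs_eq0/eqP; rewrite eq_le cabs_ge0 andbT; have := lM z; rewrite n0 mulr0.
exists ((l z / ip z z) *: z) => d.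
pose k := (l d / l z)^*%C.
have : ip z (d - k *: z) = 0.
  apply: mO => /=; rewrite lB lZ /k conjcK divfK// subrr //.
rewrite ipBr ipZr => /eqP; rewrite subr_eq0 => /eqP E.
by rewrite ipZl E /k conjcK; field; rewrite nz lz.
Qed.

End prehilbert.

Section continuity_method.
Context {R : realType} {V : lmodType R[i]}.
Variables (n : V -> R) (D : set V) (T : V -> V).

Record is_norm : Prop := IsNorm {
  norm_tri : forall u v, n (u + v) <= n u + n v;
  norm_scale : forall c u, n (c *: u) = cabs c * n u;
  norm_eq0 : forall u, n u = 0 -> u = 0 }.

Hypothesis nP : is_norm.
Hypothesis cV : cauchy_complete n.
Hypothesis DL : forall c u v, D u -> D v -> D (c *: u + v).
Hypothesis TL : forall c u v, D u -> D v -> T (c *: u + v) = c *: T u + T v.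

Definition solvable (l : R[i]) := forall y, exists2 x, D x & T x - l *: x = y.

Lemma norm0 : n 0 = 0.
Proof. by have := norm_scale nP 0 0; rewrite scale0r cabs0 mul0r. Qed.

Lemma normN u : n (- u) = n u.
Proof. by rewrite -scaleN1r (norm_scale nP) cabsN cabsE /= expr1n expr0n addr0 sqrtr1 mul1r. Qed.

Lemma norm_pos u : 0 <= n u.
Proof.
have := norm_tri nP u (- u); rewrite subrr norm0 normN; lra.
Qed.

(** Banach's fixed point. The bound at [l] makes the solution map [S] Lipschitz with constant [M],
    so [F x = S (y + (l' - l) x)] contracts by 1/2, and its fixed point solves the equation at [l'].
    The limit is a value of [S], hence lies in [D], without any closedness of [T]. *)
Lemma solvable_step (M : R) (l l' : R[i]) : 0 < M ->
  (forall x, D x -> n x <= M * n (T x - l *: x)) ->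
  cabs (l' - l) * M <= 2^-1 -> solvable l -> solvable l'.
Proof.
move=> M0 HM ll' sl y.
pose S y := projT1 (cid2 (sl y)).
have SD z : D (S z) by rewrite /S; case: cid2.
have SE z : T (S z) - l *: S z = z by rewrite /S; case: cid2.
have Slip z z' : n (S z - S z') <= M * n (z - z').
  have -> : S z - S z' = (-1) *: S z' + S z by rewrite scaleN1r addrC.
  apply: le_trans (HM _ (DL _ (SD _) (SD _))) _.
  rewrite TL// scalerDr scalerA [l * -1]mulrC -scalerA opprD addrACA -scalerBr !SE.
  by rewrite scaleN1r addrC.
pose F x := S (y + (l' - l) *: x).
have Flip x x' : n (F x - F x') <= 2^-1 * n (x - x').
  apply: le_trans (Slip _ _) _; rewrite opprD addrACA subrr add0r -scalerBr (norm_scale nP).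
  by rewrite mulrA [M * _]mulrC ler_wpM2r// norm_pos.
pose u k := iter k F 0.
have uS k : n (u k.+1 - u k) <= (2^-1) ^+ k * n (u 1%N).
  elim: k => [|k IH]; first by rewrite expr0 mul1r subr0.
  apply: le_trans (Flip _ _) _; rewrite exprS -mulrA ler_wpM2l// invr_ge0//.
have u2 k m : n (u (k + m)%N - u k) <= 2 * (2^-1) ^+ k * n (u 1%N) * (1 - (2^-1) ^+ m).
  elim: m => [|m IH]; first by rewrite addn0 subrr norm0 expr0 subrr mulr0.
  have -> : u (k + m.+1)%N - u k = (u (k + m).+1 - u (k + m)%N) + (u (k + m)%N - u k).
    by rewrite addnS addrA subrK.
  apply: le_trans (norm_tri nP _ _) _; apply: le_trans (lerD (uS _) IH) _.
  rewrite exprD exprS; set A := _ ^+ k; set B := _ ^+ m; set C := n _.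
  by rewrite le_eqVlt; apply/orP; left; apply/eqP; field.
have n1 := norm_pos (u 1%N).
have pw0 k : 0 <= (2^-1 : R) ^+ k by rewrite exprn_ge0// invr_ge0.
have u3 k m : n (u (k + m)%N - u k) <= 2 * n (u 1%N) * (2^-1) ^+ k.
  apply: le_trans (u2 _ _) _; rewrite [X in _ <= X]mulrAC ler_piMr ?gerBl//.
  by rewrite !mulr_ge0.
have pw e : 0 < e -> exists N, forall k, (N <= k)%N -> 2 * n (u 1%N) * (2^-1) ^+ k < e.
  move=> e0; have C0 : 0 < 2 * n (u 1%N) + 1 by rewrite ltr_wpDl// mulr_ge0.
  have [N] := ltr_add_invr (divr_gt0 e0 C0); rewrite add0r => HN; exists N => k Nk.
  have h2 : (2^-1 : R) ^+ k <= N.+1%:R^-1.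
    rewrite exprVn lef_pV2 ?posrE ?exprn_gt0// -natrX ler_nat.
    exact: leq_ltn_trans Nk (ltn_expl k _).
  apply: (@le_lt_trans _ _ ((2 * n (u 1%N) + 1) * N.+1%:R^-1)).
    by apply: ler_pM => //; [rewrite mulr_ge0|rewrite lerDl].
  by rewrite mulrC -ltr_pdivlMr.
have [|x Hx] := cV (u := u).
  move=> e e0; have [N HN] := pw _ e0; exists N => i j Ni Nj.
  wlog ij : i j Ni Nj / (j <= i)%N.
    move=> H; have [h|/ltnW h] := leqP j i; first exact: H.
    have -> : u i - u j = - (u j - u i) by rewrite opprB.
    by rewrite normN; exact: H.
  by rewrite -(subnKC ij); apply: le_lt_trans (u3 _ _) (HN _ Nj).
have Fx : F x = x.
  apply/eqP; rewrite -subr_eq0; apply/eqP/(norm_eq0 nP)/eqP.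
  rewrite eq_le norm_pos andbT; apply/ler_addgt0Pl => e e0; rewrite addr0.
  have [N HN] := Hx _ (divr_gt0 e0 (ltr0n R 2)).
  have -> : F x - x = (F x - u N.+1) + (u N.+1 - x) by rewrite addrA subrK.
  apply: le_trans (norm_tri nP _ _) _.
  have h1 := HN N (leqnn _); have h2 := HN N.+1 (leqnSn _).
  have : n (F x - u N.+1) <= 2^-1 * n (u N - x).
    by rewrite -normN opprB; exact: Flip.
  lra.
exists x; first by rewrite -Fx; exact: SD.
have := SE (y + (l' - l) *: x); rewrite -/(F x) Fx => /eqP.
by rewrite subr_eq => /eqP ->; rewrite scalerBl addrA subrK addrK.
Qed.

(** As [M] is the same along the segment, so is the admissible step, and finitely many steps lead
    from [l0] to [l1]. *)
Lemma solvable_path (M : R) (l0 l1 : R[i]) : 0 < M ->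
  (forall t x, 0 <= t <= 1 -> D x ->
     n x <= M * n (T x - (l0 + t%:C * (l1 - l0)) *: x)) ->
  solvable l0 -> solvable l1.
Proof.
move=> M0 HM s0.
have [K HK] : exists K, K.+1%:R^-1 < (2 * (cabs (l1 - l0) * M + 1))^-1.
  have e0 : 0 < (2 * (cabs (l1 - l0) * M + 1))^-1.
    by rewrite invr_gt0 mulr_gt0// ltr_wpDl// mulr_ge0 ?cabs_ge0 ?ltW.
  by have [N] := ltr_add_invr e0; rewrite add0r; exists N.
have H k : (k <= K.+1)%N -> solvable (l0 + (k%:R / K.+1%:R)%:C * (l1 - l0)).
  elim: k => [_|k IH kK]; first by rewrite mul0r mul0r addr0.
  apply: (solvable_step M0 _ _ (IH (ltnW kK))).
    move=> x; apply: HM; rewrite divr_ge0//= ler_pdivrMr// mul1r ler_nat ltnW//.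
  rewrite opprD addrACA subrr add0r -mulrBl -rmorphB /= -mulrBl -natrB// subSnn cabsM cabs_real.
  rewrite mul1r ger0_norm ?invr_ge0//.
  have C0 : 0 <= cabs (l1 - l0) * M by rewrite mulr_ge0 ?cabs_ge0 ?ltW.
  rewrite -mulrA; apply: le_trans (ler_wpM2r C0 (ltW HK)) _.
  rewrite invfM -mulrA ler_piMr ?invr_ge0// mulrC ler_pdivrMr ?ltr_wpDl// mul1r lerDl//.
have := H K.+1 (leqnn _); rewrite divff// mul1r [l0 + _]addrC subrK//.
Qed.

End continuity_method.

(** * The Hilbert space L2 and multiplication operators *)

Section L2_space.
Context {R : realType}.
Local Notation mu := (@lebesgue_measure R).
Local Notation aeF := (ae_filter_ringOfSetsType mu).
Implicit Types (u v w : L2 R).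

Lemma Lfun2P (f : R -> R) : f \in Lfun mu 2%:E <->
  measurable_fun setT f /\ (\int[mu]_x ((f x) ^+ 2)%:E < +oo)%E.
Proof.
split=> [fL|[mf fi]].
  split; first by have /andP[/[!inE]] := fL.
  have /integrableP[_] := Lfun2_integrable_sqr fL.
  by under eq_integral => x _ do rewrite /= ger0_norm ?sqr_ge0//.
apply/andP; split; rewrite inE//=.
rewrite /finite_norm unlock poweR_lty//.
under eq_integral => x _ do rewrite poweR_EFin powR_mulrn// real_normK ?num_real//.
exact: fi.
Qed.

(** The intervals of centre [a k] and radius [2 C 2^-k] are nested; [l] is the supremum of their
    left ends. *)
Lemma geometric_limit (a : nat -> R) (C : R) :
  (forall k, `|a k.+1 - a k| <= C * 2^-1 ^+ k) ->
  exists l, forall k, `|a k - l| <= 2 * C * 2^-1 ^+ k.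
Proof.
move=> H.
have C0 : 0 <= C by have := le_trans (normr_ge0 _) (H 0%N); rewrite expr0 mulr1.
pose r k := 2 * C * (2^-1 : R) ^+ k.
have r0 k : 0 <= r k by rewrite /r !mulr_ge0// exprn_ge0// invr_ge0.
have rS k : r k - r k.+1 = C * 2^-1 ^+ k.
  by rewrite /r exprS; field.
have lo k : a k - r k <= a k.+1 - r k.+1.
  by have := H k; rewrite -rS ler_norml => /andP[]; lra.
have hi k : a k.+1 + r k.+1 <= a k + r k.
  by have := H k; rewrite -rS ler_norml => /andP[]; lra.
have lom k m : a k - r k <= a (k + m)%N - r (k + m)%N.
  by elim: m => [|m IH]; rewrite ?addn0// addnS; exact: le_trans IH (lo _).
have him k m : a (k + m)%N + r (k + m)%N <= a k + r k.
  by elim: m => [|m IH]; rewrite ?addn0// addnS; exact: le_trans (hi _) IH.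
have lohi k m : a k - r k <= a m + r m.
  apply: le_trans (lom k m) _; apply: le_trans (him m k); rewrite addnC.
  by have := r0 (m + k)%N; lra.
pose E := range (fun k => a k - r k).
have supE : has_sup E.
  split; first by exists (a 0%N - r 0%N), 0%N.
  by exists (a 0%N + r 0%N) => _ [k _ <-].
exists (sup E) => k; rewrite distrC ler_norml; apply/andP; split.
  have : a k - r k <= sup E by apply: (sup_upper_bound supE); exists k.
  by rewrite /r; lra.
have : sup E <= a k + r k by apply: ge_sup; [exact: supE.1|move=> _ [m _ <-]].
by rewrite /r; lra.
Qed.

Lemma cvg_geometric_bound (a : nat -> R) (l C : R) :
  (forall k, `|a k - l| <= C * 2^-1 ^+ k) -> a k @[k --> \oo] --> l.
Proof.
move=> H.
have c0 : C * (2^-1 : R) ^+ k @[k --> \oo] --> 0.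
  rewrite -[X in _ --> X](mulr0 C); apply: cvgM; first exact: cvg_cst.
  by apply: cvg_expr; rewrite ger0_norm ?invr_ge0// invf_lt1// ltr1n.
apply/cvgrPdist_le => e e0; move/cvgrPdist_le : c0 => /(_ e e0).
apply: filterS => k; rewrite sub0r normrN distrC => h.
exact: le_trans (H k) (le_trans (ler_norm _) h).
Qed.

Lemma nneseries_geometric : (\sum_(0 <= k <oo) ((2^-1 : R) ^+ k)%:E <= 2%:E)%E.
Proof.
apply: lime_le.
  by apply: is_cvg_nneseries => n _ _; rewrite lee_fin exprn_ge0// invr_ge0.
apply: nearW => n; rewrite sumEFin lee_fin.
suff -> : \sum_(0 <= k < n) (2^-1 : R) ^+ k = 2 - 2 * 2^-1 ^+ n.
  by rewrite gerBl mulr_ge0// exprn_ge0// invr_ge0.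
elim: n => [|n IH]; first by rewrite big_nil expr0; lra.
by rewrite big_nat_recr//= IH exprS; field.
Qed.

(** Riesz-Fischer. The series [h] of the [4^k (f_(k+1) - f_k)^2] has integral at most 2, the sum of
    the [2^-k]. Hence [h] is finite almost everywhere and bounds the increments by [sqrt h 2^-k];
    the limit [g] satisfies [(f_k - g)^2 <= 4 h 4^-k], which integrates to the stated rate. *)
Lemma Lfun2_fast_cauchy (f : nat -> R -> R) : (forall k, f k \in Lfun mu 2%:E) ->
  (forall k, (\int[mu]_x ((f k.+1 x - f k x) ^+ 2)%:E <= (8^-1 ^+ k)%:E)%E) ->
  exists2 g, g \in Lfun mu 2%:E &
    forall k, (\int[mu]_x ((f k x - g x) ^+ 2)%:E <= (8 * 4^-1 ^+ k)%:E)%E.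
Proof.
move=> fL H.
have mf k : measurable_fun setT (f k) by have /Lfun2P[] := fL k.
have mQ k : measurable_fun [set: R] (fun x => ((f k.+1 x - f k x) ^+ 2)%:E).
  by apply/measurable_EFinP; apply: measurable_funX; exact: measurable_funB.
pose t k x : \bar R := (4 ^+ k * (f k.+1 x - f k x) ^+ 2)%:E.
have mt k : measurable_fun setT (t k).
  apply/measurable_EFinP; apply: measurable_funM; first exact: measurable_cst.
  by apply: measurable_funX; exact: measurable_funB.
have t0 k x : (0 <= t k x)%E by rewrite lee_fin mulr_ge0 ?sqr_ge0// exprn_ge0.
pose h x := (\sum_(0 <= k <oo) t k x)%E.
have h0 x : (0 <= h x)%E by apply: nneseries_ge0 => n _ _; exact: t0.
have mh : measurable_fun setT h by apply: ge0_emeasurable_sum => // k x _ _; exact: t0.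
have ih : (\int[mu]_x h x <= 2%:E)%E.
  rewrite integral_nneseries//.
  apply: le_trans nneseries_geometric; apply: lee_nneseries => k _.
    by move=> _; apply: integral_ge0 => x _; exact: t0.
  rewrite /t; under eq_integral do rewrite EFinM.
  rewrite ge0_integralZl_EFin//; last 2 first.
    by move=> x _; rewrite lee_fin sqr_ge0.
    exact: mQ.
  apply: le_trans (lee_wpmul2l _ (H k)) _; first by rewrite lee_fin exprn_ge0.
  rewrite -EFinM lee_fin -exprMn; have -> : 4 * 8^-1 = 2^-1 :> R by lra.
  exact: lexx.
have hfin : {ae mu, forall x, h x \is a fin_num}.
  have hi : mu.-integrable setT h.
    apply/integrableP; split => //.
    under eq_integral => x _ do rewrite gee0_abs//.
    exact: le_lt_trans ih (ltry _).
  have := integrable_ae measurableT hi.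
  by apply: (@filterS _ _ aeF) => x; apply.
pose D := [set x | (h x < +oo)%E].
have mD : measurable D.
  by rewrite -[D]setTI; exact: emeasurable_fun_infty_o.
have lim x : exists l, D x -> forall k, (f k x - l) ^+ 2 <= 4 * fine (h x) * 4^-1 ^+ k.
  have [Dx|Dx] := pselect (D x); last by exists 0.
  have hx : h x = (fine (h x))%:E by rewrite fineK// ge0_fin_numE.
  have hH := fine_ge0 (h0 x).
  have dk k : `|f k.+1 x - f k x| <= Num.sqrt (fine (h x)) * 2^-1 ^+ k.
    rewrite -sqrtr_sqr -[X in _ * X]ger0_norm ?exprn_ge0 ?invr_ge0// -sqrtr_sqr -sqrtrM//.
    rewrite ler_wsqrtr// -exprM mulnC exprM [2^-1 ^+ 2]expr2 -invfM.
    rewrite (_ : 2 * 2 = 4 :> R); last by lra.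
    rewrite exprVn ler_pdivlMr ?exprn_gt0// mulrC -lee_fin -hx.
    have := @nneseries_lim_ge R (t^~ x) xpredT 0%N k.+1 (fun n _ _ => t0 n x).
    apply: le_trans; rewrite big_nat_recr//= leeDr//.
    by apply: sume_ge0 => i _; exact: t0.
  have [l Hl] := geometric_limit dk.
  exists l => _ k; rewrite -real_normK ?num_real//.
  apply: le_trans (_ : (2 * Num.sqrt (fine (h x)) * 2^-1 ^+ k) ^+ 2 <= _).
    by rewrite ler_sqr ?nnegrE// (le_trans _ (Hl k)).
  rewrite 2!exprMn sqr_sqrtr// -exprM mulnC exprM [2^-1 ^+ 2]expr2 -invfM.
  by rewrite [2 ^+ 2]expr2; have -> : 2 * 2 = 4 :> R by lra.
pose l x := projT1 (cid (lim x)).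
have lE x : D x -> forall k, (f k x - l x) ^+ 2 <= 4 * fine (h x) * 4^-1 ^+ k.
  by rewrite /l; case: cid.
(* Outside [D] the value picked by [cid] is arbitrary; replacing it by 0 restores measurability. *)
pose g := l \_ D.
have gE x : D x -> g x = l x by move=> Dx; rewrite /g patchE mem_set.
have mg : measurable_fun setT g.
  apply/(measurable_restrictT l mD).
  apply: (@measurable_fun_cvg _ _ _ _ f) => [k|x Dx].
    by apply: measurable_funS (mf k).
  apply: (@cvg_geometric_bound _ _ (2 * Num.sqrt (fine (h x)))) => k.
  rewrite -sqrtr_sqr -[X in _ * X]ger0_norm ?exprn_ge0 ?invr_ge0// -sqrtr_sqr.
  rewrite -[2 as X in _ <= X * _ * _]ger0_norm// -sqrtr_sqr -!sqrtrM ?mulr_ge0 ?sqr_ge0 ?fine_ge0//.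
  rewrite ler_wsqrtr//; apply: le_trans (lE x Dx k) _.
  rewrite -exprM mulnC exprM [2^-1 ^+ 2]expr2 -invfM [2 ^+ 2]expr2.
  by have -> : 2 * 2 = 4 :> R by lra.
have Hg k : (\int[mu]_x ((f k x - g x) ^+ 2)%:E <= (8 * 4^-1 ^+ k)%:E)%E.
  have mfg : measurable_fun setT (fun x => (f k x - g x) ^+ 2).
    by apply: measurable_funX; exact: measurable_funB.
  have c0 : (0 <= (4 * 4^-1 ^+ k)%:E :> \bar R)%E.
    by rewrite lee_fin mulr_ge0// exprn_ge0// invr_ge0.
  apply: (@le_trans _ _ (\int[mu]_x ((4 * 4^-1 ^+ k)%:E * h x))%E).
    apply: ae_ge0_le_integral => //.
    - by move=> x _; rewrite lee_fin sqr_ge0.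
    - exact/measurable_EFinP.
    - by move=> x _; rewrite mule_ge0.
    - by apply: emeasurable_funM => //; exact: measurable_cst.
    - apply: (@filterS _ _ aeF _ _ _ hfin) => x hx _.
      have Dx : D x by rewrite /D /= ltey_eq hx.
      by rewrite -[h x]fineK// -EFinM lee_fin gE// (le_trans (lE x Dx k))// mulrAC.
  rewrite ge0_integralZl//; apply: le_trans (lee_wpmul2l c0 ih) _.
  by rewrite -EFinM lee_fin mulrAC; have -> : 4 * 2 = 8 :> R by lra.
exists g => //.
have gL : (fun x => f 0%N x - g x) \in Lfun mu 2%:E.
  apply/Lfun2P; split; first exact: measurable_funB.
  exact: le_lt_trans (Hg 0%N) (ltry _).
have [_ /(_ (-1) _ _ gL (fL 0%N))] := @Lfun_submod_closed _ _ R mu _ (lee1n 2 : (1 <= 2%:E)%E).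
rewrite [X in X \in _ -> _](_ : _ = g)//; apply/funext => x.
by rewrite !fctE /GRing.scale /=; lra.
Qed.

End L2_space.

Definition mul_dom {R : realType} (m : R -> R) (u : L2 R) :=
  in_L2 (fun x => (m x)%:C * repr u x).

(* [mulop m u] is the product m u in L2; outside [mul_dom m] its value 0 is junk. *)
HB.lock Definition mulop {R : realType} (m : R -> R) (u : L2 R) : L2 R :=
  xget (0 : L2 R) [set w : L2 R |
    {ae @lebesgue_measure R, forall x, repr w x = (m x)%:C * repr u x}].

Section L2_hilbert.
Context {R : realType}.
Local Notation mu := (@lebesgue_measure R).
Local Notation aeF := (ae_filter_ringOfSetsType mu).
Implicit Types (u v w : L2 R) (m n : R -> R).

Lemma ae_imply (P Q : R -> Prop) : (forall x, P x -> Q x) ->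
  {ae mu, forall x, P x} -> {ae mu, forall x, Q x}.
Proof. by move=> PQ; apply: (@filterS _ _ aeF). Qed.

Lemma ae_imply2 (P P' Q : R -> Prop) : (forall x, P x -> P' x -> Q x) ->
  {ae mu, forall x, P x} -> {ae mu, forall x, P' x} -> {ae mu, forall x, Q x}.
Proof. by move=> PQ p p'; apply: (@filterS2 _ _ aeF _ _ _ PQ). Qed.

Lemma ae_imply3 (P P' P'' Q : R -> Prop) : (forall x, P x -> P' x -> P'' x -> Q x) ->
  {ae mu, forall x, P x} -> {ae mu, forall x, P' x} -> {ae mu, forall x, P'' x} ->
  {ae mu, forall x, Q x}.
Proof. by move=> PQ p p' p''; apply: (@filterS3 _ _ aeF _ _ _ _ PQ). Qed.

Lemma ae_imply4 (P P' P'' P''' Q : R -> Prop) :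
  (forall x, P x -> P' x -> P'' x -> P''' x -> Q x) ->
  {ae mu, forall x, P x} -> {ae mu, forall x, P' x} -> {ae mu, forall x, P'' x} ->
  {ae mu, forall x, P''' x} -> {ae mu, forall x, Q x}.
Proof.
move=> PQ p p' p'' p'''; have : {ae mu, forall x, P x /\ P' x} by apply: ae_imply2 p p'.
by move=> pp'; apply: ae_imply3 pp' p'' p''' => x [] *; exact: PQ.
Qed.

Definition L2_of (h : R -> R[i]) (hL : h \in L2fun) : L2 R := \pi_(L2 R) (Sqint hL).

Lemma repr_L2_of (h : R -> R[i]) (hL : h \in L2fun) :
  {ae mu, forall x, repr (L2_of hL) x = h x}.
Proof.
have /asboolP: repr (L2_of hL) - Sqint hL \in ae_null.
  by rewrite Quotient.idealrBE reprK.
by apply: ae_imply => x /=; rewrite !fctE => /eqP; rewrite subr_eq0 => /eqP.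
Qed.

Lemma L2_eq u v : {ae mu, forall x, repr u x = repr v x} -> u = v.
Proof.
move=> uv; rewrite -[u]reprK -[v]reprK; apply/eqP.
rewrite -Quotient.idealrBE; apply/asboolP.
by apply: ae_imply uv => x /= E; rewrite !fctE E subrr.
Qed.

Lemma repr_L2_0 : {ae mu, forall x, repr (0 : L2 R) x = 0}.
Proof.
have := repr_L2P (-1) 0 (0 : L2 R); rewrite scaler0 addr0.
by apply: ae_imply => x ->; rewrite mulN1r addNr.
Qed.

Lemma repr_L2D u v : {ae mu, forall x, repr (u + v) x = repr u x + repr v x}.
Proof. by have := repr_L2P 1 u v; rewrite scale1r; apply: ae_imply => x ->; rewrite mul1r. Qed.

Lemma repr_L2Z c u : {ae mu, forall x, repr (c *: u) x = c * repr u x}.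
Proof.
by have := repr_L2P c u 0; rewrite addr0; apply: ae_imply2 repr_L2_0 => x -> ->; rewrite addr0.
Qed.

Lemma repr_L2B u v : {ae mu, forall x, repr (u - v) x = repr u x - repr v x}.
Proof.
have := repr_L2P (-1) v u; rewrite scaleN1r addrC.
by apply: ae_imply => x ->; rewrite mulN1r addrC.
Qed.

Lemma L2fun_conj (h : R -> R[i]) : h \in L2fun -> (fun x => (h x)^*%C) \in L2fun.
Proof.
move=> /andP[hr hi]; apply/andP; split.
  by rewrite (_ : (fun x => _) = fun x => complex.Re (h x))//; apply/funext => x; rewrite cReJ.
have [L0 /(_ (-1) _ _ hi L0)] := @Lfun_submod_closed _ _ R mu _ (lee1n 2 : (1 <= 2%:E)%E).
rewrite [X in X \in _ -> _](_ : _ = fun x => complex.Im ((h x)^*%C))//.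
by apply/funext => x; rewrite !fctE addr0 cImJ /GRing.scale /= mulN1r.
Qed.

Lemma L2_ip_eq u v (h k : R -> R[i]) : h \in L2fun -> k \in L2fun ->
  {ae mu, forall x, repr u x = h x} -> {ae mu, forall x, repr v x = k x} ->
  L2_ip u v = cintegral (fun x => h x * (k x)^*%C).
Proof.
move=> hL kL uh vk; rewrite /L2_ip.
have [? ?] := cintegrable_measurable (cintegrableM (sqintP (repr u)) (L2fun_conj (sqintP (repr v)))).
have [? ?] := cintegrable_measurable (cintegrableM hL (L2fun_conj kL)).
by apply: eq_cintegral => //; apply: ae_imply2 uh vk => x -> ->.
Qed.

Lemma cintegral_conj (h : R -> R[i]) : cintegrable h ->
  cintegral (fun x => (h x)^*%C) = (cintegral h)^*%C.
Proof.
move=> [hr hi]; rewrite /cintegral; apply: complexP => /=.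
  by congr Rintegral; apply/funext => x; rewrite cReJ.
rewrite -mulN1r -RintegralZl//; congr Rintegral; apply/funext => x.
by rewrite cImJ mulN1r.
Qed.

Lemma L2_is_ip : is_ip (@L2_ip R).
Proof.
split.
- by move=> c u v w; rewrite /L2_ip cintegral_repr//; exact: (L2fun_conj (sqintP (repr w))).
- move=> u v; rewrite /L2_ip -cintegral_conj; last first.
    exact: cintegrableM (sqintP (repr u)) (L2fun_conj (sqintP (repr v))).
  by congr cintegral; apply/funext => x; rewrite rmorphM /= conjcK mulrC.
- move=> u; rewrite /L2_ip /=; apply: Rintegral_ge0 => x _.
  change (0 <= complex.Re (repr u x * (repr u x)^*%C)).
  by rewrite cReM cReJ cImJ mulrN opprK -!expr2 addr_ge0// sqr_ge0.
Qed.

Lemma Lfun2_Rintegral (f : R -> R) : f \in Lfun mu 2%:E ->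
  (\int[mu]_x ((f x) ^+ 2)%:E)%E = (\int[mu]_x (f x ^+ 2))%:E.
Proof.
move=> fL; rewrite /Rintegral fineK//.
by have := integrable_fin_num measurableT (Lfun2_integrable_sqr fL).
Qed.

Lemma sqr_L2_norm u : L2_norm u ^+ 2 =
  \int[mu]_x (complex.Re (repr u x) ^+ 2) + \int[mu]_x (complex.Im (repr u x) ^+ 2).
Proof.
have /andP[ur ui] := sqintP (repr u).
rewrite (sqr_ipnorm L2_is_ip) -RintegralD//; try exact: Lfun2_integrable_sqr.
transitivity (\int[mu]_x complex.Re (repr u x * (repr u x)^*%C)); first by [].
by congr Rintegral; apply/funext => x; rewrite cReM cReJ cImJ mulrN opprK -!expr2.
Qed.

Lemma L2_norm_eq0 u : L2_norm u = 0 -> u = 0.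
Proof.
have /andP[ur ui] := sqintP (repr u).
move=> u0; have := sqr_L2_norm u; rewrite u0 expr0n /= => /esym/eqP.
rewrite paddr_eq0; last 2 first.
- by apply: Rintegral_ge0 => x _; exact: sqr_ge0.
- by apply: Rintegral_ge0 => x _; exact: sqr_ge0.
move=> /andP[/eqP r0 /eqP i0].
have key (f : R -> R) : f \in Lfun mu 2%:E -> \int[mu]_x (f x ^+ 2) = 0 ->
    {ae mu, forall x, f x = 0}.
  move=> fL f0; have := Lfun2_Rintegral fL; rewrite f0.
  have mf : measurable_fun [set: R] (fun x => ((f x) ^+ 2)%:E).
    by apply/measurable_EFinP/measurable_funX; have /Lfun2P[] := fL.
  move=> e; have : (\int[mu]_x `|((f x) ^+ 2)%:E| = 0)%E.
    by under eq_integral => x _ do rewrite gee0_abs ?lee_fin ?sqr_ge0//.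
  move/(ae_eq_integral_abs mu measurableT mf).
  by apply: ae_imply => x /(_ I) [] /eqP; rewrite sqrf_eq0 => /eqP.
apply: L2_eq; have := ae_imply2 _ (key _ ur r0) (key _ ui i0).
move=> H; apply: ae_imply2 (H (fun x => repr u x = 0) _) repr_L2_0 => x; first by move=> -> ->.
by move=> *; apply: complexP.
Qed.

Lemma L2_complete : cauchy_complete (@L2_norm R).
Proof.
move=> u Hu.
have e8 k : 0 < (8^-1 : R) ^+ k by rewrite exprn_gt0// invr_gt0.
pose N k := projT1 (cid (Hu _ (e8 k))).
have HN k i j : (N k <= i)%N -> (N k <= j)%N -> L2_norm (u i - u j) < 8^-1 ^+ k.
  by rewrite /N; case: cid => N0 H; exact: H.
(* Partial sums, so that both [p k] and [p k.+1] are at least [N k]. *)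
pose p k := (\sum_(i < k.+1) N i)%N.
have pN k : (N k <= p k)%N by rewrite /p big_ord_recr /= leq_addl.
have pS k : (N k <= p k.+1)%N.
  by apply: leq_trans (pN k) _; rewrite /p [X in (_ <= X)%N]big_ord_recr /= leq_addr.
have fast k : L2_norm (u (p k.+1) - u (p k)) ^+ 2 <= 8^-1 ^+ k.
  have h := ltW (HN k _ _ (pS k) (pN k)).
  rewrite expr2; apply: le_trans (ler_pM (sqrtr_ge0 _) (sqrtr_ge0 _) h h) _.
  by rewrite ler_piMr ?(ltW (e8 _))// exprn_ile1 ?invr_ge0// invf_le1// ler1n.
pose fr k x := complex.Re (repr (u (p k)) x).
pose fi k x := complex.Im (repr (u (p k)) x).
have frL k : fr k \in Lfun mu 2%:E by have /andP[] := sqintP (repr (u (p k))).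
have fiL k : fi k \in Lfun mu 2%:E by have /andP[] := sqintP (repr (u (p k))).
have subE := repr_L2B.
have aeint (f g : R -> R) : f \in Lfun mu 2%:E -> g \in Lfun mu 2%:E ->
    {ae mu, forall x, f x = g x} -> (\int[mu]_x ((f x)^+2)%:E = (\int[mu]_x ((g x)^+2)%:E))%E.
  move=> /Lfun2P[mf _] /Lfun2P[mg _] fg; apply: ae_eq_integral => //.
  - exact/measurable_EFinP/measurable_funX.
  - exact/measurable_EFinP/measurable_funX.
  - by apply: ae_imply fg => x -> _.
have LB (f g : R -> R) : f \in Lfun mu 2%:E -> g \in Lfun mu 2%:E ->
    (fun x => f x - g x) \in Lfun mu 2%:E.
  move=> fL gL; have [_ /(_ (-1) _ _ gL fL)] := @Lfun_submod_closed _ _ R mu _ (lee1n 2 : (1 <= 2%:E)%E).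
  rewrite [X in X \in _ -> _](_ : _ = fun x => f x - g x)//.
  by apply/funext => x; rewrite !fctE /GRing.scale /= mulN1r addrC.
have normE v : ((L2_norm v ^+ 2)%:E = \int[mu]_x ((complex.Re (repr v x)) ^+ 2)%:E +
    \int[mu]_x ((complex.Im (repr v x)) ^+ 2)%:E)%E.
  have /andP[vr vi] := sqintP (repr v).
  by rewrite sqr_L2_norm EFinD -!Lfun2_Rintegral.
have int0 (f : R -> R) : (0 <= \int[mu]_x ((f x) ^+ 2)%:E)%E.
  by apply: integral_ge0 => x _; rewrite lee_fin sqr_ge0.
have fastr k : (\int[mu]_x ((fr k.+1 x - fr k x) ^+ 2)%:E <= (8^-1 ^+ k)%:E)%E.
  have := fast k; rewrite -lee_fin normE; apply: le_trans.
  have /andP[vr vi] := sqintP (repr (u (p k.+1) - u (p k))).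
  rewrite (aeint _ (fun x => fr k.+1 x - fr k x) vr); last 2 first.
  - exact: LB.
  - by apply: ae_imply (subE (u (p k.+1)) (u (p k))) => x ->; rewrite cReD cReN.
  by rewrite leeDl.
have fasti k : (\int[mu]_x ((fi k.+1 x - fi k x) ^+ 2)%:E <= (8^-1 ^+ k)%:E)%E.
  have := fast k; rewrite -lee_fin normE; apply: le_trans.
  have /andP[vr vi] := sqintP (repr (u (p k.+1) - u (p k))).
  rewrite (aeint _ (fun x => fi k.+1 x - fi k x) vi); last 2 first.
  - exact: LB.
  - by apply: ae_imply (subE (u (p k.+1)) (u (p k))) => x ->; rewrite cImD cImN.
  by rewrite leeDr.
have [gr grL Hgr] := Lfun2_fast_cauchy frL fastr.
have [gi giL Hgi] := Lfun2_fast_cauchy fiL fasti.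
have gL : (fun x => gr x +i* gi x) \in L2fun by apply/andP.
exists (L2_of gL) => e e0.
have conv k : L2_norm (u (p k) - L2_of gL) ^+ 2 <= 16 * 4^-1 ^+ k.
  have /andP[vr vi] := sqintP (repr (u (p k) - L2_of gL)).
  rewrite -lee_fin normE.
  rewrite (aeint _ (fun x => fr k x - gr x) vr (LB _ _ (frL k) grL)); last first.
    by apply: ae_imply2 (subE (u (p k)) (L2_of gL)) (repr_L2_of gL) => x -> ->; rewrite cReD cReN.
  rewrite (aeint _ (fun x => fi k x - gi x) vi (LB _ _ (fiL k) giL)); last first.
    by apply: ae_imply2 (subE (u (p k)) (L2_of gL)) (repr_L2_of gL) => x -> ->; rewrite cImD cImN.
  apply: le_trans (leeD (Hgr k) (Hgi k)) _; rewrite -EFinD lee_fin -mulrDl.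
  have -> : 8 + 8 = 16 :> R by lra.
  exact: lexx.
have e2 : 0 < e / 2 by rewrite divr_gt0.
have [k Hk1 Hk2] : exists2 k, 16 * (4^-1 : R) ^+ k < (e / 2) ^+ 2 & (8^-1 : R) ^+ k < e / 2.
  pose d := Num.min ((e / 2) ^+ 2 / 16) (e / 2).
  have d0 : 0 < d by rewrite lt_min e2 divr_gt0// exprn_gt0.
  have [k] := ltr_add_invr d0; rewrite add0r lt_min => /andP[d1 d2].
  have pw (a : R) : 2 <= a -> a^-1 ^+ k <= k.+1%:R^-1.
    move=> a2; have a0 : 0 < a by lra.
    rewrite exprVn lef_pV2 ?posrE ?exprn_gt0//.
    apply: (@le_trans _ _ (2 ^+ k)); last by rewrite lerXn2r// nnegrE ltW.
    by rewrite -natrX ler_nat ltn_expl.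
  exists k.
    rewrite mulrC -ltr_pdivlMr//; apply: le_lt_trans (pw _ _) d1; lra.
  by apply: le_lt_trans (pw _ _) d2; lra.
exists (p k) => i pi.
apply: le_lt_trans (ipnorm_tri L2_is_ip (u (p k)) _ _) _.
have h1 := HN k _ _ (leq_trans (pN k) pi) (pN k).
have h2 : L2_norm (u (p k) - L2_of gL) < e / 2.
  rewrite -ltr_sqr ?nnegrE ?sqrtr_ge0 ?(ltW e2)//; exact: le_lt_trans (conv k) Hk1.
rewrite (splitr e); exact: ltrD (lt_trans h1 Hk2) h2.
Qed.

Lemma mulopP m u : mul_dom m u ->
  {ae mu, forall x, repr (mulop m u) x = (m x)%:C * repr u x}.
Proof. by rewrite mulop.unlock; move=> [w Hw]; exact: (@xgetPex _ (0 : L2 R) [set w : L2 R | _] (ex_intro _ w Hw)). Qed.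

Lemma mulop_unique m u w : {ae mu, forall x, repr w x = (m x)%:C * repr u x} ->
  mulop m u = w.
Proof.
move=> Hw; apply: L2_eq; have d : mul_dom m u by exists w.
by apply: ae_imply2 (mulopP d) Hw => x -> ->.
Qed.

Lemma L2fun_mul m (h : R -> R[i]) (C : R) : measurable_fun setT m ->
  (forall x, `|m x| <= C) -> h \in L2fun -> (fun x => (m x)%:C * h x) \in L2fun.
Proof.
move=> mm mC /andP[hr hi].
have C0 : 0 <= C := le_trans (normr_ge0 _) (mC 0).
have key (f : R -> R) : f \in Lfun mu 2%:E -> (fun x => m x * f x) \in Lfun mu 2%:E.
  move=> fL; have /Lfun2P[mf fi] := fL.
  apply/Lfun2P; split; first exact: measurable_funM.
  apply: (@le_lt_trans _ _ (\int[mu]_x ((C ^+ 2)%:E * ((f x) ^+ 2)%:E))%E).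
    apply: ge0_le_integral => //.
    - by move=> x _; rewrite lee_fin sqr_ge0.
    - by apply/measurable_EFinP/measurable_funX; exact: measurable_funM.
    - by apply/measurable_EFinP/measurable_funM => //; exact: measurable_funX.
    - move=> x _; rewrite lee_fin exprMn ler_wpM2r ?sqr_ge0//.
      by rewrite -[m x ^+ 2]real_normK ?num_real// lerXn2r ?nnegrE.
  rewrite ge0_integralZl//.
  - by rewrite Lfun2_Rintegral// -EFinM ltry.
  - by apply/measurable_EFinP/measurable_funX.
  - by move=> x _; rewrite lee_fin sqr_ge0.
  - by rewrite lee_fin sqr_ge0.
apply/andP; split.
  rewrite (_ : (fun x => _) = fun x => m x * complex.Re (h x)); first exact: key.
  by apply/funext => x; rewrite [LHS]cReM /= mul0r subr0.
rewrite (_ : (fun x => _) = fun x => m x * complex.Im (h x)); first exact: key.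
by apply/funext => x; rewrite cImM /= mul0r addr0.
Qed.

Lemma mul_dom_bounded m (C : R) u : measurable_fun setT m -> (forall x, `|m x| <= C) ->
  mul_dom m u.
Proof.
move=> mm mC; have hL := L2fun_mul mm mC (sqintP (repr u)).
by exists (L2_of hL); exact: repr_L2_of.
Qed.

Lemma mulop_lin m c u v : mul_dom m u -> mul_dom m v ->
  mulop m (c *: u + v) = c *: mulop m u + mulop m v.
Proof.
move=> /mulopP du /mulopP dv; apply: mulop_unique.
apply: ae_imply4 (repr_L2P c u v) (repr_L2P c (mulop m u) (mulop m v)) du dv => x.
by move=> -> -> -> ->; rewrite mulrDr mulrCA.
Qed.

Lemma mulopDl m n u : mul_dom m u -> mul_dom n u ->
  mulop (fun x => m x + n x) u = mulop m u + mulop n u.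
Proof.
move=> /mulopP du /mulopP dv; apply: mulop_unique.
by apply: ae_imply3 (repr_L2D (mulop m u) (mulop n u)) du dv => x -> -> ->; rewrite rmorphD mulrDl.
Qed.

Lemma mulopZl (k : R) m u : mul_dom m u ->
  mulop (fun x => k * m x) u = k%:C *: mulop m u.
Proof.
move=> /mulopP du; apply: mulop_unique.
by apply: ae_imply2 (repr_L2Z k%:C (mulop m u)) du => x -> ->; rewrite rmorphM mulrA.
Qed.

Lemma mul_domD m n u : mul_dom m u -> mul_dom n u -> mul_dom (fun x => m x + n x) u.
Proof.
move=> /mulopP du /mulopP dv; exists (mulop m u + mulop n u).
by apply: ae_imply3 (repr_L2D (mulop m u) (mulop n u)) du dv => x -> -> ->; rewrite rmorphD mulrDl.
Qed.

Lemma mul_domZ (k : R) m u : mul_dom m u -> mul_dom (fun x => k * m x) u.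
Proof.
move=> /mulopP du; exists (k%:C *: mulop m u).
by apply: ae_imply2 (repr_L2Z k%:C (mulop m u)) du => x -> ->; rewrite rmorphM mulrA.
Qed.

Lemma mulop_cst (k : R) u : mulop (fun=> k) u = k%:C *: u.
Proof. by apply: mulop_unique; exact: repr_L2Z. Qed.

Lemma mul_dom_cst (k : R) u : mul_dom (fun=> k) u.
Proof. by exists (k%:C *: u); exact: repr_L2Z. Qed.

Lemma mulop_comp m n u : mul_dom n u -> mul_dom m (mulop n u) ->
  mulop m (mulop n u) = mulop (fun x => m x * n x) u.
Proof.
move=> /mulopP du /mulopP dv; symmetry; apply: mulop_unique.
by apply: ae_imply2 du dv => x -> ->; rewrite rmorphM mulrA.
Qed.

Lemma mul_dom_comp m n u : mul_dom n u -> mul_dom m (mulop n u) ->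
  mul_dom (fun x => m x * n x) u.
Proof.
move=> /mulopP du /mulopP dv; exists (mulop m (mulop n u)).
by apply: ae_imply2 du dv => x -> ->; rewrite rmorphM mulrA.
Qed.

Lemma mul_dom_swap m n u : mul_dom n u -> mul_dom m (mulop n u) -> mul_dom m u ->
  mul_dom n (mulop m u).
Proof.
move=> /mulopP du /mulopP dv /mulopP dm; exists (mulop m (mulop n u)).
by apply: ae_imply3 du dv dm => x -> -> ->; rewrite mulrCA.
Qed.

Lemma mulop_ipC m u v : mul_dom m u -> mul_dom m v ->
  L2_ip (mulop m u) v = L2_ip u (mulop m v).
Proof.
move=> /mulopP du /mulopP dv; rewrite /L2_ip.
have H u' v' := cintegrable_measurable (cintegrableM (sqintP (repr u')) (L2fun_conj (sqintP (repr v')))).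
have [? ?] := H (mulop m u) v; have [? ?] := H u (mulop m v).
apply: eq_cintegral => //; apply: ae_imply2 du dv => x -> ->.
by rewrite rmorphM /= oppr0 mulrCA mulrA.
Qed.

Lemma mulop_ge0 m u : (forall x, 0 <= m x) -> mul_dom m u ->
  0 <= complex.Re (L2_ip (mulop m u) u).
Proof.
move=> m0 /mulopP du.
have H u' v' := cintegrable_measurable (cintegrableM (sqintP (repr u')) (L2fun_conj (sqintP (repr v')))).
have [mr mi] := H (mulop m u) u; rewrite /L2_ip /= /Rintegral.
have mm : measurable_fun setT (fun x => `|complex.Re (repr (mulop m u) x * (repr u x)^*%C)|).
  exact: measurableT_comp.
rewrite (@ae_eq_integral _ _ _ mu setT (fun x => `|complex.Re (repr (mulop m u) x * (repr u x)^*%C)|%:E)) //.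
- by apply: fine_ge0; apply: integral_ge0 => x _; rewrite lee_fin.
- exact/measurable_EFinP.
- exact/measurable_EFinP.
- apply: ae_imply du => x -> _; congr EFin; rewrite ger0_norm//.
  rewrite -mulrA cReM /= mul0r subr0 mulr_ge0//.
  by rewrite cReM cReJ cImJ mulrN opprK -!expr2 addr_ge0// sqr_ge0.
Qed.

Lemma weight_integral_mulop m u v : measurable_fun setT m -> (forall x, 0 <= m x) ->
  mul_dom (fun x => Num.sqrt (m x)) u -> mul_dom (fun x => Num.sqrt (m x)) v ->
  weight_integral m (repr u) (repr v) =
  L2_ip (mulop (fun x => Num.sqrt (m x)) u) (mulop (fun x => Num.sqrt (m x)) v).
Proof.
move=> mm m0 du dv; rewrite /weight_integral /L2_ip.
have H u' v' := cintegrable_measurable (cintegrableM (sqintP (repr u')) (L2fun_conj (sqintP (repr v')))).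
have [hr hi] := H u v.
have [? ?] := H (mulop (fun x => Num.sqrt (m x)) u) (mulop (fun x => Num.sqrt (m x)) v).
apply: eq_cintegral => //.
- rewrite (_ : (fun x => _) = fun x => m x * complex.Re (repr u x * (repr v x)^*%C)).
    exact: measurable_funM.
  by apply/funext => x; rewrite [LHS]cReM /= mul0r subr0.
- rewrite (_ : (fun x => _) = fun x => m x * complex.Im (repr u x * (repr v x)^*%C)).
    exact: measurable_funM.
  by apply/funext => x; rewrite [LHS]cImM /= mul0r addr0.
- apply: ae_imply2 (mulopP du) (mulopP dv) => x -> ->.
  rewrite rmorphM /= oppr0 mulrACA -rmorphM /= -expr2 sqr_sqrtr//.
Qed.

Local Opaque L2_ip.

(** Positivity of the multiplication by [C^2 - m^2]. *)
Lemma mulop_norm_le m (C : R) u : measurable_fun setT m -> (forall x, `|m x| <= C) ->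
  L2_norm (mulop m u) <= C * L2_norm u.
Proof.
move=> mm mC; have C0 : 0 <= C := le_trans (normr_ge0 _) (mC 0).
have dm v : mul_dom m v := mul_dom_bounded v mm mC.
have dmm v : mul_dom (fun x => m x * m x) v := mul_dom_comp (dm v) (dm _).
rewrite -ler_sqr ?nnegrE ?mulr_ge0 ?sqrtr_ge0// exprMn.
rewrite !(sqr_ipnorm L2_is_ip) mulop_ipC// mulop_comp//.
have d := mul_domD (mul_dom_cst (C ^+ 2) u) (mul_domZ (-1) (dmm u)).
have := mulop_ge0 _ d; rewrite (mulopDl (mul_dom_cst (C ^+ 2) u) (mul_domZ (-1) (dmm u))).
rewrite mulop_cst (mulopZl (-1) (dmm u)).
rewrite (ipDl L2_is_ip) !(ipZl L2_is_ip) cReD !cReZ mulN1r (ipC L2_is_ip u (mulop _ u)) cReJ => H.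
rewrite -subr_ge0; apply: H => x.
rewrite mulN1r subr_ge0 -expr2 -[m x ^+ 2]real_normK ?num_real// lerXn2r ?nnegrE//.
Qed.

End L2_hilbert.

(** * Density of test functions in L2 *)

Section tests_dense_in_L2.
Context {R : realType}.
Local Notation mu := (@lebesgue_measure R).
Local Notation aeF := (ae_filter_ringOfSetsType mu).
Implicit Types (u v w : L2 R) (m : R -> R).
Local Opaque L2_ip smooth.

(** Dominated convergence with majorant [|v|^2]. Multipliers that vanish eventually at each point
    cover two uses: smoothed indicators of an interval, and the tails cut away by a cut-off of
    growing radius. *)
Lemma L2_dominated (m : nat -> R -> R) v : (forall n, measurable_fun setT (m n)) ->
  (forall n x, `|m n x| <= 1) ->
  (forall x, exists N, forall n, (N <= n)%N -> m n x = 0) ->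
  forall e, 0 < e -> exists N, forall n, (N <= n)%N -> L2_norm (mulop (m n) v) < e.
Proof.
move=> mm m1 m0 e e0.
have /andP[vr vi] := sqintP (repr v).
have key (f : R -> R) : f \in Lfun mu 2%:E -> forall d, 0 < d ->
    exists N, forall n, (N <= n)%N -> \int[mu]_x ((m n x * f x) ^+ 2) < d.
  move=> fL d d0; have /Lfun2P[mf fi] := fL.
  have mq n : measurable_fun [set: R] (fun x => ((m n x * f x) ^+ 2)%:E).
    by apply/measurable_EFinP; apply: measurable_funX; exact: measurable_funM.
  have dom n x : (`|((m n x * f x) ^+ 2)%:E| <= (f x ^+ 2)%:E)%E.
    rewrite gee0_abs ?lee_fin ?sqr_ge0// exprMn ler_piMl ?sqr_ge0//.
    by rewrite -[m n x ^+ 2]real_normK ?num_real// exprn_ile1.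
  have ptw x : ((m n x * f x) ^+ 2)%:E @[n --> \oo] --> (0%:E : \bar R).
    apply: cvg_near_cst; have [N HN] := m0 x; exists N => // n /= Nn.
    by rewrite HN// mul0r expr0n.
  have := @dominated_cvg _ _ _ mu setT measurableT (fun n x => ((m n x * f x) ^+ 2)%:E)
    (fun=> 0%:E) (fun x => (f x ^+ 2)%:E) mq (fun x _ => ptw x) (fun x _ => isT)
    (Lfun2_integrable_sqr fL) (fun n x _ => dom n x).
  rewrite integral0 => /fine_cvgP[_ /cvgrPdist_lt /(_ d d0)[N _ HN]].
  exists N => n /HN /=; rewrite sub0r normrN ger0_norm//.
  by apply: fine_ge0; apply: integral_ge0 => x _; rewrite lee_fin sqr_ge0.
have d0 : 0 < e ^+ 2 / 2 by rewrite divr_gt0// exprn_gt0.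
have [N1 H1] := key _ vr _ d0; have [N2 H2] := key _ vi _ d0.
exists (maxn N1 N2) => n; rewrite geq_max => /andP[/H1 n1 /H2 n2].
rewrite -ltr_sqr ?nnegrE ?sqrtr_ge0 ?(ltW e0)// sqr_L2_norm.
have dm := mulopP (mul_dom_bounded v (mm n) (m1 n)).
have /andP[wr wi] := sqintP (repr (mulop (m n) v)).
have E (f g : R -> R) : f \in Lfun mu 2%:E -> measurable_fun [set: R] g ->
    {ae mu, forall x, f x = g x} -> \int[mu]_x (f x ^+ 2) = \int[mu]_x (g x ^+ 2).
  move=> /Lfun2P[mf _] mg fg; rewrite /Rintegral; congr fine.
  apply: ae_eq_integral => //.
  - exact/measurable_EFinP/measurable_funX.
  - exact/measurable_EFinP/measurable_funX.
  - by apply: ae_imply fg => x -> _.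
rewrite (E _ (fun x => m n x * complex.Re (repr v x)) wr); last 2 first.
- by apply: measurable_funM => //; have /Lfun2P[] := vr.
- by apply: ae_imply dm => x ->; rewrite cReZ.
rewrite (E _ (fun x => m n x * complex.Im (repr v x)) wi); last 2 first.
- by apply: measurable_funM => //; have /Lfun2P[] := vi.
- by apply: ae_imply dm => x ->; rewrite cImZ.
by rewrite [X in _ < X]splitr ltrD.
Qed.

Lemma real_is_test (g : R -> R) (M : R) : smooth g -> (forall x, M <= `|x| -> g x = 0) ->
  (fun x => (g x)%:C) \in is_test.
Proof.
move=> sg g0; apply/asboolP; split.
- exact: sg.
- exact: (@smooth_cst R 0).
- apply: (@subclosed_compact _ _ `[- M, M]); [exact: closed_closure|exact: segment_compact|].
  rewrite [X in _ `<=` X](closure_id _).1; last exact: interval_closed.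
  apply: closure_subset => x /= gx; rewrite in_itv /= -ler_norml leNgt.
  by apply/negP => /ltW/g0 E; move: gx; rewrite E eqxx.
Qed.

Lemma itv_L2fun (a b : R) : (fun x => (\1_(`[a, b]) x)%:C) \in @L2fun R.
Proof.
apply/andP; split; last by have [] := @Lfun_submod_closed _ _ R mu _ (lee1n 2 : (1 <= 2%:E)%E).
apply/Lfun2P; split; first exact: measurable_indic.
have -> : (\int[mu]_x ((\1_(`[a, b]) x) ^+ 2)%:E = \int[mu]_x (\1_(`[a, b]) x)%:E)%E.
  by apply: eq_integral => x _; rewrite indicE; case: (_ \in _); rewrite ?expr1n ?expr0n.
rewrite integral_indic// setIT [X in (X < _)%E](lebesgue_measure_itv (Interval (BLeft a) (BRight b))) /=.
by case: ifPn => _; rewrite ?ltry// -EFinD ltry.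
Qed.

Lemma L2_ip_itv u (a b : R) :
  L2_ip u (L2_of (itv_L2fun a b)) =
  (\int[mu]_(x in `[a, b]) complex.Re (repr u x)) +i*
  (\int[mu]_(x in `[a, b]) complex.Im (repr u x)).
Proof.
rewrite (L2_ip_eq (sqintP (repr u)) (itv_L2fun a b)); last 2 first.
- by apply: ae_imply repr_L2_0.
- exact: repr_L2_of.
rewrite /cintegral; apply: complexP => /=.
- rewrite [RHS]Rintegral_mkcond; congr Rintegral; apply/funext => x.
  rewrite patchE cReM /= oppr0 mulr0 subr0 indicE; case: (_ \in _); rewrite ?mulr1 ?mulr0//.
- rewrite [RHS]Rintegral_mkcond; congr Rintegral; apply/funext => x.
  rewrite patchE cImM /= oppr0 mulr0 add0r indicE; case: (_ \in _); rewrite ?mulr1 ?mulr0//.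
Qed.

(** [g n] equals 1 on the closed interval and falls to 0 within distance [1/(n+1)] outside it. The
    error is thus [m n * v], with [v] the indicator of [[a - 1, b + 1]] and [m n] eventually 0 at
    every point. *)
Lemma smooth_itv (a b : R) : exists psi : nat -> test R,
  forall e, 0 < e -> exists n, L2_norm (test_L2 (psi n) - L2_of (itv_L2fun a b)) < e.
Proof.
have [st ss [s01 s0 s1]] := @smooth_step R.
pose g n x := st (n.+1%:R * x + (1 - n.+1%:R * a)) * st (- n.+1%:R * x + (1 + n.+1%:R * b)).
have sg n : smooth (g n) by exact: (smoothM (smooth_affine ss) (smooth_affine ss)).
have n1 n : 1 <= n.+1%:R :> R by rewrite ler1n.
have g_in n x : a <= x <= b -> g n x = 1.
  move=> /andP[ax xb]; rewrite /g !s1 ?mulr1//.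
    by have : 0 <= n.+1%:R * (b - x) by [rewrite mulr_ge0// subr_ge0]; lra.
  by have : 0 <= n.+1%:R * (x - a) by [rewrite mulr_ge0// subr_ge0]; lra.
have g_lt n x : n.+1%:R * (a - x) >= 1 -> g n x = 0.
  by move=> h; rewrite /g s0 ?mul0r//; lra.
have g_gt n x : n.+1%:R * (x - b) >= 1 -> g n x = 0.
  by move=> h; rewrite /g [X in _ * X]s0 ?mulr0//; lra.
have g01 n x : 0 <= g n x <= 1.
  rewrite /g; set p := st _; set p' := st _.
  have /andP[p0 p1] : 0 <= p <= 1 := s01 _; have /andP[q0 q1] : 0 <= p' <= 1 := s01 _.
  by rewrite mulr_ge0//= mulr_ile1.
have g_out n x : x <= a - 1 \/ b + 1 <= x -> g n x = 0.
  move=> [h|h]; [apply: g_lt|apply: g_gt].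
    by have : 0 <= (n.+1%:R - 1) * (a - x - 1) by [rewrite mulr_ge0 ?subr_ge0//; lra]; have := n1 n; lra.
  by have : 0 <= (n.+1%:R - 1) * (x - b - 1) by [rewrite mulr_ge0 ?subr_ge0//; lra]; have := n1 n; lra.
have g_big n x : `|a| + `|b| + 1 <= `|x| -> g n x = 0.
  move=> h; apply: g_out.
  have := ler_norm b; have := ler_norm (- a); rewrite normrN.
  have := normr_ge0 a; have := normr_ge0 b.
  have [x0|x0] := leP 0 x; [right|left].
    by move: h; rewrite (ger0_norm x0); lra.
  by move: h; rewrite (ltr0_norm x0); lra.
exists (fun n => Test (real_is_test (sg n) (g_big n))) => e e0.
pose v := L2_of (itv_L2fun (a - 1) (b + 1)).
pose m n x : R := g n x - \1_(`[a, b]) x.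
have indE x : \1_(`[a, b]) x = (if a <= x <= b then 1 else 0) :> R.
  rewrite indicE; case: ifPn => h; first by rewrite mem_set//= in_itv.
  by rewrite memNset//= in_itv /=; apply/negP.
have [||| N HN] := @L2_dominated m v _ _ _ e e0.
- move=> n; apply: measurable_funB; last exact: measurable_indic.
  exact: continuous_measurable_fun (smooth_continuous (sg n)).
- move=> n x; rewrite /m indE; case: ifPn => [/g_in ->|_]; first by rewrite subrr normr0.
  by rewrite subr0; have /andP[p0 p1] := g01 n x; rewrite ger0_norm.
- move=> x; rewrite /m indE; case: ifPn => [h|].
    by exists 0%N => n _; rewrite g_in// subrr.
  have [ax|xa] := leP a x.
    rewrite /= -ltNge => bx; have xb : 0 < x - b by rewrite subr_gt0.
    have [N] := ltr_add_invr xb; rewrite add0r => HN; exists N => n Nn; rewrite subr0 g_gt//.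
    have : N.+1%:R^-1 * N.+1%:R <= (x - b) * n.+1%:R.
      by apply: ler_pM; rewrite ?invr_ge0// ?(ltW HN)// ler_nat.
    by rewrite mulVf ?pnatr_eq0// mulrC.
  move=> _; have ax : 0 < a - x by rewrite subr_gt0.
  have [N] := ltr_add_invr ax; rewrite add0r => HN; exists N => n Nn; rewrite subr0 g_lt//.
  have : N.+1%:R^-1 * N.+1%:R <= (a - x) * n.+1%:R.
    by apply: ler_pM; rewrite ?invr_ge0// ?(ltW HN)// ler_nat.
  by rewrite mulVf ?pnatr_eq0// mulrC.
exists N; have := HN N (leqnn _).
set psi := Test _; rewrite (@mulop_unique _ _ _ (test_L2 psi - L2_of (itv_L2fun a b)))//.
apply: ae_imply4 (repr_L2B (test_L2 psi) (L2_of (itv_L2fun a b))) (repr_test_L2 psi)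
  (repr_L2_of (itv_L2fun a b)) (repr_L2_of (itv_L2fun (a - 1) (b + 1))) => x -> -> -> ->.
rewrite /= -rmorphB -rmorphM; congr (_%:C); rewrite -/(m N x).
have [h|h] := boolP (x \in `[a - 1, b + 1]%classic).
  by rewrite indicE h mulr1.
rewrite indicE (negPf h) mulr0 /m indE.
have [h1|h1] : x <= a - 1 \/ b + 1 <= x.
- have [?|?] := leP x (a - 1); first by left.
  have [?|?] := leP (b + 1) x; first by right.
  by exfalso; move/negP: h; apply; rewrite inE /= in_itv /= !ltW.
- rewrite g_out; last by left.
  by case: ifPn => [/andP[ax _]|_]; rewrite ?subrr//; lra.
- rewrite g_out; last by right.
  by case: ifPn => [/andP[_ xb]|_]; rewrite ?subrr//; lra.
Qed.

(** Smoothed indicators show that [u] has integral 0 over every compact interval; Lebesgue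
    differentiation then gives [u = 0] almost everywhere. *)
Lemma fundamental_lemma u : (forall phi : test R, L2_ip u (test_L2 phi) = 0) -> u = 0.
Proof.
move=> u0.
have int0 (a b : R) : L2_ip u (L2_of (itv_L2fun a b)) = 0.
  have [psi Hpsi] := smooth_itv a b.
  apply: cabs_eq0; apply/eqP; rewrite eq_le cabs_ge0 andbT; apply/ler_addgt0Pl => e e0.
  have c0 : 0 < L2_norm u + 1 by rewrite ltr_wpDl// sqrtr_ge0.
  have [n Hn] := Hpsi _ (divr_gt0 e0 c0).
  have -> : L2_ip u (L2_of (itv_L2fun a b)) =
     - L2_ip u (test_L2 (psi n) - L2_of (itv_L2fun a b)).
    by rewrite (ipBr L2_is_ip) u0 sub0r opprK.
  rewrite addr0 cabsN; apply: le_trans (cauchy_schwarz L2_is_ip _ _) _.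
  apply: le_trans (ler_wpM2l (ipnorm_ge0 _ _) (ltW Hn)) _.
  by rewrite mulrCA ler_piMr ?(ltW e0)// ler_pdivrMr// mul1r lerDl.
have /andP[ur ui] := sqintP (repr u).
have key (f : R -> R) : f \in Lfun mu 2%:E ->
    (forall a b : R, \int[mu]_(x in `[a, b]) f x = 0) -> {ae mu, forall x, f x = 0}.
  move=> fL f0; have /Lfun2P[mf _] := fL.
  have ind1 (a b : R) : \1_(`[a, b]) \in Lfun mu 2%:E by have /andP[] := itv_L2fun a b.
  have fi (a b : R) : mu.-integrable `[a, b] (EFin \o f).
    have /Lfun1_integrable h := Lfun2_mul_Lfun1 fL (ind1 a b).
    have h2 : mu.-integrable `[a, b] (EFin \o (f \* \1_(`[a, b]))).
      exact: integrableS h.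
    apply: eq_integrable h2 => // x xab.
    by rewrite /= indicE xab mulr1.
  have loc : locally_integrable setT f.
    split => //; first exact: openT.
    move=> K _ cK; have [M [Mr HM]] := compact_bounded cK.
    have KM : K `<=` `[- (M + 1), M + 1].
      by move=> x Kx; rewrite /= in_itv /= -ler_norml; apply: HM => //; rewrite ltrDl.
    have /integrableP[_] := fi (- (M + 1)) (M + 1).
    apply: le_lt_trans; apply: ge0_subset_integral => //.
    - exact: closed_measurable (compact_closed (@Rhausdorff R) cK).
    - apply/measurable_EFinP; apply: measurableT_comp => //.
      exact: measurable_funS mf.
  (* On the half-line starting at [- n] the primitive is identically 0; the half-lines exhaust the
     line. *)
  have H n : {ae mu, forall x, - n%:R < x -> f x = 0}.
    have := @FTC1 R f (BLeft (- n%:R)) (fun y => fi _ _) loc.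
    apply: ae_imply => x + nx => /(_ _)[]; first by rewrite lte_fin.
    move=> _ <-; rewrite (_ : (fun x => _) = fun=> 0) ?derive1_cst//.
    by apply/funext => y; exact: f0.
  have := ae_foralln H; apply: ae_imply => x Hx; apply: (Hx (Num.bound `|x|)).
  have := archi_boundP (normr_ge0 x).
  by rewrite ltr_norml => /andP[].
have r0 (a b : R) : \int[mu]_(x in `[a, b]) complex.Re (repr u x) = 0.
  by have := int0 a b; rewrite L2_ip_itv => -[].
have i0 (a b : R) : \int[mu]_(x in `[a, b]) complex.Im (repr u x) = 0.
  by have := int0 a b; rewrite L2_ip_itv => -[].
apply: L2_eq; apply: ae_imply3 (key _ ur r0) (key _ ui i0) repr_L2_0 => x hr hi ->.
exact: complexP.
Qed.

Lemma test_L2_lin c (f g : test R) : test_L2 (c *: f + g) = c *: test_L2 f + test_L2 g.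
Proof.
apply: L2_eq; apply: ae_imply4 (repr_test_L2 (c *: f + g)) (repr_L2P c (test_L2 f) (test_L2 g))
  (repr_test_L2 f) (repr_test_L2 g) => x -> -> -> ->.
by [].
Qed.

(** Instead of mollifying, [u] is projected on the closure of the tests; the remainder is orthogonal
    to all tests, hence 0. *)
Lemma tests_dense_L2 u e : 0 < e -> exists phi : test R, L2_norm (test_L2 phi - u) < e.
Proof.
move=> e0.
have t0 : test_L2 0 = 0 :> L2 R.
  by have := test_L2_lin (-1) 0 0; rewrite scaler0 addr0 scaleN1r addNr.
have [||m [Hm Om]] := @projection _ _ _ (@L2_is_ip R) (range (@test_L2 R)) _ _ L2_complete u.
- by exists 0.
- by move=> c _ _ [f _ <-] [g _ <-]; exists (c *: f + g) => //; rewrite test_L2_lin.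
have um : u - m = 0 by apply: fundamental_lemma => phi; apply: Om; exists phi.
have [_ [phi _ <-] h] := Hm e e0; exists phi.
by move/eqP: um; rewrite subr_eq0 => /eqP ->.
Qed.

End tests_dense_in_L2.

(** * Weak derivatives and the space DS *)

Section weak_derivatives.
Context {R : realType}.
Local Notation mu := (@lebesgue_measure R).
Implicit Types (u v w : L2 R) (phi : test R).
Local Opaque L2_ip smooth.

Lemma test_smooth phi : [/\ smooth (fun x => complex.Re (phi x)),
  smooth (fun x => complex.Im (phi x)) & compact (closure [set x | phi x != 0])].
Proof. exact/asboolP/(testP phi). Qed.

Lemma test_conj_subproof phi : (fun x => (phi x)^*%C) \in is_test.
Proof.
have [fr fi fc] := test_smooth phi; apply/asboolP; split.
- rewrite (_ : (fun x => _) = fun x => complex.Re (phi x))//.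
  by apply/funext => x; rewrite cReJ.
- rewrite (_ : (fun x => _) = fun x => - complex.Im (phi x)); first exact: smoothN fi.
  by apply/funext => x; rewrite cImJ.
- rewrite (_ : [set x | _] = [set x | phi x != 0])//.
  by apply/seteqP; split => x /=; rewrite conjc_eq0.
Qed.

Definition test_conj phi : test R := Test (test_conj_subproof phi).

Lemma cderive_conj phi x : cderive (test_conj phi) x = (cderive phi x)^*%C.
Proof.
have [fr fi fc] := test_smooth phi; apply: complexP.
  rewrite cReJ /cderive /=; congr (_^`()%classic x).
  by apply/funext => y; rewrite cReJ.
rewrite cImJ /cderive /= -(derive1_is (is_deriveN (smooth_is_derive x fi))).
by congr (_^`()%classic x); apply/funext => y; rewrite cImJ.
Qed.

Lemma L2_ip_test u phi : L2_ip u (test_L2 phi) = cintegral (fun x => repr u x * (phi x)^*%C).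
Proof.
apply: (L2_ip_eq (sqintP (repr u)) (test_L2fun phi)); last exact: repr_test_L2.
by apply: ae_imply repr_L2_0.
Qed.

(** [weak_derivative] uses a bilinear pairing; conjugating the test turns it into the inner product,
    for which the Hilbert space lemmas are stated. *)
Lemma weak_derivativeP u v : weak_derivative u v <->
  forall phi, L2_ip u (test_L2 (test_derive phi)) = - L2_ip v (test_L2 phi).
Proof.
have E phi : (fun x => repr u x * cderive (test_conj phi) x) =
    (fun x => repr u x * (test_derive phi x)^*%C).
  by apply/funext => x; rewrite cderive_conj.
split=> H phi.
  by rewrite !L2_ip_test -E; exact: H (test_conj phi).
have -> : phi = test_conj (test_conj phi).
  by apply: val_inj; apply/funext => x /=; rewrite conjcK.
rewrite E -L2_ip_test H L2_ip_test; congr (- cintegral _).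
Qed.

Lemma ip_tests_ext u v : (forall phi, L2_ip u (test_L2 phi) = L2_ip v (test_L2 phi)) -> u = v.
Proof.
move=> H; apply/eqP; rewrite -subr_eq0; apply/eqP/fundamental_lemma => phi.
by rewrite (ipBl (@L2_is_ip R)) H subrr.
Qed.

Lemma weak_derivative_unique u v w : weak_derivative u v -> weak_derivative u w -> v = w.
Proof.
move=> /weak_derivativeP uv /weak_derivativeP uw; apply: ip_tests_ext => phi.
by apply: oppr_inj; rewrite -uv -uw.
Qed.

Lemma weak_derE u v : weak_derivative u v -> weak_der u = v.
Proof.
move=> uv; apply: (weak_derivative_unique (u := u)) => //.
exact: (@xgetPex _ (0 : L2 R) [set v : L2 R | weak_derivative u v] (ex_intro _ v uv)).
Qed.

Lemma weak_derivative_lin c u u' v v' : weak_derivative u u' -> weak_derivative v v' ->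
  weak_derivative (c *: u + v) (c *: u' + v').
Proof.
move=> /weak_derivativeP uv /weak_derivativeP uw; apply/weak_derivativeP => phi.
by rewrite !(ip_lin (@L2_is_ip R)) uv uw mulrN -opprD.
Qed.

Lemma test_mul_subproof (m : R -> R) phi : smooth m -> (fun x => (m x)%:C * phi x) \in is_test.
Proof.
move=> sm; have [fr fi fc] := test_smooth phi; apply/asboolP; split.
- rewrite (_ : (fun x => _) = fun x => m x * complex.Re (phi x)); first exact: (smoothM sm fr).
  by apply/funext => x; rewrite cReZ.
- rewrite (_ : (fun x => _) = fun x => m x * complex.Im (phi x)); first exact: (smoothM sm fi).
  by apply/funext => x; rewrite cImZ.
- apply: (subclosed_compact _ fc); first exact: closed_closure.
  by apply: closure_subset => x /=; apply: contra => /eqP ->; rewrite mulr0.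
Qed.

Definition test_mul (m : R -> R) (sm : smooth m) phi : test R := Test (test_mul_subproof phi sm).

Lemma mul_test_L2fun (m : R -> R) phi : continuous m -> (fun x => (m x)%:C * phi x) \in L2fun.
Proof.
move=> cm; have [fr fi _] := test_smooth phi; have [M _ f0] := test_bound phi.
apply: (@zero_outside_L2fun _ _ M); last by move=> x /f0 ->; rewrite mulr0.
- rewrite (_ : (fun x => _) = m \* (fun x => complex.Re (phi x))).
    by move=> x; apply: continuousM; [exact: cm|exact: (smooth_continuous fr)].
  by apply/funext => x; rewrite cReZ.
- rewrite (_ : (fun x => _) = m \* (fun x => complex.Im (phi x))).
    by move=> x; apply: continuousM; [exact: cm|exact: (smooth_continuous fi)].
  by apply/funext => x; rewrite cImZ.
Qed.

Lemma mul_dom_test (m : R -> R) phi : continuous m -> mul_dom m (test_L2 phi).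
Proof.
move=> cm; exists (L2_of (mul_test_L2fun phi cm)).
by apply: ae_imply2 (repr_L2_of (mul_test_L2fun phi cm)) (repr_test_L2 phi) => x -> ->.
Qed.

Lemma mulop_test (m : R -> R) phi (sm : smooth m) :
  mulop m (test_L2 phi) = test_L2 (test_mul sm phi).
Proof.
apply: mulop_unique.
by apply: ae_imply2 (repr_test_L2 (test_mul sm phi)) (repr_test_L2 phi) => x -> ->.
Qed.

Lemma test_derive_mul (m : R -> R) phi (sm : smooth m) :
  test_L2 (test_derive (test_mul sm phi)) =
  mulop m^`()%classic (test_L2 phi) + mulop m (test_L2 (test_derive phi)).
Proof.
have [fr fi _] := test_smooth phi.
have sm' := smooth_derive sm; rewrite (mulop_test _ sm') (mulop_test _ sm).
apply: L2_eq.
apply: ae_imply4 (repr_test_L2 (test_derive (test_mul sm phi)))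
  (repr_L2D (test_L2 (test_mul sm' phi)) (test_L2 (test_mul sm (test_derive phi))))
  (repr_test_L2 (test_mul sm' phi)) (repr_test_L2 (test_mul sm (test_derive phi))) => x -> -> -> ->.
apply: complexP => /=.
  rewrite cReD !cReZ /cderive /=.
  rewrite (_ : (fun y => _) = fun y => m y * complex.Re (phi y)); last first.
    by apply/funext => y; rewrite cReZ.
  rewrite (derive1_is (is_deriveM (smooth_is_derive x sm) (smooth_is_derive x fr))).
  by rewrite addrC [in LHS]/GRing.scale /= mulrC.
rewrite cImD !cImZ /cderive /=.
rewrite (_ : (fun y => _) = fun y => m y * complex.Im (phi y)); last first.
  by apply/funext => y; rewrite cImZ.
rewrite (derive1_is (is_deriveM (smooth_is_derive x sm) (smooth_is_derive x fi))).
by rewrite addrC [in LHS]/GRing.scale /= mulrC.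
Qed.

Lemma weak_derivative_mul (m : R -> R) u v : smooth m -> weak_derivative u v ->
  mul_dom m u -> mul_dom m^`()%classic u -> mul_dom m v ->
  weak_derivative (mulop m u) (mulop m^`()%classic u + mulop m v).
Proof.
move=> sm /weak_derivativeP uv du du' dv; apply/weak_derivativeP => phi.
have cm := smooth_continuous sm; have cm' := smooth_continuous (smooth_derive sm).
have dt f : mul_dom m (test_L2 f) by exact: mul_dom_test.
have dt' f : mul_dom m^`()%classic (test_L2 f) by exact: mul_dom_test.
rewrite (ipDl (@L2_is_ip R)) (mulop_ipC du (dt _)) (mulop_ipC du' (dt' _)) (mulop_ipC dv (dt _)).
rewrite [X in _ = - (_ + L2_ip _ X)](mulop_test _ sm) opprD -uv test_derive_mul.
by rewrite (ipDr (@L2_is_ip R)) addKr.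
Qed.

(* Closedness is phrased with one approximating element per precision e. *)
Lemma weak_derivative_closed u v :
  (forall e, 0 < e -> exists u' v', [/\ weak_derivative u' v',
     L2_norm (u' - u) < e & L2_norm (v' - v) < e]) -> weak_derivative u v.
Proof.
move=> H; apply/weak_derivativeP => phi; apply/eqP; rewrite -subr_eq0 opprK; apply/eqP.
set f := test_L2 phi; set g := test_L2 _.
apply: cabs_eq0; apply/eqP; rewrite eq_le cabs_ge0 andbT; apply/ler_addgt0Pl => e e0.
have n0 : 0 <= L2_norm f + L2_norm g by rewrite addr_ge0 ?sqrtr_ge0.
have c0 : 0 < L2_norm f + L2_norm g + 1 by rewrite ltr_wpDl.
have [u' [v' [/weak_derivativeP uv hu hv]]] := H _ (divr_gt0 e0 c0).
have := uv phi; rewrite -/f -/g => /eqP; rewrite -subr_eq0 opprK => /eqP E.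
have -> : L2_ip u g + L2_ip v f = - (L2_ip (u' - u) g + L2_ip (v' - v) f).
  by rewrite !(ipBl (@L2_is_ip R)) addrACA E -opprD sub0r opprK.
rewrite addr0 cabsN; apply: le_trans (cabsD _ _) _.
have h1 := le_trans (cauchy_schwarz (@L2_is_ip R) (u' - u) g) (ler_wpM2r (ipnorm_ge0 _ _) (ltW hu)).
have h2 := le_trans (cauchy_schwarz (@L2_is_ip R) (v' - v) f) (ler_wpM2r (ipnorm_ge0 _ _) (ltW hv)).
apply: le_trans (lerD h1 h2) _; rewrite -mulrDr mulrAC -mulrA ler_piMr ?(ltW e0)//.
rewrite ler_pdivrMr// mul1r [X in X <= _]addrC lerDl//.
Qed.

(** Closedness of the multiplication by a possibly unbounded [m]. Pairing with tests passes to the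
    limit because [m phi] is in [L2]; a cut-off then makes the multiplier bounded, which turns the
    pairings into a pointwise identity on each ball. *)
Lemma mulop_closed (m : R -> R) u k : continuous m ->
  (forall e, 0 < e -> exists u', [/\ mul_dom m u',
     L2_norm (u' - u) < e & L2_norm (mulop m u' - k) < e]) ->
  {ae mu, forall x, repr k x = (m x)%:C * repr u x}.
Proof.
move=> cm H.
have pair phi : L2_ip k (test_L2 phi) = L2_ip u (mulop m (test_L2 phi)).
  set f := test_L2 phi; set g := mulop m f.
  apply/eqP; rewrite -subr_eq0; apply/eqP.
  apply: cabs_eq0; apply/eqP; rewrite eq_le cabs_ge0 andbT; apply/ler_addgt0Pl => e e0.
  have n0 : 0 <= L2_norm f + L2_norm g by rewrite addr_ge0 ?sqrtr_ge0.
  have c0 : 0 < L2_norm f + L2_norm g + 1 by rewrite ltr_wpDl.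
  have [u' [du hu hv]] := H _ (divr_gt0 e0 c0).
  have -> : L2_ip k f - L2_ip u g = L2_ip (u' - u) g - L2_ip (mulop m u' - k) f.
    rewrite !(ipBl (@L2_is_ip R)) (mulop_ipC du (mul_dom_test phi cm)) -/f -/g.
    by ring.
  rewrite addr0; apply: le_trans (cabsD _ _) _; rewrite cabsN.
  have h1 := le_trans (cauchy_schwarz (@L2_is_ip R) (u' - u) g) (ler_wpM2r (ipnorm_ge0 _ _) (ltW hu)).
  have h2 := le_trans (cauchy_schwarz (@L2_is_ip R) (mulop m u' - k) f) (ler_wpM2r (ipnorm_ge0 _ _) (ltW hv)).
  apply: le_trans (lerD h1 h2) _; rewrite -mulrDr mulrAC -mulrA ler_piMr ?(ltW e0)//.
  rewrite ler_pdivrMr// mul1r [X in X <= _]addrC lerDl//.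
have [kap k0 Hcut] := @smooth_cutoff R.
have loc (N : nat) : {ae mu, forall x, `|x| <= N.+1%:R -> repr k x = (m x)%:C * repr u x}.
  have [c sc [c01 c1 c0 _]] := Hcut N.+1%:R (ltr0Sn _ _).
  have cc := smooth_continuous sc.
  have cb x : `|c x| <= 1 by have /andP[? ?] := c01 x; rewrite ger0_norm.
  have mc : measurable_fun setT c by exact: continuous_measurable_fun.
  have ccm : continuous (fun x => c x * m x).
    by move=> x; apply: continuousM; [exact: cc|exact: cm].
  have [C C0 HC] : exists2 C : R, 0 < C & forall x, `|c x * m x| <= C.
    apply: (@continuous_bounded_outside _ _ (2 * N.+1%:R) 0 ccm) => x /c0 ->.
    by rewrite mul0r normr0.
  have mcm : measurable_fun setT (fun x => c x * m x) by exact: continuous_measurable_fun.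
  have dk := mul_dom_bounded k mc cb.
  have du := mul_dom_bounded u mcm HC.
  have E : mulop c k = mulop (fun x => c x * m x) u.
    apply: ip_tests_ext => phi.
    rewrite (mulop_ipC dk (mul_dom_test phi cc)) (mulop_test _ sc) pair -(mulop_test _ sc).
    rewrite (mulop_ipC du (mul_dom_test phi ccm)).
    have d1 := mul_dom_test phi cc.
    have d2 : mul_dom m (mulop c (test_L2 phi)) by rewrite (mulop_test _ sc); exact: mul_dom_test.
    have mcE : (fun x => m x * c x) = (fun x => c x * m x) by apply/funext => x; rewrite mulrC.
    by rewrite (mulop_comp d1 d2) mcE.
  have := mulopP du; rewrite -E; apply: ae_imply2 (mulopP dk) => x -> h xN.
  by move: h; rewrite c1// !mul1r.
have := ae_foralln loc; apply: ae_imply => x Hx; apply: (Hx (Num.bound `|x|)).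
by rewrite (le_trans (ltW (archi_boundP (normr_ge0 x))))// ler_nat.
Qed.

End weak_derivatives.

(** [dsD d], [dsQ d] and [dsA d] are [d'], [sqrt q d] and [sqrt a d]. Through them the weighted
    integrals in the norm of [DS] become inner products in [L2]. *)
HB.lock Definition dsD {R : realType} {a q : R -> R} (d : DS a q) : L2 R := weak_der d.
Definition dsQ {R : realType} {a q : R -> R} (d : DS a q) : L2 R :=
  mulop (fun x => Num.sqrt (q x)) d.
Definition dsA {R : realType} {a q : R -> R} (d : DS a q) : L2 R :=
  mulop (fun x => Num.sqrt (a x)) d.

Section DS_space.
Context {R : realType}.
Local Notation mu := (@lebesgue_measure R).
Variables a q : R -> R.
Hypotheses (sa : smooth a) (sq : smooth q).
Hypotheses (a0 : forall x, 0 <= a x) (q0 : forall x, 0 <= q x).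
Implicit Types (u v w : L2 R) (phi : test R) (d : DS a q).
Local Opaque L2_ip smooth.

Local Notation sqq := (fun x => Num.sqrt (q x)).
Local Notation sqa := (fun x => Num.sqrt (a x)).

Lemma dsDE d : dsD d = weak_der d.
Proof. by rewrite dsD.unlock. Qed.

Lemma continuous_sqrt (m : R -> R) : smooth m -> continuous (fun x => Num.sqrt (m x)).
Proof.
by move=> sm x; apply: continuous_comp; [exact: (smooth_continuous sm)|exact: sqrt_continuous].
Qed.

Lemma smooth_measurable (m : R -> R) : smooth m -> measurable_fun setT m.
Proof. by move=> sm; exact: (continuous_measurable_fun (smooth_continuous sm)). Qed.

Lemma dsP d : [/\ weak_derivative d (dsD d), mul_dom sqq d & mul_dom sqa d].
Proof.
have /asboolP[[v dv] dq da] := DSP d; split => //.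
by rewrite dsDE (weak_derE dv).
Qed.

Lemma DS_valE c d (e : DS a q) : DS_val (c *: d + e) = c *: DS_val d + DS_val e.
Proof. by []. Qed.

Lemma DS_val_inj d (e : DS a q) : DS_val d = DS_val e -> d = e.
Proof. exact: val_inj. Qed.

Lemma dsD_lin c d (e : DS a q) : dsD (c *: d + e) = c *: dsD d + dsD e.
Proof.
have [wd _ _] := dsP d; have [we _ _] := dsP e.
by rewrite dsDE; apply: weak_derE; rewrite DS_valE; exact: weak_derivative_lin.
Qed.

Lemma dsQ_lin c d (e : DS a q) : dsQ (c *: d + e) = c *: dsQ d + dsQ e.
Proof.
have [_ wd _] := dsP d; have [_ we _] := dsP e.
by rewrite /dsQ DS_valE mulop_lin.
Qed.

Lemma dsA_lin c d (e : DS a q) : dsA (c *: d + e) = c *: dsA d + dsA e.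
Proof.
have [_ _ wd] := dsP d; have [_ _ we] := dsP e.
by rewrite /dsA DS_valE mulop_lin.
Qed.

Lemma DS_of u u' : weak_derivative u u' -> mul_dom sqq u -> mul_dom sqa u ->
  exists d : DS a q, DS_val d = u /\ dsD d = u'.
Proof.
move=> uu' uq ua.
have uP : u \in in_DS a q by apply/asboolP; split => //; exists u'.
by exists (MkDS uP); rewrite dsDE; split => //; exact: weak_derE.
Qed.

(** [t = 1] is the inner product of [DS]; [t = 2] is the hermitian form to be inverted at
    [lambda = 1], where the damping enters with its factor 2. *)
Definition DSip (t : R) d (e : DS a q) : R[i] :=
  L2_ip (dsD d) (dsD e) + L2_ip (dsQ d) (dsQ e) + t%:C * L2_ip (dsA d) (dsA e) + L2_ip d e.

Lemma DSip1E d (e : DS a q) : DSip 1 d e = DS_ip d e.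
Proof.
have [_ dq da] := dsP d; have [_ eq ea] := dsP e.
rewrite /DS_ip (weight_integral_mulop (smooth_measurable sq) q0 dq eq).
by rewrite (weight_integral_mulop (smooth_measurable sa) a0 da ea) /DSip mul1r !dsDE.
Qed.

Lemma DS_normE d : DS_norm d = ipnorm (DSip 1) d.
Proof. by rewrite /DS_norm /ipnorm DSip1E. Qed.

Lemma conjD4 (t : R) (x y z w : R[i]) :
  (x + y + t%:C * z + w)^*%C = x^*%C + y^*%C + t%:C * z^*%C + w^*%C.
Proof. by apply: complexP; rewrite !(cReJ, cImJ, cReD, cImD, cReZ, cImZ); ring. Qed.

Lemma DSip_is_ip t : 0 <= t -> is_ip (DSip t).
Proof.
move=> t0; have P := @L2_is_ip R; split.
- move=> c u v w; rewrite /DSip dsD_lin dsQ_lin dsA_lin DS_valE.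
  rewrite (ip_lin P c (dsD u)) (ip_lin P c (dsQ u)) (ip_lin P c (dsA u)).
  rewrite (ip_lin P c (DS_val u)).
  move: (L2_ip (dsD u) _) (L2_ip (dsD v) _) (L2_ip (dsQ u) _) (L2_ip (dsQ v) _) => x1 x2 x3 x4.
  move: (L2_ip (dsA u) _) (L2_ip (dsA v) _) (L2_ip u _) (L2_ip v _) => x5 x6 x7 x8.
  ring.
- move=> u v; rewrite /DSip conjD4 (ipC P (dsD u)) (ipC P (dsQ u)) (ipC P (dsA u)).
  by rewrite (ipC P (DS_val u)).
- move=> u; rewrite /DSip !cReD cReZ !addr_ge0 ?mulr_ge0 ?(ip_ge0 P)//.
Qed.

Lemma sqrt_sum4 (t x y z w : R) : 1 <= t -> 0 <= x -> 0 <= y -> 0 <= z -> 0 <= w ->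
  let S := x + y + t * z + w in [/\ Num.sqrt x <= Num.sqrt S, Num.sqrt y <= Num.sqrt S,
    Num.sqrt z <= Num.sqrt S & Num.sqrt w <= Num.sqrt S].
Proof.
move=> t1 x0 y0 z0 w0 S; have tz : z <= t * z by rewrite ler_peMl.
by split; apply: ler_wsqrtr; rewrite /S; lra.
Qed.

Lemma DSnorm_ge (t : R) d : 1 <= t ->
  [/\ L2_norm (dsD d) <= ipnorm (DSip t) d, L2_norm (dsQ d) <= ipnorm (DSip t) d,
      L2_norm (dsA d) <= ipnorm (DSip t) d & L2_norm d <= ipnorm (DSip t) d].
Proof.
move=> t1; have t0 : 0 <= t := le_trans ler01 t1; have P := @L2_is_ip R.
have E : complex.Re (DSip t d d) = complex.Re (L2_ip (dsD d) (dsD d)) +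
    complex.Re (L2_ip (dsQ d) (dsQ d)) + t * complex.Re (L2_ip (dsA d) (dsA d)) +
    complex.Re (L2_ip d d) by rewrite /DSip !cReD cReZ.
rewrite /L2_norm /ipnorm E.
exact: (sqrt_sum4 t1 (ip_ge0 P _) (ip_ge0 P _) (ip_ge0 P _) (ip_ge0 P _)).
Qed.

Lemma DSnorm_le (t : R) d : 0 <= t ->
  ipnorm (DSip t) d ^+ 2 = L2_norm (dsD d) ^+ 2 + L2_norm (dsQ d) ^+ 2 +
    t * L2_norm (dsA d) ^+ 2 + L2_norm d ^+ 2.
Proof.
move=> t0; have P := @L2_is_ip R.
by rewrite (sqr_ipnorm (DSip_is_ip t0)) !(sqr_ipnorm P) /DSip !cReD cReZ.
Qed.

Lemma dsB (F : DS a q -> L2 R) : (forall c d e, F (c *: d + e) = c *: F d + F e) ->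
  forall d e, F (d - e) = F d - F e.
Proof. by move=> FL d e; rewrite addrC -scaleN1r FL scaleN1r addrC. Qed.

(** The four components converge in [L2]; closedness of weak derivation and of multiplication shows
    that their limits belong to one element of [DS]. *)
Lemma DS_complete t : 1 <= t -> cauchy_complete (ipnorm (DSip t)).
Proof.
move=> t1 u Hu; have t0 : 0 <= t := le_trans ler01 t1.
have lim (F : DS a q -> L2 R) : (forall d e, F (d - e) = F d - F e) ->
    (forall d, L2_norm (F d) <= ipnorm (DSip t) d) ->
    exists l, forall e, 0 < e -> exists N, forall i, (N <= i)%N -> L2_norm (F (u i) - l) < e.
  move=> FB Fn; apply: L2_complete => e e0; have [N HN] := Hu e e0; exists N => i j Ni Nj.
  by rewrite -FB; apply: le_lt_trans (Fn _) (HN i j Ni Nj).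
have [lD HD] := lim dsD (dsB dsD_lin) (fun d => let: And4 h _ _ _ := DSnorm_ge d t1 in h).
have [lQ HQ] := lim dsQ (dsB dsQ_lin) (fun d => let: And4 _ h _ _ := DSnorm_ge d t1 in h).
have [lA HA] := lim dsA (dsB dsA_lin) (fun d => let: And4 _ _ h _ := DSnorm_ge d t1 in h).
have [l Hl] := lim (@DS_val _ _ _) (fun d e => erefl) (fun d => let: And4 _ _ _ h := DSnorm_ge d t1 in h).
have two (F : DS a q -> L2 R) (k : L2 R) :
    (forall e, 0 < e -> exists N, forall i, (N <= i)%N -> L2_norm (F (u i) - k) < e) ->
    forall e, 0 < e -> exists i, L2_norm (DS_val (u i) - l) < e /\ L2_norm (F (u i) - k) < e.
  move=> Hk e e0; have [N1 H1] := Hk e e0; have [N2 H2] := Hl e e0.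
  by exists (maxn N1 N2); split; [apply: H2; exact: leq_maxr|apply: H1; exact: leq_maxl].
have wl : weak_derivative l lD.
  apply: weak_derivative_closed => e e0; have [i [h1 h2]] := two _ _ HD e e0.
  by exists (u i), (dsD (u i)); have [? _ _] := dsP (u i).
have ql : {ae mu, forall x, repr lQ x = (sqq x)%:C * repr l x}.
  apply: (mulop_closed (continuous_sqrt sq)) => e e0; have [i [h1 h2]] := two _ _ HQ e e0.
  by exists (u i); have [_ ? _] := dsP (u i).
have al : {ae mu, forall x, repr lA x = (sqa x)%:C * repr l x}.
  apply: (mulop_closed (continuous_sqrt sa)) => e e0; have [i [h1 h2]] := two _ _ HA e e0.
  by exists (u i); have [_ _ ?] := dsP (u i).
have [d [dl dD]] := DS_of wl (ex_intro _ lQ ql) (ex_intro _ lA al).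
have dQ : dsQ d = lQ by rewrite /dsQ dl; exact: mulop_unique.
have dA : dsA d = lA by rewrite /dsA dl; exact: mulop_unique.
exists d => e e0.
(* [3 + t] is the sum of the weights 1, 1, [t], 1 of the four components. *)
have c0 : 0 < 3 + t by rewrite ltr_wpDr.
have e20 : 0 < e ^+ 2 / (3 + t) by rewrite divr_gt0// exprn_gt0.
have s0 : 0 < Num.sqrt (e ^+ 2 / (3 + t)) by rewrite sqrtr_gt0.
have [N1 H1] := HD _ s0; have [N2 H2] := HQ _ s0; have [N3 H3] := HA _ s0; have [N4 H4] := Hl _ s0.
exists (maxn (maxn N1 N2) (maxn N3 N4)) => i.
rewrite !geq_max => /andP[/andP[/H1 h1 /H2 h2] /andP[/H3 h3 /H4 h4]].
have sq_lt (x : R) : 0 <= x -> x < Num.sqrt (e ^+ 2 / (3 + t)) -> x ^+ 2 < e ^+ 2 / (3 + t).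
  by move=> x0 h; rewrite -[X in _ < X]sqr_sqrtr ?(ltW e20)// ltr_sqr// nnegrE// ltW.
rewrite -ltr_sqr ?nnegrE ?sqrtr_ge0 ?(ltW e0)// DSnorm_le//.
rewrite (dsB dsD_lin) (dsB dsQ_lin) (dsB dsA_lin) dD dQ dA.
have k1 := sq_lt _ (sqrtr_ge0 _) h1; have k2 := sq_lt _ (sqrtr_ge0 _) h2.
have k3 := sq_lt _ (sqrtr_ge0 _) h3; have k4 := sq_lt _ (sqrtr_ge0 _) h4.
have k5 := ler_wpM2l t0 (ltW k3).
rewrite (_ : DS_val (u i - d) = DS_val (u i) - l); last by rewrite -dl.
have E : e ^+ 2 = e ^+ 2 / (3 + t) + e ^+ 2 / (3 + t) + t * (e ^+ 2 / (3 + t)) + e ^+ 2 / (3 + t).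
  by field; rewrite gt_eqF.
rewrite E; apply: ltrD k4; apply: ltr_leD k5; exact: ltrD.
Qed.

Lemma dsD_test phi : dsD (test_DS a q phi) = test_L2 (test_derive phi).
Proof. by rewrite dsDE; apply: weak_derE; rewrite test_DSE//; exact: test_weak_derivative. Qed.

Lemma dsQ_test phi : dsQ (test_DS a q phi) = mulop sqq (test_L2 phi).
Proof. by rewrite /dsQ test_DSE. Qed.

Lemma dsA_test phi : dsA (test_DS a q phi) = mulop sqa (test_L2 phi).
Proof. by rewrite /dsA test_DSE. Qed.

Lemma test_DS_lin c (f g : test R) : test_DS a q (c *: f + g) = c *: test_DS a q f + test_DS a q g.
Proof. by apply: DS_val_inj; rewrite DS_valE !test_DSE// test_L2_lin. Qed.

Lemma bounded_mul_dom (m : R -> R) (C : R) : smooth m -> (forall x, `|m x| <= C) ->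
  forall u, mul_dom m u.
Proof. by move=> sm mC u; apply: mul_dom_bounded mC; exact: smooth_measurable. Qed.

(** Source of the test elements [m w] of the energy identities. *)
Lemma DS_mul (m : R -> R) (C C' : R) d : smooth m -> (forall x, `|m x| <= C) ->
  (forall x, `|m^`()%classic x| <= C') ->
  exists e : DS a q, [/\ DS_val e = mulop m d, dsD e = mulop m^`()%classic d + mulop m (dsD d),
    dsQ e = mulop m (dsQ d) & dsA e = mulop m (dsA d)].
Proof.
move=> sm mC mC'; have dm := bounded_mul_dom sm mC; have dm' := bounded_mul_dom (smooth_derive sm) mC'.
have [wd qd ad] := dsP d.
have sw (n : R -> R) u : mul_dom n u -> mul_dom n (mulop m u) /\ mulop n (mulop m u) = mulop m (mulop n u).
  move=> du; have h := mul_dom_swap du (dm _) (dm u); split => //.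
  rewrite (mulop_comp (dm u) h) (mulop_comp du (dm _)).
  by congr (mulop _ u); apply/funext => x; rewrite mulrC.
have [e [ed eD]] := DS_of (weak_derivative_mul sm wd (dm _) (dm' _) (dm _)) (sw _ _ qd).1 (sw _ _ ad).1.
exists e; split => //; first by rewrite /dsQ ed (sw _ _ qd).2.
by rewrite /dsA ed (sw _ _ ad).2.
Qed.

End DS_space.

(** * Compactly supported elements of L2 and Poincare's inequality *)

Section compactly_supported_L2.
Context {R : realType}.
Local Notation mu := (@lebesgue_measure R).
Implicit Types (u v w k : L2 R) (phi : test R).
Local Opaque smooth.

Lemma L2_ipE u v : L2_ip u v = cintegral (fun x => repr u x * (repr v x)^*%C).
Proof. by []. Qed.

Local Opaque L2_ip.

Lemma complex_is_test (f : R -> R[i]) (M : R) : smooth (fun x => complex.Re (f x)) ->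
  smooth (fun x => complex.Im (f x)) -> (forall x, M <= `|x| -> f x = 0) -> f \in is_test.
Proof.
move=> sr si f0; apply/asboolP; split; [exact: sr|exact: si|].
apply: (@subclosed_compact _ _ `[- M, M]); [exact: closed_closure|exact: segment_compact|].
rewrite [X in _ `<=` X](closure_id _).1; last exact: interval_closed.
apply: closure_subset => x /= gx; rewrite in_itv /= -ler_norml leNgt.
by apply/negP => /ltW/f0 E; move: gx; rewrite E eqxx.
Qed.

Lemma L2_ip_disjoint u v : {ae mu, forall x, repr u x = 0 \/ repr v x = 0} -> L2_ip u v = 0.
Proof.
move=> uv; rewrite -[RHS](ip0l (@L2_is_ip R) v).
rewrite !L2_ipE.
have H u' v' := cintegrable_measurable (cintegrableM (sqintP (repr u')) (L2fun_conj (sqintP (repr v')))).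
have [? ?] := H u v; have [? ?] := H 0 v.
apply: eq_cintegral => //; apply: ae_imply2 uv repr_L2_0 => x [->|->] ->; first by [].
by rewrite conjc0 !mulr0.
Qed.

Lemma L2_norm_itv (a b : R) : a <= b -> L2_norm (L2_of (itv_L2fun a b)) ^+ 2 = b - a.
Proof.
move=> ab; rewrite (sqr_ipnorm (@L2_is_ip R)) L2_ip_itv /=.
rewrite (_ : Rintegral _ _ _ = \int[mu]_(x in `[a, b]) 1).
  rewrite Rintegral_cst// mul1r; have := lebesgue_measure_itv (Interval (BLeft a) (BRight b)).
  move=> /= ->; case: ifPn => h /=; first by [].
  by apply/eqP; rewrite eq_sym subr_eq0 eq_le ab andbT leNgt -lte_fin.
have /andP[vr vi] := sqintP (repr (L2_of (itv_L2fun a b))); have /Lfun2P[mr _] := vr.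
rewrite /Rintegral; congr fine; apply: ae_eq_integral => //.
- by apply/measurable_EFinP; exact: measurable_funS mr.
- apply: ae_imply (repr_L2_of (itv_L2fun a b)) => x -> xab /=.
  by rewrite indicE mem_set.
Qed.

(** The factor 2 comes from bounding real and imaginary parts separately by [B]. *)
Lemma L2_norm_bound u (a b B : R) : a <= b ->
  {ae mu, forall x, cabs (repr u x) <= B * \1_(`[a, b]) x} ->
  L2_norm u ^+ 2 <= 2 * (B ^+ 2 * (b - a)).
Proof.
move=> ab uB; have /andP[ur ui] := sqintP (repr u).
have key (f : R -> R) : f \in Lfun mu 2%:E ->
    {ae mu, forall x, `|f x| <= B * \1_(`[a, b]) x} -> \int[mu]_x (f x ^+ 2) <= B ^+ 2 * (b - a).
  move=> fL fB; have /Lfun2P[mf _] := fL; rewrite -lee_fin -Lfun2_Rintegral//.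
  have := L2_norm_itv ab; rewrite sqr_L2_norm => E.
  apply: (@le_trans _ _ (\int[mu]_x ((B ^+ 2)%:E * (\1_(`[a, b]) x)%:E))%E).
    apply: ae_ge0_le_integral => //.
    - by move=> x _; rewrite lee_fin sqr_ge0.
    - exact/measurable_EFinP/measurable_funX.
    - by move=> x _; rewrite -EFinM lee_fin mulr_ge0// sqr_ge0.
    - by apply/measurable_EFinP/measurable_funM => //; exact: measurable_indic.
    - apply: ae_imply fB => x h _; rewrite -EFinM lee_fin.
      have i2 : \1_(`[a, b]) x = \1_(`[a, b]) x ^+ 2 :> R.
        by rewrite indicE; case: (_ \in _); rewrite ?expr1n ?expr0n.
      rewrite i2 -exprMn -real_normK ?num_real// lerXn2r// nnegrE//.
      exact: le_trans (normr_ge0 _) h.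
  rewrite ge0_integralZl//.
  - rewrite integral_indic// setIT (EFinM (B ^+ 2) (b - a)) lee_wpmul2l// ?lee_fin ?sqr_ge0//.
    have := lebesgue_measure_itv (Interval (BLeft a) (BRight b)) => /= ->.
    by case: ifPn => h /=; rewrite ?lee_fin ?subr_ge0// EFinB.
  - exact/measurable_EFinP/measurable_indic.
  - by rewrite lee_fin sqr_ge0.
rewrite sqr_L2_norm mulrDl mul1r; apply: lerD.
  by apply: key => //; apply: ae_imply uB => x; apply: le_trans; exact: le_Re_cabs.
by apply: key => //; apply: ae_imply uB => x; apply: le_trans; exact: le_Im_cabs.
Qed.

Lemma test_ip_itv phi (a b : R) :
  L2_ip (test_L2 phi) (L2_of (itv_L2fun a b)) =
  (\int[mu]_(x in `[a, b]) complex.Re (phi x)) +i*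
  (\int[mu]_(x in `[a, b]) complex.Im (phi x)).
Proof.
rewrite L2_ip_itv; have [sr si _] := test_smooth phi.
have /andP[ur ui] := sqintP (repr (test_L2 phi)).
have /Lfun2P[mr _] := ur; have /Lfun2P[mi _] := ui.
congr (_ +i* _); rewrite /Rintegral; congr fine; apply: ae_eq_integral => //.
- by apply/measurable_EFinP; exact: measurable_funS mr.
- by apply/measurable_EFinP; apply: measurable_funS (smooth_measurable sr).
- by apply: ae_imply (repr_test_L2 phi) => x ->.
- by apply/measurable_EFinP; exact: measurable_funS mi.
- by apply/measurable_EFinP; apply: measurable_funS (smooth_measurable si).
- by apply: ae_imply (repr_test_L2 phi) => x ->.
Qed.

(** The last clause writes the primitive as an inner product with an indicator: Cauchy-Schwarz then
    bounds it pointwise by the norm of [phi], and [F M] is the total integral. *)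
Lemma test_primitive phi (M : R) : (forall x, M <= `|x| -> phi x = 0) -> 0 < M ->
  exists F : R -> R[i], [/\ smooth (fun x => complex.Re (F x)),
    smooth (fun x => complex.Im (F x)), forall x, cderive F x = phi x &
    [/\ forall x, x <= - M -> F x = 0, forall x, M <= x -> F x = F M &
    forall x, F x = L2_ip (test_L2 phi) (L2_of (itv_L2fun (- M - 1) x))]].
Proof.
move=> phi0 M0; have [sr si _] := test_smooth phi.
have z x : x <= - M -> phi x = 0.
  by move=> xM; apply: phi0; rewrite ler0_norm; lra.
have [|Fr [sFr dFr zFr iFr]] := @smooth_primitive _ _ (- M) sr; first by move=> x /z ->.
have [|Fi [sFi dFi zFi iFi]] := @smooth_primitive _ _ (- M) si; first by move=> x /z ->.
exists (fun x => Fr x +i* Fi x); split; [exact: sFr|exact: sFi| |].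
  by move=> x; rewrite /cderive /= dFr dFi; case: (phi x).
split.
- by move=> x xM; rewrite zFr// zFi.
- move=> x xM; congr (_ +i* _); symmetry.
    apply: (@smooth_const _ _ M x sFr) => // y /andP[My _].
    by rewrite dFr phi0// (le_trans (ltW My))// ler_norm.
  apply: (@smooth_const _ _ M x sFi) => // y /andP[My _].
  by rewrite dFi phi0// (le_trans (ltW My))// ler_norm.
- by move=> x; rewrite test_ip_itv iFr iFi.
Qed.

Definition supp_in (L : R) u := {ae mu, forall x, L <= `|x| -> repr u x = 0}.

Lemma supp_mulop (L : R) (m : R -> R) u : supp_in L u -> (forall x, `|x| <= L -> m x = 1) ->
  mulop m u = u.
Proof.
move=> uL m1; apply: mulop_unique; apply: ae_imply uL => x h.
by have [xL|/ltW/m1 ->] := leP L `|x|; [rewrite h// mulr0|rewrite mul1r].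
Qed.

Lemma cutoff_derive (m : R -> R) (N x : R) : smooth m -> (forall y, `|y| <= N -> m y = 1) ->
  `|x| < N -> m^`()%classic x = 0.
Proof.
move=> sm m1 xN; rewrite derive1E.
have -> : 'D_1 m x = 'D_1 (fun=> 1 : R) x.
  apply: near_eq_derive.
  have cn : continuous (fun y : R => `|y|) by exact: norm_continuous.
  have : \forall y \near x, `|y| < N.
    by have := cn x; move/cvgr_lt; apply.
  by apply: filterS => y /ltW/m1.
by rewrite derive_cst.
Qed.

Lemma derive_outside (m : R -> R) (N x : R) : smooth m -> (forall y, N <= `|y| -> m y = 0) ->
  N < `|x| -> m^`()%classic x = 0.
Proof.
move=> sm m1 xN; rewrite derive1E.
have -> : 'D_1 m x = 'D_1 (fun=> 0 : R) x.
  apply: near_eq_derive.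
  have cn : continuous (fun y : R => `|y|) by exact: norm_continuous.
  have : \forall y \near x, N < `|y|.
    by have := cn x; move/cvgr_gt; apply.
  by apply: filterS => y /ltW/m1.
by rewrite derive_cst.
Qed.

(* Duality: for a test phi, <k, phi> = <k, theta'> = - <k', theta>, where theta is a
   primitive of phi cut off outside the support of k. *)
Lemma poincare (L : R) : 0 < L -> exists2 C : R, 0 < C & forall k k',
  weak_derivative k k' -> supp_in L k -> L2_norm k <= C * L2_norm k'.
Proof.
move=> L0; have L20 : 0 < 2 * L by rewrite mulr_gt0.
have [kap _ Hcut] := @smooth_cutoff R.
have [c2 s2 [c2_01 c2_1 c2_0 _]] := Hcut _ L0.
have [c3 s3 [c3_01 c3_1 c3_0 _]] := Hcut _ L20.
have P := @L2_is_ip R.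
have cb (c : R -> R) : (forall x, 0 <= c x <= 1) -> forall x, `|c x| <= 1.
  by move=> h x; have /andP[? ?] := h x; rewrite ger0_norm.
pose r := 2 * (2 * L); have r0 : 0 <= r by rewrite mulr_ge0// ltW.
(* For [x <= r] the interval [[- 2 L - 1, x]] has length at most [2 L + r + 1], whose root bounds
   the primitive; [r + r] is the length of the interval carrying [th], and 2 the constant of
   [L2_norm_bound]. *)
pose C := Num.sqrt (2 * ((2 * L + r + 1) * (r + r))).
have C0 : 0 <= C := sqrtr_ge0 _.
exists (C + 1) => [|k k' kk' kL]; first by rewrite ltr_wpDl.
have key phi : cabs (L2_ip k (test_L2 phi)) <= C * L2_norm k' * L2_norm (test_L2 phi).
  pose phi2 := test_mul s2 phi.
  have z2 x : 2 * L <= `|x| -> phi2 x = 0 by move=> xL; rewrite /= c2_0// mul0r.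
  have [F [sr si dF [F0 F1 FE]]] := test_primitive z2 L20.
  have th_test : (fun x => (c3 x)%:C * F x) \in is_test.
    apply: (@complex_is_test _ (2 * (2 * L))).
    - rewrite (_ : (fun x => _) = fun x => c3 x * complex.Re (F x)); first exact: (smoothM s3 sr).
      by apply/funext => x; rewrite cReZ.
    - rewrite (_ : (fun x => _) = fun x => c3 x * complex.Im (F x)); first exact: (smoothM s3 si).
      by apply/funext => x; rewrite cImZ.
    - by move=> x /c3_0 ->; rewrite mul0r.
  pose th := Test th_test.
  have phi2E : test_L2 phi2 = mulop c2 (test_L2 phi) by rewrite (mulop_test _ s2).
  have E1 : L2_ip k (test_L2 phi) = L2_ip k (test_L2 phi2).
    have dm := mul_dom_bounded k (smooth_measurable s2) (cb _ c2_01).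
    rewrite phi2E -(mulop_ipC dm); last exact: mul_dom_test (smooth_continuous s2).
    by rewrite (supp_mulop kL c2_1).
  have dth x : `|x| < 2 * L -> cderive th x = phi2 x.
    move=> xL; rewrite -dF /cderive /=; congr (_ +i* _).
      rewrite (_ : (fun y => _) = fun y => c3 y * complex.Re (F y)); last first.
        by apply/funext => y; rewrite cReZ.
      rewrite (derive1_is (is_deriveM (smooth_is_derive x s3) (smooth_is_derive x sr))).
      by rewrite (cutoff_derive s3 c3_1 xL) c3_1 ?(ltW xL)// scaler0 addr0 scale1r.
    rewrite (_ : (fun y => _) = fun y => c3 y * complex.Im (F y)); last first.
      by apply/funext => y; rewrite cImZ.
    rewrite (derive1_is (is_deriveM (smooth_is_derive x s3) (smooth_is_derive x si))).
    by rewrite (cutoff_derive s3 c3_1 xL) c3_1 ?(ltW xL)// scaler0 addr0 scale1r.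
  (* The two tests agree for [|x| < 2 L], and [k] vanishes for [|x| >= L]. *)
  have E2 : L2_ip k (test_L2 (test_derive th)) = L2_ip k (test_L2 phi2).
    apply/eqP; rewrite -subr_eq0 -(ipBr P); apply/eqP; apply: L2_ip_disjoint.
    apply: ae_imply4 kL (repr_L2B (test_L2 (test_derive th)) (test_L2 phi2))
      (repr_test_L2 (test_derive th)) (repr_test_L2 phi2) => x hk -> -> ->.
    have [xL|xL] := leP L `|x|; first by left; exact: hk.
    right; rewrite /= -/(cderive th x) (dth x) ?subrr//.
    by apply: lt_trans xL _; rewrite ltr_pMl// ltr1n.
  have /weak_derivativeP/(_ th) := kk'; rewrite E2 -E1 => ->; rewrite cabsN.
  apply: le_trans (cauchy_schwarz P _ _) _; rewrite [C * _]mulrC -mulrA.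
  apply: ler_wpM2l; first exact: ipnorm_ge0.
  have n2 : L2_norm (test_L2 phi2) <= L2_norm (test_L2 phi).
    rewrite phi2E; have := mulop_norm_le (test_L2 phi) (smooth_measurable s2) (cb _ c2_01).
    by rewrite mul1r.
  pose B := L2_norm (test_L2 phi) * Num.sqrt (2 * L + r + 1).
  have B0 : 0 <= B by rewrite mulr_ge0 ?sqrtr_ge0.
  have thB x : cabs (th x) <= B * \1_(`[- r, r]) x.
    rewrite /= cabsM cabs_real; have [xr|xr] := leP `|x| r; last first.
      by rewrite (c3_0 _ (ltW xr)) normr0 mul0r mulr_ge0.
    rewrite indicE mem_set ?mulr1; last by rewrite /= in_itv /= -ler_norml.
    apply: le_trans (ler_wpM2r (cabs_ge0 _) (cb _ c3_01 x)) _; rewrite mul1r FE.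
    apply: le_trans (cauchy_schwarz P _ _) _.
    apply: ler_pM => //; try exact: ipnorm_ge0.
    have [lx|xl] := leP (- (2 * L) - 1) x.
      rewrite -[X in X <= _]ger0_norm ?ipnorm_ge0// -sqrtr_sqr ler_wsqrtr//.
      rewrite (L2_norm_itv lx); have := ler_norm x; lra.
    have -> : L2_of (itv_L2fun (- (2 * L) - 1) x) = 0.
      apply: L2_eq; apply: ae_imply2 (repr_L2_of (itv_L2fun (- (2 * L) - 1) x)) repr_L2_0 => y -> ->.
      rewrite indicE memNset//= in_itv /= => /andP[h1 h2].
      by have := le_lt_trans (le_trans h1 h2) xl; rewrite ltxx.
    by rewrite (ipnorm0 P) sqrtr_ge0.
  rewrite -ler_sqr ?nnegrE ?mulr_ge0 ?ipnorm_ge0//.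
  have rr : - r <= r by lra.
  apply: le_trans (@L2_norm_bound (test_L2 th) (- r) r B rr _) _.
    by apply: ae_imply (repr_test_L2 th) => x ->.
  have rr2 : 0 <= 2 * ((2 * L + r + 1) * (r + r)) by rewrite mulr_ge0// mulr_ge0; lra.
  have s0 : 0 <= 2 * L + r + 1 by rewrite !addr_ge0 ?(ltW L20).
  rewrite /B /C !exprMn (sqr_sqrtr rr2) (sqr_sqrtr s0).
  rewrite opprK; move: (L2_norm (test_L2 phi) ^+ 2) => X.
  rewrite le_eqVlt; apply/orP; left; apply/eqP; ring.
have n0 : 0 <= L2_norm k' := ipnorm_ge0 _ _.
have [k0|k0] := leP (L2_norm k) 0; first by rewrite (le_trans k0)// mulr_ge0// addr_ge0.
apply: (@le_trans _ _ (C * L2_norm k')); last by rewrite ler_wpM2r// lerDl.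
apply/ler_addgt0Pl => e e0.
pose D := L2_norm k + C * L2_norm k' + 1.
have D0 : 0 < D by rewrite ltr_wpDl// addr_ge0 ?(ltW k0) ?mulr_ge0.
have CK : 0 <= C * L2_norm k' by rewrite mulr_ge0.
have ed0 : 0 < e * L2_norm k / D by rewrite divr_gt0// mulr_gt0.
(* The duality estimate is applied to a test close to [k] itself. The precision is proportional to
   [L2_norm k], so that this factor cancels at the end. *)
have [phi Hphi] := tests_dense_L2 k ed0.
have h1 : L2_norm k ^+ 2 <= L2_norm k * (e * L2_norm k / D) + C * L2_norm k' * (L2_norm k + e * L2_norm k / D).
  rewrite (sqr_ipnorm P).
  have -> : complex.Re (L2_ip k k) = - complex.Re (L2_ip k (test_L2 phi - k)) + complex.Re (L2_ip k (test_L2 phi)).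
    by rewrite (ipBr P) cReD cReN opprB subrK.
  apply: lerD.
    rewrite -cReN -(ipNr P); apply: le_trans (ler_norm _) _.
    apply: le_trans (Re_ip_le P _ _) _; rewrite (ipnormN P); apply: ler_wpM2l (ltW Hphi).
    exact: ipnorm_ge0.
  apply: le_trans (ler_norm _) _; apply: le_trans (le_Re_cabs _) _; apply: le_trans (key phi) _.
  apply: ler_wpM2l => //.
  have -> : test_L2 phi = k + (test_L2 phi - k) by rewrite addrC subrK.
  apply: le_trans (ipnormD P _ _) _; rewrite lerD2l; exact: ltW.
have h2 : L2_norm k * L2_norm k <= L2_norm k * (e + C * L2_norm k').
  rewrite -expr2; apply: le_trans h1 _.
  rewrite (_ : _ + _ = L2_norm k * (e * ((L2_norm k + C * L2_norm k') / D) + C * L2_norm k')); last first.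
    move: (L2_norm k) (L2_norm k') D0 => x y D0; field; rewrite gt_eqF//.
  rewrite ler_wpM2l ?(ltW k0)// lerD2r ler_piMr ?(ltW e0)// ler_pdivrMr// mul1r lerDl//.
by move: h2; rewrite ler_pM2l.
Qed.

End compactly_supported_L2.

(** * Density of test functions in DS *)

Section density_in_DS.
Context {R : realType}.
Local Notation mu := (@lebesgue_measure R).
Implicit Types (u v w k : L2 R) (phi : test R).
Local Opaque L2_ip smooth.
Let P := @L2_is_ip R.

Lemma bounded01 (c : R -> R) : (forall x, 0 <= c x <= 1) -> forall x, `|c x| <= 1.
Proof. by move=> h x; have /andP[? ?] := h x; rewrite ger0_norm. Qed.

(* A test close to u' in L2 is corrected by a multiple of a bump so that its integral
   vanishes, which makes its primitive compactly supported. *)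
Lemma approx_weak_derivative (L : R) u u' : 0 < L -> weak_derivative u u' -> supp_in L u ->
  supp_in L u' -> forall e, 0 < e -> exists psi : test R,
    (forall x, 2 * L <= `|x| -> psi x = 0) /\ L2_norm (test_L2 (test_derive psi) - u') < e.
Proof.
move=> L0 uu' uL uL' e e0; have L20 : 0 < 2 * L by rewrite mulr_gt0.
have [kap _ Hcut] := @smooth_cutoff R.
have [c1 s1 [c1_01 c1_1 c1_0 _]] := Hcut _ L0.
have [c2 s2 [c2_01 c2_1 c2_0 _]] := Hcut _ L20.
pose t1 := Test (real_is_test s1 c1_0); pose t2 := Test (real_is_test s2 c2_0).
pose be := test_mul s1 t1.
(* For [g] supported in [|x| <= 2 L], where [t2 = 1], this is the integral of [g]. *)
pose I g := L2_ip (test_L2 g) (test_L2 t2).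
have c12 x : c1 x * c2 x = c1 x.
  have [xL|xL] := leP `|x| (2 * L); first by rewrite c2_1// mulr1.
  by rewrite c1_0 ?mul0r// ltW.
have dm1 v := mul_dom_bounded v (smooth_measurable s1) (bounded01 c1_01).
have Ibe : I be = (L2_norm (test_L2 t1) ^+ 2)%:C.
  rewrite /I -(mulop_test t1 s1) (mulop_ipC (dm1 _) (dm1 _)) (mulop_test t2 s1) -(ip_self P).
  congr L2_ip; apply: L2_eq.
  apply: ae_imply2 (repr_test_L2 (test_mul s1 t2)) (repr_test_L2 t1) => x -> -> /=.
  by rewrite -rmorphM c12.
have t1n : 0 < L2_norm (test_L2 t1).
  rewrite lt_neqAle ipnorm_ge0 andbT eq_sym; apply/eqP => /L2_norm_eq0 t10.
  have := test_ip_itv t1 0 L; rewrite t10 (ip0l P) => -[+ _].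
  rewrite (@eq_Rintegral _ _ _ mu _ (fun=> 1)); last first.
    move=> x; rewrite inE /= in_itv /= => /andP[x0 xL].
    by rewrite c1_1// ger0_norm.
  rewrite Rintegral_cst// mul1r; have := lebesgue_measure_itv (Interval (BLeft 0) (BRight L)).
  by move=> /= ->; rewrite lte_fin L0 /= oppr0 addr0 => h; move: L0; rewrite -h ltxx.
have Ibe0 : I be != 0.
  rewrite Ibe; apply/eqP => -[h]; have := exprn_gt0 2 t1n; rewrite h ltxx//.
(* [u'] has mean zero, since the derivative of [t2] vanishes on the support of [u]. *)
have u't2 : L2_ip u' (test_L2 t2) = 0.
  have /weak_derivativeP/(_ t2) h := uu'.
  apply: oppr_inj; rewrite oppr0 -h; apply: L2_ip_disjoint.
  apply: ae_imply2 uL (repr_test_L2 (test_derive t2)) => x hu ->.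
  have [xL|xL] := leP L `|x|; [by left; exact: hu|right].
  have d0 : c2^`()%classic x = 0.
    by apply: (cutoff_derive s2 c2_1); apply: lt_trans xL _; rewrite ltr_pMl// ltr1n.
  rewrite /= /cderive /=; apply: complexP => /=; first exact: d0.
  by rewrite derive1_cst.
have Ige (g : test R) : cabs (I g) <= L2_norm (test_L2 g - u') * L2_norm (test_L2 t2).
  have -> : I g = L2_ip (test_L2 g - u') (test_L2 t2) by rewrite (ipBl P) u't2 subr0.
  exact: cauchy_schwarz.
(* The 1 accounts for the approximation of [u'], the other term for the correction of the mean by a
   multiple of [be]. *)
pose D := 1 + L2_norm (test_L2 t2) * cabs (I be)^-1 * L2_norm (test_L2 be).
have D0 : 0 < D by rewrite ltr_pwDl// !mulr_ge0 ?cabs_ge0 ?ipnorm_ge0.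
have [phi Hphi] := tests_dense_L2 u' (divr_gt0 e0 D0).
pose g := test_mul s1 phi.
have gu : L2_norm (test_L2 g - u') < e / D.
  rewrite -(mulop_test phi s1).
  have {1}-> : u' = mulop c1 u' by rewrite (supp_mulop uL' c1_1).
  have -> : mulop c1 (test_L2 phi) - mulop c1 u' = mulop c1 (test_L2 phi - u').
    have -> : test_L2 phi - u' = (-1) *: u' + test_L2 phi by rewrite scaleN1r addrC.
    by rewrite mulop_lin// scaleN1r addrC.
  apply: le_lt_trans (mulop_norm_le _ (smooth_measurable s1) (bounded01 c1_01)) _.
  by rewrite mul1r.
pose kp := I g / I be.
pose h := (- kp) *: be + g : test R.
have Ih : I h = 0.
  by rewrite /I /h test_L2_lin (ip_lin P) -/(I be) -/(I g) /kp mulNr divfK// addNr.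
have h0 x : 2 * L <= `|x| -> h x = 0.
  move=> xL; rewrite /h.
  have -> : ((- kp) *: be + g) x = - kp * be x + g x by [].
  by rewrite /be /g /= (c1_0 _ xL) !mul0r mulr0 addr0.
have [F [sr si dF [F0 F1 FE]]] := test_primitive h0 L20.
have FM : F (2 * L) = 0.
  rewrite FE -Ih /I; apply/eqP; rewrite -subr_eq0 -(ipBr P); apply/eqP.
  apply: L2_ip_disjoint.
  set E := L2_of _; apply: ae_imply4 (repr_test_L2 h) (repr_L2B E (test_L2 t2))
    (repr_L2_of (itv_L2fun (- (2 * L) - 1) (2 * L)))
    (repr_test_L2 t2) => x -> -> -> ->.
  have [xL|xL] := leP (2 * L) `|x|; [by left; exact: h0|right].
  rewrite /= c2_1 ?(ltW xL)// indicE mem_set ?subrr//= in_itv /=.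
  move: xL; rewrite ltr_norml => /andP[h1 h2]; rewrite (ltW h2) andbT.
  by apply: le_trans (ltW h1); rewrite gerBl.
have Fz x : 2 * L <= `|x| -> F x = 0.
  have [x0|x0] := leP 0 x; first by rewrite (ger0_norm x0) => /F1 ->.
  by rewrite (ltr0_norm x0) lerNr => /F0.
pose psi := Test (complex_is_test sr si Fz).
exists psi; split; first exact: Fz.
have -> : test_L2 (test_derive psi) = test_L2 h.
  apply: L2_eq; apply: ae_imply2 (repr_test_L2 (test_derive psi)) (repr_test_L2 h) => x -> ->.
  exact: dF.
have -> : test_L2 h - u' = (- kp) *: test_L2 be + (test_L2 g - u').
  by rewrite /h test_L2_lin addrA.
apply: le_lt_trans (ipnormD P _ _) _; rewrite (ipnormZ P) cabsN.
have k1 : cabs kp * L2_norm (test_L2 be) <=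
    L2_norm (test_L2 g - u') * (L2_norm (test_L2 t2) * cabs (I be)^-1 * L2_norm (test_L2 be)).
  rewrite /kp cabsM !mulrA; apply: ler_wpM2r; first exact: ipnorm_ge0.
  by apply: ler_wpM2r; [exact: cabs_ge0|exact: Ige].
apply: (@le_lt_trans _ _ (L2_norm (test_L2 g - u') * D)).
  by rewrite /D mulrDr mulr1 addrC; apply: lerD => //.
by rewrite -ltr_pdivlMr.
Qed.

Variables a q : R -> R.
Hypotheses (sa : smooth a) (sq : smooth q).

(** On a fixed ball, Poincare's inequality and the local boundedness of [a] and [q] bound the whole
    norm of [DS] by that of the derivative, which [approx_weak_derivative] makes small. *)
Lemma tests_dense_DS_supp (L : R) (d : DS a q) : 0 < L -> supp_in L d -> supp_in L (dsD d) ->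
  forall e, 0 < e -> exists psi, ipnorm (DSip 1) (test_DS a q psi - d) < e.
Proof.
move=> L0 dL dL' e e0; have L20 : 0 < 2 * L by rewrite mulr_gt0.
have [wd qd ad] := dsP d.
have [C C0 HC] := poincare L20.
have [kap _ Hcut] := @smooth_cutoff R.
have [c s [c_01 c_1 c_0 _]] := Hcut _ L20.
have bnd (m : R -> R) : smooth m -> exists2 B : R, 0 < B & forall k, supp_in (2 * L) k ->
    mul_dom (fun x => Num.sqrt (m x)) k -> L2_norm (mulop (fun x => Num.sqrt (m x)) k) <= B * L2_norm k.
  move=> sm; have cm := continuous_sqrt sm.
  have ccm : continuous (fun x => c x * Num.sqrt (m x)).
    have cc : continuous c := smooth_continuous s.
    have h : continuous (c \* (fun x => Num.sqrt (m x))).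
      by move=> x; apply: continuousM; [exact: cc|exact: cm].
    exact: h.
  have [B B0 HB] : exists2 B : R, 0 < B & forall x, `|c x * Num.sqrt (m x)| <= B.
    apply: (@continuous_bounded_outside _ _ (2 * (2 * L)) 0 ccm) => x /c_0 ->.
    by rewrite mul0r normr0.
  exists B => // k kL dk.
  have -> : mulop (fun x => Num.sqrt (m x)) k = mulop (fun x => c x * Num.sqrt (m x)) k.
    symmetry; apply: mulop_unique; apply: ae_imply2 (mulopP dk) kL => x -> h.
    have [xL|xL] := leP (2 * L) `|x|; first by rewrite h// !mulr0.
    by rewrite c_1 ?mul1r// ltW.
  exact: mulop_norm_le (continuous_measurable_fun ccm) HB.
have [Bq Bq0 HBq] := bnd _ sq; have [Ba Ba0 HBa] := bnd _ sa.
pose D := 1 + (Bq * C) ^+ 2 + (Ba * C) ^+ 2 + C ^+ 2.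
have D1 : 1 <= D by rewrite /D -!addrA lerDl !addr_ge0 ?sqr_ge0.
have D0 : 0 < D := lt_le_trans ltr01 D1.
have [psi [psi0 Hpsi]] := approx_weak_derivative L0 wd dL dL' (divr_gt0 e0 D0).
exists psi; set k := test_DS a q psi - d.
have k' : dsD k = test_L2 (test_derive psi) - dsD d.
  by rewrite /k (dsB (@dsD_lin _ _ _)) dsD_test.
have kL : supp_in (2 * L) k.
  have -> : DS_val k = test_L2 psi - DS_val d by rewrite -(test_DSE psi sa sq).
  apply: ae_imply3 (repr_L2B (test_L2 psi) (DS_val d)) (repr_test_L2 psi) dL => x -> -> h xL.
  rewrite psi0// h ?subrr//; apply: le_trans xL; rewrite ler_pMl// ler1n//.
have [wk qk ak] := dsP k.
have h0 := HC _ _ wk kL; have h1 := HBq _ kL qk; have h2 := HBa _ kL ak.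
rewrite -k' in Hpsi; have n0 : 0 <= L2_norm (dsD k) := ipnorm_ge0 _ _.
have n1 : 0 <= L2_norm k := ipnorm_ge0 _ _.
rewrite -ltr_sqr ?nnegrE ?ipnorm_ge0 ?(ltW e0)// DSnorm_le//.
apply: (@le_lt_trans _ _ (D * L2_norm (dsD k) ^+ 2)).
  rewrite /D !mulrDl !mul1r -!exprMn -!mulrA; apply: lerD; last first.
    by rewrite lerXn2r ?nnegrE ?mulr_ge0// ltW.
  apply: lerD; last first.
    rewrite lerXn2r ?nnegrE ?mulr_ge0 ?ipnorm_ge0 ?(ltW C0) ?(ltW Ba0)//.
    by apply: le_trans h2 _; rewrite ler_wpM2l// ltW.
  rewrite lerD2l lerXn2r ?nnegrE ?mulr_ge0 ?ipnorm_ge0 ?(ltW C0) ?(ltW Bq0)//.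
  by apply: le_trans h1 _; rewrite ler_wpM2l// ltW.
rewrite -ltr_pdivlMl//.
apply: (@lt_le_trans _ _ ((e / D) ^+ 2)).
  by rewrite ltr_sqr// nnegrE// divr_ge0// ltW.
rewrite exprMn mulrC; apply: ler_wpM2r; first exact: sqr_ge0.
by rewrite expr2 ler_piMr ?invr_ge0 ?(ltW D0)// invf_le1.
Qed.

Lemma lt_sum4 (y x1 x2 x3 x4 : R) : 0 < y -> x1 <= y / 16 -> x2 <= y / 16 ->
  x3 <= y / 16 -> x4 <= y / 16 -> x1 + x2 + x3 + x4 < y.
Proof. lra. Qed.

(** The tails tend to 0 by dominated convergence; the extra term [c' d] in the derivative is
    [O(1/n)] by the slope of the cut-off. *)
Lemma DS_cutoff (d : DS a q) e : 0 < e -> exists L (d' : DS a q),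
  [/\ 0 < L, supp_in L d', supp_in L (dsD d') & ipnorm (DSip 1) (d' - d) < e].
Proof.
move=> e0; have [kap k0 Hcut] := @smooth_cutoff R.
pose c (n : nat) := projT1 (cid2 (Hcut n.+1%:R (ltr0Sn _ n))).
have cs n : smooth (c n) by rewrite /c; case: cid2.
have [c01 c1 c0 c'] : [/\ forall n x, 0 <= c n x <= 1, forall n x, `|x| <= n.+1%:R -> c n x = 1,
    forall n x, 2 * n.+1%:R <= `|x| -> c n x = 0 & forall n x, `|(c n)^`()%classic x| <= kap / n.+1%:R].
  by split => n; rewrite /c; case: cid2 => /= ? ? [? ? ? ?].
pose m n x := c n x - 1.
have sm n : smooth (m n) by exact: (smoothB (cs n) (@smooth_cst _ 1)).
have m1 n x : `|m n x| <= 1.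
  by rewrite /m; have /andP[? ?] := c01 n x; rewrite ler_norml; lra.
have m0 x : exists N, forall n, (N <= n)%N -> m n x = 0.
  exists (Num.bound `|x|) => n Nn; rewrite /m c1 ?subrr//.
  apply: le_trans (ltW (archi_boundP (normr_ge0 x))) _.
  by rewrite ler_nat (leq_trans Nn).
have e4 : 0 < e / 8 by rewrite divr_gt0.
have tail v := L2_dominated v (fun n => smooth_measurable (sm n)) m1 m0 e4.
have [N1 H1] := tail (dsD d); have [N2 H2] := tail (dsQ d).
have [N3 H3] := tail (dsA d); have [N4 H4] := tail (DS_val d).
have [N5 H5] : exists N, forall n, (N <= n)%N -> kap / n.+1%:R * L2_norm d < e / 8.
  have c0' : 0 < kap * L2_norm d + 1 by rewrite ltr_wpDl// mulr_ge0 ?ipnorm_ge0// ltW.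
  have [N] := ltr_add_invr (divr_gt0 e4 c0'); rewrite add0r => HN; exists N => n Nn.
  have hn : n.+1%:R^-1 < e / 8 / (kap * L2_norm d + 1).
    by apply: le_lt_trans HN; rewrite lef_pV2 ?posrE// ler_nat.
  rewrite mulrAC mulrC; move: hn; rewrite ltr_pdivlMr//; apply: le_lt_trans.
  by rewrite ler_wpM2l ?invr_ge0// lerDl.
pose n := maxn (maxn N1 N2) (maxn (maxn N3 N4) N5).
have [d' [d'v d'D d'Q d'A]] := DS_mul d (cs n) (bounded01 (c01 n)) (c' n).
have dm v := bounded_mul_dom (cs n) (bounded01 (c01 n)) v.
have dm' v := bounded_mul_dom (smooth_derive (cs n)) (c' n) v.
have cB v : mulop (c n) v - v = mulop (m n) v.
  have -> : m n = fun x => c n x + -1 by apply/funext => x.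
  by rewrite mulopDl// ?mulop_cst//; [rewrite rmorphN1 scaleN1r|exact: mul_dom_cst].
exists (2 * n.+1%:R + 1), d'; split.
- by rewrite addr_gt0// mulr_gt0.
- rewrite /supp_in d'v; apply: ae_imply (mulopP (dm d)) => x -> xn.
  by rewrite c0 ?mul0r//; apply: le_trans xn; rewrite lerDl.
- rewrite /supp_in d'D.
  apply: ae_imply3 (repr_L2D (mulop (c n)^`()%classic d) (mulop (c n) (dsD d)))
    (mulopP (dm (dsD d))) (mulopP (dm' d)) => x -> -> -> xn.
  rewrite c0; last by apply: le_trans xn; rewrite lerDl.
  rewrite (derive_outside (cs n) (c0 n)) ?mul0r ?addr0//.
  by apply: lt_le_trans xn; rewrite ltrDl.
have DB : dsD (d' - d) = mulop (c n)^`()%classic d + mulop (m n) (dsD d).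
  by rewrite (dsB (@dsD_lin _ _ _)) d'D -addrA cB.
have QB : dsQ (d' - d) = mulop (m n) (dsQ d) by rewrite (dsB (@dsQ_lin _ _ _)) d'Q cB.
have AB : dsA (d' - d) = mulop (m n) (dsA d) by rewrite (dsB (@dsA_lin _ _ _)) d'A cB.
have vB : DS_val (d' - d) = mulop (m n) d by rewrite -cB -d'v.
have l1 : L2_norm (dsD (d' - d)) < e / 4.
  rewrite DB; apply: le_lt_trans (ipnormD P _ _) _.
  have -> : e / 4 = e / 8 + e / 8 by field.
  apply: ltrD; last by apply: H1; rewrite /n !leq_max leqnn.
  apply: le_lt_trans (mulop_norm_le _ (smooth_measurable (smooth_derive (cs n))) (c' n)) _.
  by apply: H5; rewrite /n !leq_max leqnn !orbT.
have l8 x : x < e / 8 -> x < e / 4 by lra.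
have l2 : L2_norm (dsQ (d' - d)) < e / 4.
  by rewrite QB; apply: l8; apply: H2; rewrite /n !leq_max leqnn !orbT.
have l3 : L2_norm (dsA (d' - d)) < e / 4.
  by rewrite AB; apply: l8; apply: H3; rewrite /n !leq_max leqnn !orbT.
have l4 : L2_norm (DS_val (d' - d)) < e / 4.
  by rewrite vB; apply: l8; apply: H4; rewrite /n !leq_max leqnn !orbT.
have sq_lt (x : R) : 0 <= x -> x < e / 4 -> x ^+ 2 <= e ^+ 2 / 16.
  move=> x0 xe; have -> : e ^+ 2 / 16 = (e / 4) ^+ 2 by field.
  by rewrite lerXn2r ?nnegrE ?(ltW xe)// (le_trans x0 (ltW xe)).
rewrite -ltr_sqr ?nnegrE ?ipnorm_ge0 ?(ltW e0)// DSnorm_le//.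
rewrite mul1r.
exact: (lt_sum4 (exprn_gt0 2 e0) (sq_lt _ (ipnorm_ge0 _ _) l1) (sq_lt _ (ipnorm_ge0 _ _) l2)
  (sq_lt _ (ipnorm_ge0 _ _) l3) (sq_lt _ (ipnorm_ge0 _ _) l4)).
Qed.

Lemma tests_dense_DS (d : DS a q) e : 0 < e ->
  exists psi, ipnorm (DSip 1) (test_DS a q psi - d) < e.
Proof.
move=> e0; have e2 : 0 < e / 2 by rewrite divr_gt0.
have [L [d' [L0 s1 s2 h1]]] := DS_cutoff d e2.
have [psi h2] := tests_dense_DS_supp L0 s1 s2 e2.
exists psi; rewrite (splitr e); apply: le_lt_trans (ltrD h2 h1).
exact: (ipnorm_tri (@DSip_is_ip R a q 1 ler01) d').
Qed.

(** Extends identities from tests to [DS]. Additivity is enough, so the argument serves linear and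
    conjugate-linear maps alike. *)
Lemma DS_ext0 (F : DS a q -> R[i]) (M : R) : (forall d d', F (d - d') = F d - F d') ->
  (forall d, cabs (F d) <= M * ipnorm (DSip 1) d) ->
  (forall phi, F (test_DS a q phi) = 0) -> forall d, F d = 0.
Proof.
move=> FB FM F0 d.
apply: cabs_eq0; apply/eqP; rewrite eq_le cabs_ge0 andbT; apply/ler_addgt0Pl => e e0.
have M1 : 0 < `|M| + 1 by rewrite ltr_wpDl.
have [phi h] := tests_dense_DS d (divr_gt0 e0 M1).
have -> : F d = - F (test_DS a q phi - d) by rewrite FB F0 sub0r opprK.
rewrite addr0 cabsN (le_trans (FM _))//.
apply: le_trans (ler_wpM2r (ipnorm_ge0 _ _) (ler_norm M)) _.
apply: le_trans (ler_wpM2l (normr_ge0 M) (ltW h)) _.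
by rewrite mulrCA ler_piMr ?(ltW e0)// ler_pdivrMr// mul1r lerDl.
Qed.

Lemma DS_by_parts (d e : DS a q) : L2_ip d (dsD e) = - L2_ip (dsD d) e.
Proof.
apply/eqP; rewrite -subr_eq0 opprK; apply/eqP.
apply: (@DS_ext0 (fun e => L2_ip d (dsD e) + L2_ip (dsD d) (DS_val e))
  (L2_norm d + L2_norm (dsD d))).
- move=> x y; rewrite (dsB (@dsD_lin _ _ _)) (ipBr P).
  have -> : DS_val (x - y) = DS_val x - DS_val y by [].
  rewrite (ipBr P) opprD addrACA//.
- move=> x; have [nD _ _ nv] := DSnorm_ge x (lexx 1).
  apply: le_trans (cabsD _ _) _; rewrite mulrDl; apply: lerD.
    apply: le_trans (cauchy_schwarz P _ _) _; apply: ler_wpM2l; [exact: ipnorm_ge0|exact: nD].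
  apply: le_trans (cauchy_schwarz P _ _) _; apply: ler_wpM2l; [exact: ipnorm_ge0|exact: nv].
- move=> phi; have [/weak_derivativeP h _ _] := dsP d.
  by rewrite (dsD_test sa sq phi) (test_DSE phi sa sq) h addNr.
Qed.

End density_in_DS.

(** * The a priori estimate *)

(** The integral of [m u] times the conjugate of [v], in which all energy identities are written. It
    is hermitian since [m] is real. *)
HB.lock Definition wip {R : realType} (m : R -> R) (u v : L2 R) : R[i] := L2_ip u (mulop m v).

Section weighted_ip.
Context {R : realType}.
Implicit Types (u v w : L2 R) (m n : R -> R) (c : R[i]).
Local Opaque L2_ip smooth.
Let P := @L2_is_ip R.

Definition bounded_multiplier m :=
  measurable_fun setT m /\ exists K : R, forall x, `|m x| <= K.

Local Notation bdd := bounded_multiplier.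

Lemma bdd_dom m u : bdd m -> mul_dom m u.
Proof. by move=> [mm [K mK]]; exact: mul_dom_bounded mm mK. Qed.

Lemma bdd_cst (k : R) : bdd (fun=> k).
Proof. by split; [exact: measurable_cst|exists `|k|]. Qed.

Lemma bddD m n : bdd m -> bdd n -> bdd (fun x => m x + n x).
Proof.
move=> [mm [K mK]] [mn [K' mK']]; split; first exact: measurable_funD.
by exists (K + K') => x; rewrite (le_trans (ler_normD _ _))// lerD.
Qed.

Lemma bddM m n : bdd m -> bdd n -> bdd (fun x => m x * n x).
Proof.
move=> [mm [K mK]] [mn [K' mK']]; split; first exact: measurable_funM.
by exists (K * K') => x; rewrite normrM ler_pM.
Qed.

Lemma bddN m : bdd m -> bdd (fun x => - m x).
Proof.
move=> [mm [K mK]]; split; first exact: measurableT_comp.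
by exists K => x; rewrite normrN.
Qed.

Lemma wipE m u v : wip m u v = L2_ip u (mulop m v).
Proof. by rewrite wip.unlock. Qed.

Lemma wip_lin m c u v w : wip m (c *: u + v) w = c * wip m u w + wip m v w.
Proof. by rewrite !wipE (ip_lin P). Qed.

Lemma wipC m u v : bdd m -> wip m v u = (wip m u v)^*%C.
Proof. by move=> bm; rewrite !wipE -(ipC P) (mulop_ipC (bdd_dom _ bm) (bdd_dom _ bm)). Qed.

Lemma wip_linr m c u v w : bdd m -> wip m w (c *: u + v) = c^*%C * wip m w u + wip m w v.
Proof. by move=> bm; rewrite !(wipC _ w) ?wip_lin// rmorphD rmorphM. Qed.

Lemma wip_Im0 m u : bdd m -> complex.Im (wip m u u) = 0.
Proof.
move=> bm; have := congr1 (fun c => complex.Im c) (wipC u u bm); rewrite cImJ => /eqP.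
by rewrite -subr_eq0 opprK -mulr2n mulrn_eq0 /= => /eqP.
Qed.

Lemma wipDm m n u v : bdd m -> bdd n -> wip (fun x => m x + n x) u v = wip m u v + wip n u v.
Proof. by move=> bm bn; rewrite !wipE mulopDl ?(ipDr P)//; exact: bdd_dom. Qed.

Lemma wipZm (k : R) m u v : bdd m -> wip (fun x => k * m x) u v = k%:C * wip m u v.
Proof. by move=> bm; rewrite !wipE mulopZl ?(ipZr P) ?conjc_real//; exact: bdd_dom. Qed.

Lemma wip_cst (k : R) u v : wip (fun=> k) u v = k%:C * L2_ip u v.
Proof. by rewrite wipE mulop_cst (ipZr P) conjc_real. Qed.

Lemma wip_le m (K : R) u v : measurable_fun setT m -> (forall x, `|m x| <= K) ->
  cabs (wip m u v) <= K * (L2_norm u * L2_norm v).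
Proof.
move=> mm mK; rewrite wipE; apply: le_trans (cauchy_schwarz P _ _) _.
rewrite mulrCA; apply: ler_wpM2l; [exact: ipnorm_ge0|exact: mulop_norm_le].
Qed.

Lemma wip_ge0 m u : bdd m -> (forall x, 0 <= m x) -> 0 <= complex.Re (wip m u u).
Proof.
by move=> bm m0; rewrite wipE -(mulop_ipC (bdd_dom _ bm) (bdd_dom _ bm)); apply: mulop_ge0 (bdd_dom _ bm).
Qed.

Lemma wip_mono m n u : bdd m -> bdd n -> (forall x, m x <= n x) ->
  complex.Re (wip m u u) <= complex.Re (wip n u u).
Proof.
move=> bm bn mn; rewrite -subr_ge0 -cReN -cReD.
have -> : wip n u u - wip m u u = wip (fun x => n x + -1 * m x) u u.
  rewrite (wipDm _ _ bn (bddM (bdd_cst (-1)) bm)) (wipZm (-1) _ _ bm).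
  by rewrite rmorphN1 mulN1r.
apply: wip_ge0; first exact: bddD bn (bddM (bdd_cst (-1)) bm).
by move=> x; rewrite mulN1r subr_ge0.
Qed.

End weighted_ip.

(** * Energy identities for the resolvent equation *)

Section wave_identities.
Context {R : realType}.
Variables a q : R -> R.
Hypotheses (sa : smooth a) (sq : smooth q).
Hypotheses (a0 : forall x, 0 <= a x) (q0 : forall x, 0 <= q x).
Local Opaque L2_ip smooth.
Let P := @L2_is_ip R.
Local Notation bdd := bounded_multiplier.
Local Notation sqq := (fun x => Num.sqrt (q x)).
Local Notation sqa := (fun x => Num.sqrt (a x)).

Variables (c b : R) (w : DS a q) (z y F1 F3 g : L2 R).
Let lam : R[i] := (- c) +i* b.

(* The resolvent equation (G - lam)(v, w) = (F, g), written for w and for the L2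
   functions z = v', y = sqrt q v, with F1 = F', F3 = sqrt q F. *)
Definition wave_solution := [/\ dsD w = lam *: z + F1, dsQ w = lam *: y + F3 &
  forall psi : DS a q, L2_ip z (dsD psi) + L2_ip y (dsQ psi) +
    2%:R * L2_ip (dsA w) (dsA psi) + lam * L2_ip w psi + L2_ip g psi = 0].

Hypothesis sol : wave_solution.

(** Test element [m w]. The relations [w' = lam z + F1] and [sqrt q w = lam y + F3] are inserted in
    the conjugate-linear slot, whence [lam^*]. In the imaginary part [b] therefore multiplies the
    difference of kinetic and potential energy, in the real part [- c] multiplies their sum. *)
Lemma wave_identity_w (m : R -> R) : smooth m -> bdd m -> bdd m^`()%classic ->
  wip m^`()%classic z w + lam^*%C * (wip m z z + wip m y y) + lam * wip m w w +
  2%:R * wip m (dsA w) (dsA w) + (wip m z F1 + wip m y F3 + wip m g w) = 0.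
Proof.
move=> sm bm bm'; have [E1 E3 E2] := sol; have [_ [C mC]] := bm; have [_ [C' mC']] := bm'.
have [psi [pv pD pQ pA]] := DS_mul w sm mC mC'.
have := E2 psi; rewrite pv pD pQ pA (ipDr P) -!wipE E1 E3 !wip_linr//.
move: (wip m^`()%classic z w) (wip m z z) (wip m y y) (wip m w w) => x1 x2 x3 x4.
move: (wip m (dsA w) (dsA w)) (wip m z F1) (wip m y F3) (wip m g w) => x5 x6 x7 x8 <-.
ring.
Qed.

Lemma wave_identity_w_Re (m : R -> R) : smooth m -> bdd m -> bdd m^`()%classic ->
  complex.Re (wip m^`()%classic z w) - c * (complex.Re (wip m z z) + complex.Re (wip m y y) +
    complex.Re (wip m w w)) + 2 * complex.Re (wip m (dsA w) (dsA w)) +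
  (complex.Re (wip m z F1) + complex.Re (wip m y F3) + complex.Re (wip m g w)) = 0.
Proof.
move=> sm bm bm'; have := congr1 (fun c => complex.Re c) (wave_identity_w sm bm bm').
have := wip_Im0 z bm; have := wip_Im0 y bm; have := wip_Im0 w bm; have := wip_Im0 (dsA w) bm.
rewrite /lam; move: (wip m^`()%classic z w) (wip m z z) (wip m y y) (wip m w w) => x1 x2 x3 x4.
move: (wip m (dsA w) (dsA w)) (wip m z F1) (wip m y F3) (wip m g w) => x5 x6 x7 x8.
rewrite !cReIm /= => -> -> -> ->; lra.
Qed.

Lemma wave_identity_w_Im (m : R -> R) : smooth m -> bdd m -> bdd m^`()%classic ->
  complex.Im (wip m^`()%classic z w) + b * (complex.Re (wip m w w) - complex.Re (wip m z z) -
    complex.Re (wip m y y)) +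
  (complex.Im (wip m z F1) + complex.Im (wip m y F3) + complex.Im (wip m g w)) = 0.
Proof.
move=> sm bm bm'; have := congr1 (fun c => complex.Im c) (wave_identity_w sm bm bm').
have := wip_Im0 z bm; have := wip_Im0 y bm; have := wip_Im0 w bm; have := wip_Im0 (dsA w) bm.
rewrite /lam; move: (wip m^`()%classic z w) (wip m z z) (wip m y y) (wip m w w) => x1 x2 x3 x4.
move: (wip m (dsA w) (dsA w)) (wip m z F1) (wip m y F3) (wip m g w) => x5 x6 x7 x8.
rewrite !cReIm /= => -> -> -> ->; lra.
Qed.

Lemma wave_y (m : R -> R) v : bdd m -> bdd (fun x => m x * Num.sqrt (q x)) ->
  lam * wip m y v = wip (fun x => m x * Num.sqrt (q x)) w v - wip m F3 v.
Proof.
move=> bm bmq; have [E1 E3 E2] := sol; have [_ dq _] := dsP w.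
apply/eqP; rewrite eq_sym subr_eq -wip_lin -E3 eq_sym; apply/eqP.
rewrite !wipE -(mulop_ipC (bdd_dom _ bm) (bdd_dom _ bm)) -(mulop_ipC (bdd_dom _ bmq) (bdd_dom _ bmq)).
by rewrite (mulop_comp dq (bdd_dom _ bm)).
Qed.

Lemma mulop_dsA (m : R -> R) : bdd m -> bdd (fun x => m x * Num.sqrt (a x)) ->
  mulop m (dsA w) = mulop (fun x => m x * Num.sqrt (a x)) w.
Proof.
by move=> bm bma; have [_ _ da] := dsP w; rewrite /dsA (mulop_comp da (bdd_dom _ bm)).
Qed.

Lemma bdd_continuous_supp (m : R -> R) (L : R) : continuous m ->
  (forall x, L <= `|x| -> m x = 0) -> bdd m.
Proof.
move=> cm m0; split; first exact: continuous_measurable_fun.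
have [C _ mC] : exists2 C : R, 0 < C & forall x, `|m x| <= C.
  by apply: (@continuous_bounded_outside _ _ L 0 cm) => x /m0 ->; rewrite normr0.
by exists C.
Qed.

Lemma bdd_smooth_supp (m n : R -> R) (L : R) : smooth m -> continuous n ->
  (forall x, L <= `|x| -> m x = 0) -> bdd (fun x => m x * n x).
Proof.
move=> sm cn m0; have cm : continuous m := smooth_continuous sm.
apply: (@bdd_continuous_supp _ L).
  have h : continuous (m \* n) by move=> x; apply: continuousM; [exact: cm|exact: cn].
  exact: h.
by move=> x /m0 ->; rewrite mul0r.
Qed.

Lemma smooth_supp_derive (m : R -> R) (L : R) : smooth m ->
  (forall x, L <= `|x| -> m x = 0) -> forall x, L + 1 <= `|x| -> m^`()%classic x = 0.
Proof.
by move=> sm m0 x xL; apply: (derive_outside sm m0); apply: lt_le_trans xL; rewrite ltrDl.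
Qed.

Section compactly_supported_multiplier.
Variables (m : R -> R) (L : R).
Hypotheses (sm : smooth m) (m0 : forall x, L <= `|x| -> m x = 0).

Let ca : continuous a := smooth_continuous sa.
Let cq : continuous q := smooth_continuous sq.
Let csq := continuous_sqrt sq.
Let csa := continuous_sqrt sa.
Let bm : bdd m := bdd_continuous_supp (smooth_continuous sm) m0.
Let bm' : bdd m^`()%classic :=
  bdd_continuous_supp (smooth_continuous (smooth_derive sm)) (smooth_supp_derive sm m0).
Let bma : bdd (fun x => m x * a x) := bdd_smooth_supp sm ca m0.
Let bmsq : bdd (fun x => m x * Num.sqrt (q x)) := bdd_smooth_supp sm csq m0.
Let bmsa : bdd (fun x => m x * Num.sqrt (a x)) := bdd_smooth_supp sm csa m0.

Lemma wip_sqrt_split (k : R -> R) u v : (forall x, 0 <= k x) ->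
  mul_dom (fun x => Num.sqrt (k x)) u -> bdd (fun x => m x * Num.sqrt (k x)) ->
  bdd (fun x => m x * k x) ->
  L2_ip (mulop (fun x => Num.sqrt (k x)) u) (mulop (fun x => m x * Num.sqrt (k x)) v) =
  wip (fun x => m x * k x) u v.
Proof.
move=> k0 du b1 b2; rewrite -(mulop_ipC (bdd_dom _ b1) (bdd_dom _ b1)) (mulop_comp du (bdd_dom _ b1)).
rewrite wipE -(mulop_ipC (bdd_dom _ b2) (bdd_dom _ b2)).
congr (L2_ip (mulop _ _) _); apply/funext => x.
by rewrite -mulrA -expr2 sqr_sqrtr.
Qed.

Lemma wave_z_test (phi : test R) :
  L2_ip z (test_L2 (test_derive phi)) + L2_ip y (mulop sqq (test_L2 phi)) +
    2%:R * L2_ip (dsA w) (mulop sqa (test_L2 phi)) + lam * L2_ip w (test_L2 phi) +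
    L2_ip g (test_L2 phi) = 0.
Proof.
have [_ _ E2] := sol.
have := E2 (test_DS a q phi).
by rewrite (dsD_test sa sq) (dsQ_test sa sq) (dsA_test sa sq) (test_DSE phi sa sq).
Qed.

(** This is [m z'], with [z' = lam w + 2 a w + sqrt q y + g] read off the equation. *)
Let Z : L2 R := lam *: mulop m w + (2%:R *: mulop (fun x => m x * a x) w +
  (mulop (fun x => m x * Num.sqrt (q x)) y + mulop m g)).

(* z is only locally in H^1, but mulop m z belongs to DS and is a legitimate test element. *)
Lemma wave_localized_z : exists psi : DS a q, [/\ DS_val psi = mulop m z,
  dsD psi = mulop m^`()%classic z + Z, dsQ psi = mulop (fun x => m x * Num.sqrt (q x)) z &
  dsA psi = mulop (fun x => m x * Num.sqrt (a x)) z].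
Proof.
have dt := fun (k : R -> R) phi (ck : continuous k) => mul_dom_test phi ck.
have cm : continuous m := smooth_continuous sm.
have cm' : continuous m^`()%classic := smooth_continuous (smooth_derive sm).
have wz : weak_derivative (mulop m z) (mulop m^`()%classic z + Z).
  apply/weak_derivativeP => phi.
  have := wave_z_test (test_mul sm phi).
  rewrite test_derive_mul -(mulop_test phi sm) (ipDr P).
  rewrite (mulop_ipC (bdd_dom z bm) (dt _ _ cm)) /Z !(ipDl P) !(ipZl P).
  rewrite (mulop_ipC (bdd_dom z bm') (dt _ _ cm')) (mulop_ipC (bdd_dom w bm) (dt _ _ cm)).
  rewrite (mulop_ipC (bdd_dom g bm) (dt _ _ cm)).
  have -> : L2_ip y (mulop sqq (mulop m (test_L2 phi))) =
      L2_ip (mulop (fun x => m x * Num.sqrt (q x)) y) (test_L2 phi).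
    have d2 : mul_dom sqq (mulop m (test_L2 phi)) by rewrite (mulop_test _ sm); exact: mul_dom_test.
    rewrite (mulop_comp (dt _ phi cm) d2) -mulop_ipC; first last.
    - exact: mul_dom_comp (dt _ phi cm) d2.
    - rewrite (_ : (fun x => _) = fun x => m x * Num.sqrt (q x)); first exact: bdd_dom.
      by apply/funext => x; rewrite mulrC.
    by congr (L2_ip (mulop _ _) _); apply/funext => x; rewrite mulrC.
  have -> : L2_ip (dsA w) (mulop sqa (mulop m (test_L2 phi))) =
      L2_ip (mulop (fun x => m x * a x) w) (test_L2 phi).
    have d2 : mul_dom sqa (mulop m (test_L2 phi)) by rewrite (mulop_test _ sm); exact: mul_dom_test.
    rewrite (mulop_comp (dt _ phi cm) d2).
    have -> : (fun x => Num.sqrt (a x) * m x) = (fun x => m x * Num.sqrt (a x)).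
      by apply/funext => x; rewrite mulrC.
    have [_ _ da] := dsP w.
    rewrite (wip_sqrt_split (test_L2 phi) a0 da bmsa bma) wipE mulop_ipC//; first exact: bdd_dom.
    by apply: mul_dom_test; apply: smooth_continuous; exact: smoothM.
  move: (L2_ip z (mulop m^`()%classic (test_L2 phi))).
  move: (L2_ip z (mulop m (test_L2 (test_derive phi)))) => x1 x2.
  move: (L2_ip (mulop (fun x => m x * Num.sqrt (q x)) y) (test_L2 phi)) => x3.
  move: (L2_ip (mulop (fun x => m x * a x) w) (test_L2 phi)) => x4.
  move: (L2_ip w (mulop m (test_L2 phi))) (L2_ip g (mulop m (test_L2 phi))) => x5 x6 h.
  apply/eqP; rewrite -subr_eq0 opprK -h; apply/eqP; ring.
have cmp (k : R -> R) : bdd (fun x => m x * Num.sqrt (k x)) ->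
    mul_dom (fun x => Num.sqrt (k x)) (mulop m z) /\
    mulop (fun x => Num.sqrt (k x)) (mulop m z) = mulop (fun x => m x * Num.sqrt (k x)) z.
  move=> bk; have /mulopP h1 := bdd_dom z bk; have /mulopP h2 := bdd_dom z bm.
  have d : mul_dom (fun x => Num.sqrt (k x)) (mulop m z).
    exists (mulop (fun x => m x * Num.sqrt (k x)) z).
    by apply: ae_imply2 h1 h2 => x -> ->; rewrite [m x * _]mulrC rmorphM mulrA.
  split => //; rewrite (mulop_comp (bdd_dom z bm) d).
  by congr (mulop _ z); apply/funext => x; rewrite mulrC.
have [dq eq] := cmp q bmsq; have [da ea] := cmp a bmsa.
have [psi [pv pD]] := DS_of wz dq da.
by exists psi; split => //; rewrite ?/dsQ ?/dsA pv.
Qed.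

(** Test element [m z]. It is the relation [(|z|^2)' = 2 Re (z' conj z)] integrated against [m],
    with [z'] given by the equation. *)
Lemma wave_identity_z :
  complex.Re (wip m^`()%classic z z) + 2 * complex.Re (lam * wip m w z) +
  4 * complex.Re (wip (fun x => m x * a x) w z) +
  2 * complex.Re (wip (fun x => m x * Num.sqrt (q x)) y z) + 2 * complex.Re (wip m g z) = 0.
Proof.
have [_ _ E2] := sol; have [psi [pv pD pQ pA]] := wave_localized_z; have [_ _ da] := dsP w.
have := E2 psi; rewrite pv pD pQ pA (wip_sqrt_split z a0 da bmsa bma) /Z.
rewrite !(ipDr P) !(ipZr P) -!wipE.
rewrite (wipC w z bm) (wipC w z bma) (wipC y z bmsq) (wipC g z bm).
move=> /(congr1 (fun c => complex.Re c)); rewrite /lam.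
move: (wip m^`()%classic z z) (wip m w z) (wip (fun x => m x * a x) w z) => x1 x2 x3.
move: (wip (fun x => m x * Num.sqrt (q x)) y z) (wip m g z) => x4 x5.
rewrite !cReIm /=; lra.
Qed.

(** The analogous relation for [|w|^2], with [w' = lam z + F1]. *)
Lemma wave_identity_w_parts :
  complex.Re (wip m^`()%classic w w) + 2 * complex.Re (lam * wip m z w) +
  2 * complex.Re (wip m F1 w) = 0.
Proof.
have [E1 _ _] := sol; have [_ [C mC]] := bm; have [_ [C' mC']] := bm'.
have [psi [pv pD _ _]] := DS_mul w sm mC mC'.
have := DS_by_parts sa sq w psi; rewrite pv pD (ipDr P) -!wipE E1.
rewrite !(wip_lin, wip_linr) //.
rewrite (wipC z w bm) (wipC F1 w bm) => /(congr1 (fun c => complex.Re c)); rewrite /lam.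
move: (wip m^`()%classic w w) (wip m z w) (wip m F1 w) => x1 x2 x3.
rewrite !cReIm /=; lra.
Qed.

(** In the sum of the last two identities [lam] multiplies a pairing plus its conjugate, a real
    number. Only [Re lam = - c] survives and the large parameter [b] disappears. *)
Lemma wave_identity_energy :
  complex.Re (wip m^`()%classic w w) + complex.Re (wip m^`()%classic z z) -
  4 * c * complex.Re (wip m w z) + 4 * complex.Re (wip (fun x => m x * a x) w z) +
  2 * complex.Re (wip (fun x => m x * Num.sqrt (q x)) y z) +
  2 * (complex.Re (wip m g z) + complex.Re (wip m F1 w)) = 0.
Proof.
have := wave_identity_w_parts; have := wave_identity_z; rewrite (wipC w z bm) /lam.
move: (wip m^`()%classic z z) (wip m w z) (wip (fun x => m x * a x) w z) => x1 x2 x3.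
move: (wip (fun x => m x * Num.sqrt (q x)) y z) (wip m g z) (wip m^`()%classic w w) => x4 x5 x6.
move: (wip m F1 w) => x7; rewrite !cReIm /=; lra.
Qed.

End compactly_supported_multiplier.
End wave_identities.

(** * Localised transport estimates *)

Section a_priori_estimate.
Context {R : realType}.
Variables a q : R -> R.
Hypotheses (sa : smooth a) (sq : smooth q).
Hypotheses (a0 : forall x, 0 <= a x) (q0 : forall x, 0 <= q x).
Local Opaque L2_ip smooth.
Let P := @L2_is_ip R.
Local Notation bdd := bounded_multiplier.
Implicit Types (w : DS a q) (z y g u v : L2 R).

Record wave_data (kap c b : R) w z y (F1 F3 : L2 R) g (n f : R) : Prop := WaveData {
  wave_sol : wave_solution c b w z y F1 F3 g;
  wave_c : `|c| <= kap;
  wave_b : 1 <= `|b|;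
  wave_w_le : L2_norm w <= n; wave_z_le : L2_norm z <= n; wave_y_le : L2_norm y <= n;
  wave_F1_le : L2_norm F1 <= f; wave_F3_le : L2_norm F3 <= f; wave_g_le : L2_norm g <= f }.

Lemma wip_bound (m : R -> R) (K : R) u v (nu nv : R) : measurable_fun setT m ->
  (forall x, `|m x| <= K) -> L2_norm u <= nu -> L2_norm v <= nv ->
  cabs (wip m u v) <= K * (nu * nv).
Proof.
move=> mm mK un vn; apply: le_trans (wip_le _ _ mm mK) _.
have K0 : 0 <= K := le_trans (normr_ge0 _) (mK 0).
by apply: ler_wpM2l => //; apply: ler_pM => //; exact: ipnorm_ge0.
Qed.

Lemma bounds_Re (k : R[i]) (B : R) : cabs k <= B -> - B <= complex.Re k <= B.
Proof. by move=> kB; rewrite -ler_norml; exact: le_trans (le_Re_cabs _) kB. Qed.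

Lemma bounds_Im (k : R[i]) (B : R) : cabs k <= B -> - B <= complex.Im k <= B.
Proof. by move=> kB; rewrite -ler_norml; exact: le_trans (le_Im_cabs _) kB. Qed.

Section estimates.
Variables (kap c b : R) (w : DS a q) (z y F1 F3 g : L2 R) (n f : R).
Hypothesis H : wave_data kap c b w z y F1 F3 g n f.

(** An admissible error: the first term is absorbed once [|b|] is large, the second is linear in the
    data. *)
Definition wave_error := n ^+ 2 / `|b| + n * f.

Let sol := wave_sol H.

Lemma n_ge0 : 0 <= n. Proof. exact: le_trans (ipnorm_ge0 _ _) (wave_w_le H). Qed.
Lemma f_ge0 : 0 <= f. Proof. exact: le_trans (ipnorm_ge0 _ _) (wave_g_le H). Qed.
Lemma b_gt0 : 0 < `|b|. Proof. exact: lt_le_trans ltr01 (wave_b H). Qed.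

Lemma nf_le_error : n * f <= wave_error.
Proof. by rewrite lerDr divr_ge0// sqr_ge0. Qed.

Lemma error_ge0 : 0 <= wave_error.
Proof. by apply: le_trans nf_le_error; rewrite mulr_ge0 ?n_ge0 ?f_ge0. Qed.

Lemma div_b_le_error (k x : R) : 0 <= k -> `|b| * x <= k * (n ^+ 2 + n * f) ->
  x <= k * wave_error.
Proof.
move=> k0; rewrite -ler_pdivlMl ?b_gt0// => h; apply: le_trans h _.
rewrite mulrCA; apply: ler_wpM2l => //; rewrite mulrDr mulrC lerD2l.
rewrite ler_piMl ?mulr_ge0 ?n_ge0 ?f_ge0// invf_le1 ?b_gt0//; exact: wave_b H.
Qed.

(** Since [lam y = sqrt q w - F3] and [|lam| >= |b|], the function [y] gains a factor [1 / |b|]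
    wherever [m sqrt q] is bounded, so its pairings are admissible errors. *)
Lemma wip_y_bound (m : R -> R) (K : R) v : bdd m -> bdd (fun x => m x * Num.sqrt (q x)) ->
  (forall x, `|m x| <= K) -> (forall x, `|m x * Num.sqrt (q x)| <= K) -> L2_norm v <= n ->
  cabs (wip m y v) <= K * wave_error.
Proof.
move=> bm bmq mK mqK vn; have K0 : 0 <= K := le_trans (normr_ge0 _) (mK 0).
have E := congr1 cabs (wave_y sol v bm bmq); rewrite cabsM in E.
have lamb : `|b| <= cabs ((- c) +i* b) by exact: (le_Im_cabs ((- c) +i* b)).
apply: div_b_le_error => //; apply: le_trans (ler_wpM2r (cabs_ge0 _) lamb) _; rewrite E.
apply: le_trans (cabsD _ _) _; rewrite cabsN mulrDr; apply: lerD.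
  by rewrite expr2; apply: wip_bound bmq.1 mqK (wave_w_le H) vn.
rewrite [n * f]mulrC; exact: wip_bound bm.1 mK (wave_F3_le H) vn.
Qed.

Lemma Re_wip_sqrD (m : R -> R) u v : bdd m -> complex.Re (wip m (u + v) (u + v)) =
  complex.Re (wip m u u) + complex.Re (wip m v v) + 2 * complex.Re (wip m u v).
Proof.
move=> bm; have := wip_lin m 1 u v (u + v); rewrite scale1r mul1r => ->.
have h x : wip m x (u + v) = wip m x u + wip m x v.
  by have := wip_linr 1 u v x bm; rewrite scale1r rmorph1 mul1r.
rewrite !h (wipC u v bm); move: (wip m u u) (wip m v v) (wip m u v) => x1 x2 x3.
rewrite !cReIm; ring.
Qed.

Lemma Re_wip_sqrB (m : R -> R) u v : bdd m -> complex.Re (wip m (u - v) (u - v)) =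
  complex.Re (wip m u u) + complex.Re (wip m v v) - 2 * complex.Re (wip m u v).
Proof.
move=> bm; rewrite Re_wip_sqrD// -scaleN1r.
have := wip_lin m (-1) v 0 (-1 *: v); have := wip_linr (-1) v 0 v bm; have := wip_linr (-1) v 0 u bm.
rewrite !addr0 => -> h1 h2.
have z0 x : wip m 0 x = 0 by rewrite wipE (ip0l P).
have z1 x : wip m x 0 = 0 by rewrite (wipC 0 x bm) z0 conjc0.
rewrite h2 h1 z0 !z1 !addr0; move: (wip m u u) (wip m v v) (wip m u v) => x1 x2 x3.
rewrite !cReIm /=; ring.
Qed.

Lemma transport_error_arith (K x1 x2 : R) : 0 <= K * x1 ->
  K * x1 + (K * x2 + K * x2 + K * x2) <= 3 * K * (x1 + x2).
Proof. lra. Qed.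

(** The energy identity plus or minus twice the real identity for [w]. The indices 1 to 4 of [S] and
    [A] refer to the pairs [ww], [zz], [wz], [yy] with weights [m] and [m a]; the [X] are the terms
    in [m']. Equipartition replaces [4 A1] by [2 (A1 + A2)]. The constant is 2 for [Y], 4 for the
    [G], 6 for the [H], 8 for equipartition, and [2 kap] for [S4]. *)
Lemma transport_arith (kap' c' B X1 X2 X3 A1 A2 A3 A4 S1 S2 S3 S4 Y G1 G2 H1 H2 H3 : R) :
  0 <= B -> `|c'| <= kap' ->
  X1 + X2 - 4 * c' * S3 + 4 * A3 + 2 * Y + 2 * (G1 + G2) = 0 ->
  X3 - c' * (S2 + S4 + S1) + 2 * A1 + (H1 + H2 + H3) = 0 ->
  - B <= Y <= B -> - B <= G1 <= B -> - B <= G2 <= B ->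
  - B <= H1 <= B -> - B <= H2 <= B -> - B <= H3 <= B ->
  - B <= A4 <= B -> - B <= S4 <= B -> `|A1 - A2 - A4| <= 3 * B ->
  `|X1 + X2 + 2 * X3 + 2 * (A1 + A2 + 2 * A3) - 2 * c' * (S1 + S2 + 2 * S3)| <= (20 + 2 * kap') * B /\
  `|X1 + X2 - 2 * X3 - 2 * (A1 + A2 - 2 * A3) + 2 * c' * (S1 + S2 - 2 * S3)| <= (20 + 2 * kap') * B.
Proof.
move=> B0 ck E1 E2 /andP[Y1 Y2] /andP[G11 G12] /andP[G21 G22].
move=> /andP[H11 H12] /andP[H21 H22] /andP[H31 H32] /andP[A41 A42] S4B.
have cS : `|c' * S4| <= kap' * B by rewrite normrM ler_pM// ler_norml.
move: cS; rewrite !ler_norml => /andP[c1 c2] /andP[a1 a2].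
split; apply/andP; split; lra.
Qed.

(* Up to errors controlled by [wave_error], |w + z|^2 and |w - z|^2 solve the transport
   equations r' = 2 (a - c) r and r' = - 2 (a - c) r, tested here against [m]. They decouple
   by equipartition of energy: the imaginary part of the identity for the weight [m * a],
   divided by b, shows that a |w|^2 and a (|z|^2 + |y|^2) have nearly the same mean. *)
Lemma transport_estimate (m : R -> R) (L K : R) : smooth m -> (forall x, L <= `|x| -> m x = 0) ->
  (forall x, `|m x| <= K) -> (forall x, `|m^`()%classic x| <= K) ->
  (forall x, `|m x * a x| <= K) -> (forall x, `|(fun x => m x * a x)^`()%classic x| <= K) ->
  (forall x, `|m x * Num.sqrt (q x)| <= K) -> (forall x, `|m x * a x * Num.sqrt (q x)| <= K) ->
  (forall x, `|m x * Num.sqrt (q x) * Num.sqrt (q x)| <= K) ->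
  let rho s x := m^`()%classic x + (s * (2 * (m x * a x)) + s * (- (2 * c)) * m x) in
  `|complex.Re (wip (rho 1) (DS_val w + z) (DS_val w + z))| <= (20 + 2 * kap) * K * wave_error /\
  `|complex.Re (wip (rho (-1)) (DS_val w - z) (DS_val w - z))| <= (20 + 2 * kap) * K * wave_error.
Proof.
move=> sm m0 k1 k2 k3 k4 k5 k6 k7 rho.
have sma : smooth (fun x => m x * a x) by exact: smoothM sm sa.
have ma0 x : L <= `|x| -> m x * a x = 0 by move=> /m0 ->; rewrite mul0r.
have csq := continuous_sqrt sq; have csa := continuous_sqrt sa.
have bm : bdd m := bdd_continuous_supp (smooth_continuous sm) m0.
have bm' : bdd m^`()%classic :=
  bdd_continuous_supp (smooth_continuous (smooth_derive sm)) (smooth_supp_derive sm m0).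
have bma : bdd (fun x => m x * a x) := bdd_continuous_supp (smooth_continuous sma) ma0.
have bma' : bdd (fun x => m x * a x)^`()%classic :=
  bdd_continuous_supp (smooth_continuous (smooth_derive sma)) (smooth_supp_derive sma ma0).
have bmsq : bdd (fun x => m x * Num.sqrt (q x)) := bdd_smooth_supp sm csq m0.
have bmsa : bdd (fun x => m x * Num.sqrt (a x)) := bdd_smooth_supp sm csa m0.
have bmasq : bdd (fun x => m x * a x * Num.sqrt (q x)) := bdd_smooth_supp sma csq ma0.
have K0 : 0 <= K := le_trans (normr_ge0 _) (k1 0).
have [wn zn yn] := And3 (wave_w_le H) (wave_z_le H) (wave_y_le H).
have [F1n F3n gn] := And3 (wave_F1_le H) (wave_F3_le H) (wave_g_le H).
pose B := K * wave_error.
have B0 : 0 <= B by rewrite mulr_ge0// error_ge0.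
have nfB : K * (n * f) <= B by apply: ler_wpM2l => //; exact: nf_le_error.
have nfB' : K * (f * n) <= B by rewrite [f * n]mulrC.
have I1 := wave_identity_energy sa sq a0 sol sm m0.
have I2 := wave_identity_w_Re sol sm bm bm'.
have I3 := wave_identity_w_Im sol sma bma bma'.
have AA : wip m (dsA w) (dsA w) = wip (fun x => m x * a x) w w.
  have [_ _ da] := dsP w.
  rewrite wipE (mulop_dsA w bm bmsa) (wip_sqrt_split w a0 da bmsa bma)//.
rewrite AA in I2.
have e1 := bounds_Re (le_trans (wip_bound bm.1 k1 gn zn) nfB').
have e2 := bounds_Re (le_trans (wip_bound bm.1 k1 F1n wn) nfB').
(* The term [Y] already carries the weight [m sqrt q]; the gain for [y] costs one more factor
   [sqrt q]. *)
have bmqq : bdd (fun x => m x * Num.sqrt (q x) * Num.sqrt (q x)).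
  rewrite (_ : (fun x => _) = fun x => m x * q x).
    exact: bdd_smooth_supp sm (smooth_continuous sq) m0.
  by apply/funext => x; rewrite -mulrA -expr2 sqr_sqrtr.
have e3 := bounds_Re (wip_y_bound bmsq bmqq k5 k7 zn).
have e4 := bounds_Re (wip_y_bound bm bmsq k1 k5 yn).
have e5 := bounds_Re (wip_y_bound bma bmasq k3 k6 yn).
have e6 := bounds_Re (le_trans (wip_bound bm.1 k1 zn F1n) nfB).
have e7 := bounds_Re (le_trans (wip_bound bm.1 k1 yn F3n) nfB).
have e8 := bounds_Re (le_trans (wip_bound bm.1 k1 gn wn) nfB').
have e9 : `|complex.Re (wip (fun x => m x * a x) w w) - complex.Re (wip (fun x => m x * a x) z z) -
    complex.Re (wip (fun x => m x * a x) y y)| <= 3 * B.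
  rewrite /B mulrA; apply: div_b_le_error; first by rewrite mulr_ge0.
  have eY := wip_bound bma'.1 k4 zn wn.
  have eF1 := wip_bound bma.1 k3 zn F1n; have eF3 := wip_bound bma.1 k3 yn F3n.
  have eg := wip_bound bma.1 k3 gn wn.
  rewrite -normrM.
  have -> : b * (complex.Re (wip (fun x => m x * a x) w w) -
      complex.Re (wip (fun x => m x * a x) z z) - complex.Re (wip (fun x => m x * a x) y y)) =
      - (complex.Im (wip (fun x => m x * a x)^`()%classic z w) +
         (complex.Im (wip (fun x => m x * a x) z F1) + complex.Im (wip (fun x => m x * a x) y F3) +
          complex.Im (wip (fun x => m x * a x) g w))).
    by apply/eqP; rewrite -subr_eq0 opprK -I3; apply/eqP; ring.
  rewrite normrN; apply: le_trans (ler_normD _ _) _.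
  apply: (@le_trans _ _ (K * (n * n) + (K * (n * f) + K * (n * f) + K * (f * n)))).
    apply: lerD; first exact: le_trans (le_Im_cabs _) eY.
    apply: le_trans (ler_normD _ _) _; apply: lerD; last exact: le_trans (le_Im_cabs _) eg.
    apply: le_trans (ler_normD _ _) _; apply: lerD; first exact: le_trans (le_Im_cabs _) eF1.
    exact: le_trans (le_Im_cabs _) eF3.
  rewrite expr2 [f * n]mulrC; have : 0 <= K * (n * n) by rewrite !mulr_ge0 ?n_ge0.
  exact: transport_error_arith.
have [T1 T2] := transport_arith B0 (wave_c H) I1 I2 e3 e1 e2 e6 e7 e8 e5 e4 e9.
have split_rho s u : complex.Re (wip (rho s) u u) = complex.Re (wip m^`()%classic u u) +
    s * (2 * complex.Re (wip (fun x => m x * a x) u u) - 2 * c * complex.Re (wip m u u)).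
  rewrite /rho (wipDm _ _ bm'); last first.
    apply: bddD; last exact: bddM (bdd_cst _) bm.
    exact: bddM (bdd_cst s) (bddM (bdd_cst 2) bma).
  rewrite wipDm; [|exact: bddM (bdd_cst s) (bddM (bdd_cst 2) bma)|exact: bddM (bdd_cst _) bm].
  rewrite (wipZm s _ _ (bddM (bdd_cst 2) bma)) (wipZm 2 _ _ bma) (wipZm _ _ _ bm).
  by rewrite !cReD !cReZ; ring.
rewrite -mulrA -/B; split.
  rewrite split_rho !(Re_wip_sqrD _ _ bm', Re_wip_sqrD _ _ bm, Re_wip_sqrD _ _ bma).
  move: T1; rewrite (wipC z w bm') cReJ; congr (`|_| <= _); ring.
rewrite split_rho !(Re_wip_sqrB _ _ bm', Re_wip_sqrB _ _ bm, Re_wip_sqrB _ _ bma).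
move: T2; rewrite (wipC z w bm') cReJ; congr (`|_| <= _); ring.
Qed.

End estimates.
End a_priori_estimate.

(** * Numerical bookkeeping of the estimates *)

Section arithmetic.
Context {R : realType}.

(* With [m = s * e^(s h) * chi], the transported weight [s * rho s] equals
   [e^(s h) (chi (h' + 2 (a - c)) + s chi')], and the barrier [h] makes
   [h' + 2 (a - c)] at least 1 everywhere. *)
Lemma interior_weight (kap H kp N s c ax hx h'x chx ch'x : R) : `|c| <= kap -> `|s| = 1 ->
  0 <= chx <= 1 -> `|ch'x| <= kp / N -> `|hx| <= H -> 0 <= kp / N ->
  1 <= h'x + 2 * (ax - kap) ->
  expR (- H) * chx - expR H * (kp / N) <=
  s * ((s * h'x * expR (s * hx) * chx + expR (s * hx) * ch'x) +
    (s * (2 * (expR (s * hx) * chx * ax)) + s * (- (2 * c)) * (expR (s * hx) * chx))).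
Proof.
move=> ck s1 /andP[ch0 _] ch'k hH kN0 L.
have ss : s * s = 1 by rewrite -expr2 -real_normK ?num_real// s1 expr1n.
have shH : `|s * hx| <= H by rewrite normrM s1 mul1r.
move: shH; rewrite ler_norml => /andP[l1 l2].
have e1 : expR (- H) <= expR (s * hx) by rewrite ler_expR.
have e2 : expR (s * hx) <= expR H by rewrite ler_expR.
have e3 : 0 <= expR (- H) := expR_ge0 _.
have sc : `|s * ch'x| <= kp / N by rewrite normrM s1 mul1r.
move: sc ck; rewrite !ler_norml => /andP[t1 _] /andP[_ t2].
have -> : s * ((s * h'x * expR (s * hx) * chx + expR (s * hx) * ch'x) +
    (s * (2 * (expR (s * hx) * chx * ax)) + s * (- (2 * c)) * (expR (s * hx) * chx))) =
  (s * s) * (expR (s * hx) * chx * (h'x + 2 * (ax - c))) + expR (s * hx) * (s * ch'x) by ring.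
rewrite ss mul1r; move: (expR (s * hx)) (expR (- H)) (expR H) e1 e2 e3 => e e' e'' e1 e2 e3.
apply: lerD.
  apply: (@le_trans _ _ (e * chx)); first exact: ler_wpM2r.
  rewrite ler_peMr ?mulr_ge0//; last lra.
  exact: le_trans e3 e1.
apply: (@le_trans _ _ (- (e * (kp / N)))).
  by rewrite lerN2; apply: ler_wpM2r.
rewrite -mulrN; apply: ler_wpM2l; last exact: t1.
exact: le_trans e3 e1.
Qed.

(** Here [e = e^H], [e' = e^(-H)], [k] is the slope of the cut-off, [X], [Z], [Y] are the localised
    pairings [ww], [zz], [wz], and [p1], [p2] are the squared norms of [w + z] and [w - z]. In the
    sum of the two bounds [Y] cancels and the parallelogram law evaluates [p1 + p2]; after
    multiplication by [e] the leak of the cut-off is at most [4 e^2 k n2], hence at most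
    [eta n2]. *)
Lemma interior_arith (kap eta k n2 E X Z Y p1 p2 w2 z2 e e' K1 K2 : R) :
  0 <= kap -> 0 <= k -> 0 < e -> 0 < K1 -> 0 < K2 ->
  e' * (X + Z + 2 * Y) - e * k * p1 <= (20 + 2 * kap) * K1 * E ->
  e' * (X + Z - 2 * Y) - e * k * p2 <= (20 + 2 * kap) * K2 * E ->
  p1 + p2 = 2 * (w2 + z2) -> 0 <= Z -> e' * e = 1 -> 4 * e ^+ 2 * k <= eta ->
  w2 <= n2 -> z2 <= n2 -> 0 <= E -> 0 <= n2 ->
  X <= eta * n2 + e * ((20 + 2 * kap) * (K1 + K2)) * E.
Proof.
move=> kap0 k0 e0 K10 K20 k1 k2 par Z0 ee NE s1 s2 E0 n0.
have ek : 0 <= e * k by rewrite mulr_ge0// ltW.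
have S : 2 * e' * (X + Z) <= e * k * (4 * n2) + (20 + 2 * kap) * (K1 + K2) * E.
  have : e * k * (p1 + p2) <= e * k * (4 * n2) by apply: ler_wpM2l => //; rewrite par; clear -s1 s2; lra.
  clear -k1 k2; move: (e * k) k1 k2 => ek k1 k2; lra.
have := ler_wpM2l (ltW e0) S.
have -> : e * (2 * e' * (X + Z)) = (e' * e) * (2 * (X + Z)) by ring.
rewrite ee mul1r => S'.
have N' := ler_wpM2r n0 NE.
have C0 : 0 <= e * ((20 + 2 * kap) * (K1 + K2)) * E.
  by rewrite !mulr_ge0// ?(ltW e0)//; clear -kap0 K10 K20; lra.
have T0 : 0 <= 4 * e ^+ 2 * k * n2 by rewrite !mulr_ge0 ?exprn_ge0 ?(ltW e0).
move: S' N' C0 T0; rewrite [e * (_ + _)]mulrDr.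
have -> : e * (e * k * (4 * n2)) = 4 * e ^+ 2 * k * n2 by ring.
rewrite [e * (_ * E)]mulrA.
move: (4 * e ^+ 2 * k * n2) (eta * n2) => t t'.
move: (e * ((20 + 2 * kap) * (K1 + K2)) * E) => t'' S' N' C0 T0; clear -Z0 S' N' C0 T0; lra.
Qed.

Lemma barrier_arith (h a kap : R) :
  (2 * kap + 2 <= h /\ 0 <= a) \/ (0 <= h /\ kap + 1 <= a) -> 1 <= h + 2 * (a - kap).
Proof. by case=> -[]; lra. Qed.

Lemma identity_cst_arith (c b nf w2 z2 y2 A2 r1 r2 r3 i1 i2 i3 : R) :
  - nf <= r1 <= nf -> - nf <= r2 <= nf -> - nf <= r3 <= nf ->
  - nf <= i1 <= nf -> - nf <= i2 <= nf -> - nf <= i3 <= nf ->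
  - c * (z2 + y2 + w2) + 2 * A2 + (r1 + r2 + r3) = 0 ->
  b * (w2 - z2 - y2) + (i1 + i2 + i3) = 0 ->
  `|- c * (z2 + y2 + w2) + 2 * A2| <= 3 * nf /\ `|b * (w2 - z2 - y2)| <= 3 * nf.
Proof.
move: (- c * (z2 + y2 + w2) + 2 * A2) (b * (w2 - z2 - y2)) => X Y.
move=> /andP[p1 p2] /andP[p3 p4] /andP[p5 p6] /andP[p7 p8] /andP[p9 p10] /andP[p11 p12].
move=> /eqP; rewrite addr_eq0 => /eqP -> /eqP; rewrite addr_eq0 => /eqP ->.
by rewrite !normrN !ler_norml; split; apply/andP; split; lra.
Qed.

Lemma damped_arith (w z y A : R) : 0 <= A -> w + z + y <= z + y + w + 2 * A.
Proof. lra. Qed.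

Lemma equipartition_arith (w z y e : R) : - e <= w - z - y -> w + z + y <= 2 * w + e.
Proof. lra. Qed.

(** Young's inequality. As [D^2 = 1 / (32 (kap + 1))], one has [D^2 kap <= 1/32], and both
    contributions in [n^2] are at most [n^2 / 16]. *)
Lemma damping_arith (kap D n f An wn : R) : 0 <= kap -> 0 <= n -> 0 <= f -> 0 <= D -> 0 <= An ->
  wn <= n -> D ^+ 2 * (32 * (kap + 1)) = 1 -> 2 * An ^+ 2 <= kap * n ^+ 2 + 3 * (n * f) ->
  D * (wn * An) <= 8^-1 * n ^+ 2 + n * f.
Proof.
move=> k0 n0 f0 D0 A0 wnn DA h.
apply: (@le_trans _ _ (D * (n * An))).
  by apply: ler_wpM2l => //; exact: ler_wpM2r.
have nf0 : 0 <= n * f by rewrite mulr_ge0.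
have n20 : 0 <= n ^+ 2 := sqr_ge0 _.
have s := sqr_ge0 (4^-1 * n - 2 * D * An).
have D20 : 0 <= D ^+ 2 := sqr_ge0 _.
have h' := ler_wpM2l D20 h.
have d1 : D ^+ 2 * kap <= 32^-1 by lra.
have d2 : D ^+ 2 <= 32^-1.
  have : 0 <= D ^+ 2 * kap by rewrite mulr_ge0.
  by lra.
have e1 := ler_wpM2r n20 d1; have e2 := ler_wpM2r nf0 d2.
have E1 : (4^-1 * n - 2 * D * An) ^+ 2 = 16^-1 * n ^+ 2 - D * (n * An) + 2 * (D ^+ 2 * (2 * An ^+ 2)) by field.
have E2 : D ^+ 2 * (kap * n ^+ 2 + 3 * (n * f)) = D ^+ 2 * kap * n ^+ 2 + 3 * (D ^+ 2 * (n * f)) by ring.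
rewrite E1 in s; rewrite E2 in h'.
move: (D * (n * An)) (D ^+ 2 * (2 * An ^+ 2)) (D ^+ 2 * kap * n ^+ 2) (D ^+ 2 * (n * f)) s h' e1 e2.
move: (n * f) nf0 (n ^+ 2) n20; clear => nf nf0 n2 n20 *; lra.
Qed.

(** The shares of [n2] on the right add up to [2 (1/32 + 1/32 + 1/8) = 3/8], the second 1/32 being
    [C / b]. The coefficient of [n f] is [2 C + 2 + 3]; dividing by [1 - 3/8] costs less than a
    factor 2. *)
Lemma a_priori_arith (n f n2 b w2 chi out C : R) : 0 <= n -> 0 <= f -> 0 < C -> 32 * C <= b ->
  n2 = n ^+ 2 -> n2 <= 2 * w2 + 3 * (n * f) -> w2 = chi + out ->
  chi <= 32^-1 * n2 + C * (n2 / b + n * f) -> out <= 8^-1 * n2 + n * f ->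
  n <= (2 * (2 * C + 5)) * f.
Proof.
move=> n0 f0 C0 Cb En h1 h2 h3 h4.
have b0 : 0 < b by apply: lt_le_trans Cb; rewrite mulr_gt0.
have n20 : 0 <= n2 by rewrite En sqr_ge0.
have h5 : C * (n2 / b) <= 32^-1 * n2.
  rewrite mulrA ler_pdivrMr// [_ * b]mulrAC ler_wpM2r//; lra.
have h6 : n * n <= n * ((2 * (2 * C + 5)) * f).
  rewrite -expr2 -En [n * (_ * f)]mulrCA.
  have C1 : 0 <= C * (n * f) by rewrite !mulr_ge0// ltW.
  have nf0 : 0 <= n * f by rewrite mulr_ge0.
  move: h3; rewrite mulrDr; move: (C * (n2 / b)) h5 => t h5.
  have -> : 2 * (2 * C + 5) * (n * f) = 4 * (C * (n * f)) + 10 * (n * f) by ring.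
  move: (C * (n * f)) C1 (n * f) nf0 h1 h4; move=> t' C1 nf nf0 h1 h4 h3; lra.
have [->|n1] := eqVneq n 0; first by rewrite !mulr_ge0// addr_ge0// mulr_ge0// ltW.
by rewrite -(ler_pM2l (_ : 0 < n))// lt_neqAle eq_sym n1.
Qed.

End arithmetic.

(** * Interior and exterior estimates combined *)

Section global_estimate.
Context {R : realType}.
Variables a q : R -> R.
Hypotheses (sa : smooth a) (sq : smooth q).
Hypotheses (a0 : forall x, 0 <= a x) (q0 : forall x, 0 <= q x).
Hypotheses (a_pinfty : a x @[x --> +oo] --> +oo) (a_ninfty : a x @[x --> -oo] --> +oo).
Local Opaque L2_ip smooth.
Let P := @L2_is_ip R.
Local Notation bdd := bounded_multiplier.
Implicit Types (w : DS a q) (z y g u v : L2 R).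

Lemma damping_large (A : R) : exists2 r : R, 0 < r & forall x, r <= `|x| -> A <= a x.
Proof.
have /cvgryPge/(_ A)[M [_ hM]] := a_pinfty.
have /cvgryPge/(_ A)[M' [_ hM']] := a_ninfty.
exists (`|M| + `|M'| + 1); first by rewrite ltr_wpDl// addr_ge0.
have l1 := ler_norm M; have l2 := ler_norm (- M'); rewrite normrN in l2.
have n1 := normr_ge0 M; have n2 := normr_ge0 M'.
move: (`|M|) (`|M'|) l1 l2 n1 n2 => p p' l1 l2 n1 n2.
move=> x; case: (ger0P x) => x0 h; [apply: hM|apply: hM'] => /=; lra.
Qed.

Lemma common_bound7 (f1 f2 f3 f4 f5 f6 f7 : R -> R) (L : R) :
  [/\ continuous f1, continuous f2, continuous f3 & continuous f4] ->
  [/\ continuous f5, continuous f6 & continuous f7] ->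
  (forall x, L <= `|x| -> [/\ f1 x = 0, f2 x = 0, f3 x = 0 & f4 x = 0] /\
     [/\ f5 x = 0, f6 x = 0 & f7 x = 0]) ->
  exists2 K : R, 0 < K & [/\ forall x, `|f1 x| <= K, forall x, `|f2 x| <= K,
    forall x, `|f3 x| <= K & forall x, `|f4 x| <= K] /\
    [/\ forall x, `|f5 x| <= K, forall x, `|f6 x| <= K & forall x, `|f7 x| <= K].
Proof.
move=> [c1 c2 c3 c4] [c5 c6 c7] z.
have B (f : R -> R) : continuous f -> (forall x, L <= `|x| -> f x = 0) ->
    exists2 C : R, 0 < C & forall x, `|f x| <= C.
  by move=> cf f0; apply: (@continuous_bounded_outside _ _ L 0 cf) => x /f0 ->; rewrite normr0.
have [K1 k1 b1] := B _ c1 (fun x h => let: conj (And4 e _ _ _) _ := z x h in e).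
have [K2 k2 b2] := B _ c2 (fun x h => let: conj (And4 _ e _ _) _ := z x h in e).
have [K3 k3 b3] := B _ c3 (fun x h => let: conj (And4 _ _ e _) _ := z x h in e).
have [K4 k4 b4] := B _ c4 (fun x h => let: conj (And4 _ _ _ e) _ := z x h in e).
have [K5 k5 b5] := B _ c5 (fun x h => let: conj _ (And3 e _ _) := z x h in e).
have [K6 k6 b6] := B _ c6 (fun x h => let: conj _ (And3 _ e _) := z x h in e).
have [K7 k7 b7] := B _ c7 (fun x h => let: conj _ (And3 _ _ e) := z x h in e).
exists (K1 + K2 + K3 + K4 + K5 + K6 + K7); first by rewrite !addr_gt0.
by split; split=> x; [apply: le_trans (b1 x) _|apply: le_trans (b2 x) _|
  apply: le_trans (b3 x) _|apply: le_trans (b4 x) _|apply: le_trans (b5 x) _|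
  apply: le_trans (b6 x) _|apply: le_trans (b7 x) _]; lra.
Qed.

(** The seven functions to be bounded are continuous with compact support and depend on [m], [a] and
    [q] only, so that [K] is uniform in [kap], [c], [b] and the solution. *)
Lemma transport_bound (m : R -> R) (L : R) : smooth m -> (forall x, L <= `|x| -> m x = 0) ->
  exists2 K : R, 0 < K & forall kap c b w z y F1 F3 g (n f : R),
  wave_data kap c b w z y F1 F3 g n f ->
  let rho s x := m^`()%classic x + (s * (2 * (m x * a x)) + s * (- (2 * c)) * m x) in
  `|complex.Re (wip (rho 1) (DS_val w + z) (DS_val w + z))| <= (20 + 2 * kap) * K * wave_error b n f /\
  `|complex.Re (wip (rho (-1)) (DS_val w - z) (DS_val w - z))| <= (20 + 2 * kap) * K * wave_error b n f.
Proof.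
move=> sm m0.
have csq := continuous_sqrt sq.
have sma : smooth (fun x => m x * a x) by exact: smoothM sm sa.
have ma0 x : L <= `|x| -> m x * a x = 0 by move=> /m0 ->; rewrite mul0r.
have mL x : L + 1 <= `|x| -> m x = 0 by move=> h; apply: m0; apply: le_trans h; rewrite lerDl.
have maL x : L + 1 <= `|x| -> m x * a x = 0 by move=> /mL ->; rewrite mul0r.
have mqL x : L + 1 <= `|x| -> [/\ m x * Num.sqrt (q x) = 0, m x * a x * Num.sqrt (q x) = 0 &
    m x * Num.sqrt (q x) * Num.sqrt (q x) = 0] by move=> /mL ->; rewrite !mul0r.
have cM (f g : R -> R) : continuous f -> continuous g -> continuous (fun x => f x * g x).
  by move=> cf cg x; have h : {for x, continuous (f \* g)} by apply: continuousM; [exact: cf|exact: cg].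
have cm : continuous m := smooth_continuous sm.
have cma : continuous (fun x => m x * a x) := smooth_continuous sma.
have cm' : continuous m^`()%classic := smooth_continuous (smooth_derive sm).
have cma' : continuous (fun x => m x * a x)^`()%classic := smooth_continuous (smooth_derive sma).
have [K K0 [[k1 k2 k3 k4] [k5 k6 k7]]] := @common_bound7 _ _ _ _ _ _ _ (L + 1)
  (And4 cm cm' cma cma') (And3 (cM _ _ cm csq) (cM _ _ cma csq) (cM _ _ (cM _ _ cm csq) csq))
  (fun x h => conj (And4 (mL x h) (smooth_supp_derive sm m0 h) (maL x h)
     (smooth_supp_derive sma ma0 h)) (mqL x h)).
exists K => // kap c b w z y F1 F3 g n f H.
exact: (transport_estimate sa sq a0 q0 H sm m0 k1 k2 k3 k4 k5 k6 k7).
Qed.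

Lemma interior_estimate (kap eta r : R) : 0 <= kap -> 0 < eta -> 0 < r ->
  exists2 chi : R -> R, smooth chi & exists N C : R, [/\ r <= N /\ 0 < C,
    forall x, 0 <= chi x <= 1, forall x, `|x| <= N -> chi x = 1,
    forall x, 2 * N <= `|x| -> chi x = 0 &
    forall c b w z y F1 F3 g (n f : R), wave_data kap c b w z y F1 F3 g n f ->
    complex.Re (wip chi w w) <= eta * n ^+ 2 + C * wave_error b n f].
Proof.
move=> kap0 eta0 r0.
(* For [|x| <= r1] the slope [2 kap + 2] of the barrier outweighs [- 2 kap]; beyond, [a >= kap + 1]
   does. *)
have [r1 r10 ar1] := damping_large (kap + 1).
have L0 : 0 < 2 * kap + 2 by rewrite ltr_wpDl// mulr_ge0.
have [h sh [h0 h1 [H H0 hH]]] := smooth_barrier r10 L0.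
have [kp kp0 cut] := @smooth_cutoff R.
(* Chosen so that [4 e^(2 H) kp / N <= eta]. This is possible because [H] comes from the barrier
   alone and does not depend on [N]. *)
pose N := r + 4 * expR H ^+ 2 * kp / eta.
have N0 : 0 < N by rewrite /N ltr_pwDl// divr_ge0 ?(ltW eta0)// !mulr_ge0 ?sqr_ge0// ltW.
have [chi sc [c01 c1 c0 c']] := cut N N0.
exists chi => //.
pose m s x := expR (s * h x) * chi x.
have she s : smooth (fun x => expR (s * h x)) by apply: smooth_exp_comp; exact: smoothZ.
have sm s : smooth (m s) by exact: smoothM (she s) sc.
have m0 s x : 2 * N <= `|x| -> m s x = 0 by move=> /c0; rewrite /m => ->; rewrite mulr0.
have m' s x : (m s)^`()%classic x = s * h^`()%classic x * expR (s * h x) * chi x +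
    expR (s * h x) * chi^`()%classic x.
  apply: derive1_is; have d1 := smooth_is_derive x sh; have d2 := smooth_is_derive x sc.
  have d3 : is_derive x 1 (fun x => s * h x) (s * h^`()%classic x).
    apply: is_derive_ext (is_deriveZ s d1) _ _ => //.
  have d4 : is_derive x 1 (fun x => expR (s * h x)) (s * h^`()%classic x * expR (s * h x)).
    have := @is_derive1_comp _ expR (fun x => s * h x) x _ _ (is_derive_expR _) d3.
    by move=> d; apply: is_derive_ext d _ _ => //; exact: mulrC.
  apply: is_derive_ext (is_deriveM d4 d2) _ _ => //.
  by rewrite /GRing.scale /= addrC [chi x * _]mulrC.
have [K1 K10 T1] := transport_bound (sm 1) (m0 1).
have [K2 K20 T2] := transport_bound (sm (-1)) (m0 (-1)).
have eH := expR_gt0 H.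
exists N, (expR H * ((20 + 2 * kap) * (K1 + K2))); split=> //; first split.
- by rewrite /N lerDl divr_ge0 ?(ltW eta0)// !mulr_ge0 ?sqr_ge0// ltW.
- apply: mulr_gt0 => //; apply: mulr_gt0; last exact: addr_gt0.
  by rewrite ltr_pwDl// mulr_ge0.
move=> c b w z y F1 F3 g n f D.
have [E1 _] := T1 _ _ _ _ _ _ _ _ _ _ _ D; have [_ E2] := T2 _ _ _ _ _ _ _ _ _ _ _ D.
have bchi : bdd chi := bdd_continuous_supp (smooth_continuous sc) c0.
have brho s : bdd (fun x => (m s)^`()%classic x + (s * (2 * (m s x * a x)) + s * (- (2 * c)) * m s x)).
  apply: bddD; first exact: bdd_continuous_supp (smooth_continuous (smooth_derive (sm s))) (smooth_supp_derive (sm s) (m0 s)).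
  apply: bddD.
    apply: bddM (bdd_cst _) (bddM (bdd_cst _) _).
    exact: bdd_smooth_supp (sm s) (smooth_continuous sa) (m0 s).
  by apply: bddM (bdd_cst _) _; exact: bdd_continuous_supp (smooth_continuous (sm s)) (m0 s).
have kN0 : 0 <= kp / N by rewrite divr_ge0// ltW.
have L x : 1 <= h^`()%classic x + 2 * (a x - kap).
  apply: barrier_arith; have [xr|/ltW xr] := lerP `|x| r1; first by left; split; [exact: h1|].
  by right; split; [exact: h0|exact: ar1].
have key s u (B : R) : `|s| = 1 ->
    `|complex.Re (wip (fun x => (m s)^`()%classic x + (s * (2 * (m s x * a x)) + s * (- (2 * c)) * m s x)) u u)| <= B ->
    expR (- H) * complex.Re (wip chi u u) - expR H * (kp / N) * L2_norm u ^+ 2 <= B.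
  move=> s1 sB.
  have bl : bdd (fun x => expR (- H) * chi x + - (expR H * (kp / N))).
    exact: bddD (bddM (bdd_cst _) bchi) (bdd_cst _).
  have := @wip_mono R (fun x => expR (- H) * chi x + - (expR H * (kp / N)))
    (fun x => s * ((m s)^`()%classic x + (s * (2 * (m s x * a x)) + s * (- (2 * c)) * m s x))) u
    bl (bddM (bdd_cst s) (brho s)).
  rewrite (wipZm s _ _ (brho s)) (wipDm _ _ (bddM (bdd_cst _) bchi) (bdd_cst _)) (wipZm _ _ _ bchi).
  rewrite wip_cst cReD !cReZ (sqr_ipnorm P) mulNr => h2; apply: le_trans (h2 _) _.
    move=> x; rewrite m'; exact: (interior_weight (wave_c D) s1 (c01 x) (c' x) (hH x) kN0 (L x)).
  apply: le_trans (ler_norm _) _; rewrite normrM s1 mul1r; exact: sB.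
have k1 := key 1 _ _ (normr1 _) E1.
have k2 := key (-1) _ _ (etrans (normrN1 _) erefl) E2.
have nw : L2_norm (DS_val w) <= n := wave_w_le D.
have nz : L2_norm z <= n := wave_z_le D.
have par := parallelogram P (DS_val w) z.
have D1 := Re_wip_sqrD w z bchi; have D2 := Re_wip_sqrB w z bchi.
have pz := wip_ge0 z bchi (fun x => (andP (c01 x)).1).
have e1 : expR (- H) * expR H = 1 by rewrite expRN mulVf// expR_eq0.
have NE : 4 * expR H ^+ 2 * (kp / N) <= eta.
  rewrite mulrA ler_pdivrMr// /N mulrDr [eta * (_ / _)]mulrC divfK ?gt_eqF//.
  by rewrite lerDr mulr_ge0 ?ltW.
have s1 : L2_norm (DS_val w) ^+ 2 <= n ^+ 2 by rewrite ler_sqr ?nnegrE ?(ipnorm_ge0)//; exact: le_trans (ipnorm_ge0 _ _) nw.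
have s2 : L2_norm z ^+ 2 <= n ^+ 2 by rewrite ler_sqr ?nnegrE ?(ipnorm_ge0)//; exact: le_trans (ipnorm_ge0 _ _) nz.
have E0 := error_ge0 D.
rewrite D1 in k1; rewrite D2 in k2.
have n2 := sqr_ge0 n.
exact: (interior_arith kap0 kN0 eH K10 K20 k1 k2 par pz e1 NE s1 s2 E0 n2).
Qed.

(** Write [1 - chi = nu sqrt a] with [nu] at most [1 / sqrt A]: one factor [w] is traded for
    [sqrt a w], which the damping controls. *)
Lemma exterior_estimate (A N : R) (chi : R -> R) w : 0 < A ->
  (forall x, N <= `|x| -> A <= a x) -> smooth chi -> (forall x, 0 <= chi x <= 1) ->
  (forall x, `|x| <= N -> chi x = 1) ->
  complex.Re (wip (fun x => 1 - chi x) w w) <= (Num.sqrt A)^-1 * (L2_norm w * L2_norm (dsA w)).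
Proof.
move=> A0 aA sc c01 c1.
(* The maximum keeps the denominator away from 0 on [|x| <= N], where [1 - chi] vanishes; elsewhere
   it is [sqrt a]. *)
pose d x := Num.max (Num.sqrt A) (Num.sqrt (a x)).
have sA : 0 < Num.sqrt A by rewrite sqrtr_gt0.
have dA x : Num.sqrt A <= d x by rewrite /d le_max lexx.
have d0 x : 0 < d x := lt_le_trans sA (dA x).
pose nu x := (1 - chi x) * (d x)^-1.
have c1c : continuous (fun x => 1 - chi x) := smooth_continuous (smoothB (@smooth_cst R 1) sc).
have cd : continuous d.
  move=> x; apply: (@continuous_max _ _ (fun=> Num.sqrt A) (fun x => Num.sqrt (a x)) x).
    exact: cst_continuous.
  exact: (continuous_sqrt sa).
have cn : continuous nu.
  move=> x; apply: (@continuousM _ _ (fun x => 1 - chi x) (fun x => (d x)^-1)).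
    exact: c1c.
  by apply: (@continuousV _ _ d x); [rewrite gt_eqF|exact: cd].
have nuA x : `|nu x| <= (Num.sqrt A)^-1.
  have /andP[l1 l2] := c01 x.
  rewrite /nu normrM ger0_norm ?subr_ge0// ger0_norm ?invr_ge0 ?(ltW (d0 x))//.
  apply: (@le_trans _ _ (1 * (d x)^-1)).
    by apply: ler_wpM2r; [rewrite invr_ge0 ltW|rewrite gerBl].
  by rewrite mul1r lef_pV2 ?posrE.
have bn : bdd nu by split; [exact: continuous_measurable_fun|exists (Num.sqrt A)^-1].
have E : (fun x => nu x * Num.sqrt (a x)) = fun x => 1 - chi x.
  apply/funext => x; rewrite /nu; have [xN|/ltW xN] := lerP `|x| N.
    by rewrite c1// subrr !mul0r.
  rewrite /d max_r ?divfK//; first by rewrite gt_eqF// sqrtr_gt0 (lt_le_trans A0)// aA.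
  by rewrite ler_sqrt ?aA// (le_trans (ltW A0))// aA.
have bna : bdd (fun x => nu x * Num.sqrt (a x)).
  rewrite E; split; first exact: continuous_measurable_fun.
  by exists 1 => x; have /andP[l1 l2] := c01 x; rewrite ger0_norm ?subr_ge0// gerBl.
have := mulop_dsA w bn bna; rewrite E wipE => <-; rewrite -wipE.
apply: le_trans (ler_norm _) (le_trans (le_Re_cabs _) _).
exact: wip_le bn.1 nuA.
Qed.

(** The multiplier 1, which leaves no term in [m']. The first bound controls [sqrt a w], the second
    is the global equipartition of energy. *)
Lemma wave_identity_cst (c b : R) w z y F1 F3 g (n f : R) :
  wave_solution c b w z y F1 F3 g ->
  L2_norm w <= n -> L2_norm z <= n -> L2_norm y <= n ->
  L2_norm F1 <= f -> L2_norm F3 <= f -> L2_norm g <= f ->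
  `|- c * (L2_norm z ^+ 2 + L2_norm y ^+ 2 + L2_norm w ^+ 2) + 2 * L2_norm (dsA w) ^+ 2| <= 3 * (n * f) /\
  `|b * (L2_norm w ^+ 2 - L2_norm z ^+ 2 - L2_norm y ^+ 2)| <= 3 * (n * f).
Proof.
move=> sol wn zn yn F1n F3n gn.
have s1 : smooth (fun=> 1 : R) := @smooth_cst R 1.
have d1 : (fun=> 1 : R)^`()%classic = fun=> 0 by apply/funext => x; rewrite derive1_cst.
have b1 : bdd (fun=> 1 : R) := bdd_cst 1.
have b1' : bdd (fun=> 1 : R)^`()%classic by rewrite d1; exact: bdd_cst.
have e1 : cabs (wip (fun=> 1) z F1) <= n * f.
  by rewrite wip_cst mul1r; apply: le_trans (cauchy_schwarz P _ _) _; apply: ler_pM => //; exact: ipnorm_ge0.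
have e2 : cabs (wip (fun=> 1) y F3) <= n * f.
  by rewrite wip_cst mul1r; apply: le_trans (cauchy_schwarz P _ _) _; apply: ler_pM => //; exact: ipnorm_ge0.
have e3 : cabs (wip (fun=> 1) g w) <= n * f.
  rewrite wip_cst mul1r; apply: le_trans (cauchy_schwarz P _ _) _.
  by rewrite mulrC; apply: ler_pM => //; exact: ipnorm_ge0.
have s2 u : complex.Re (wip (fun=> 1) u u) = L2_norm u ^+ 2 by rewrite wip_cst mul1r (sqr_ipnorm P).
have dz : wip (fun=> 1 : R)^`()%classic z w = 0 by rewrite d1 wip_cst mul0r.
have I2 := wave_identity_w_Re sol s1 b1 b1'; have I1 := wave_identity_w_Im sol s1 b1 b1'.
rewrite dz !s2 in I2; rewrite dz !s2 in I1.
have I2' : - c * (L2_norm z ^+ 2 + L2_norm y ^+ 2 + L2_norm w ^+ 2) + 2 * L2_norm (dsA w) ^+ 2 +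
  (complex.Re (wip (fun=> 1) z F1) + complex.Re (wip (fun=> 1) y F3) + complex.Re (wip (fun=> 1) g w)) = 0.
  by rewrite mulNr -[RHS]I2 [complex.Re 0]/(0 : R) sub0r.
have I1' : b * (L2_norm w ^+ 2 - L2_norm z ^+ 2 - L2_norm y ^+ 2) +
  (complex.Im (wip (fun=> 1) z F1) + complex.Im (wip (fun=> 1) y F3) + complex.Im (wip (fun=> 1) g w)) = 0.
  by rewrite -[RHS]I1 [complex.Im 0]/(0 : R) add0r.
exact: (identity_cst_arith (bounds_Re e1) (bounds_Re e2) (bounds_Re e3) (bounds_Im e1) (bounds_Im e2) (bounds_Im e3) I2' I1').
Qed.

Lemma norm_le_of_sum (n x1 x2 x3 : R) : 0 <= n -> 0 <= x1 -> 0 <= x2 -> 0 <= x3 ->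
  n ^+ 2 = x1 ^+ 2 + x2 ^+ 2 + x3 ^+ 2 -> [/\ x1 <= n, x2 <= n & x3 <= n].
Proof.
move=> n0 h1 h2 h3 E.
by split; rewrite -ler_sqr ?nnegrE// E; [rewrite -addrA lerDl|rewrite addrAC lerDr|rewrite lerDr];
  rewrite addr_ge0 ?sqr_ge0.
Qed.

(** For [Re lambda = 1] the energy and the damping have the same sign in the real part, whatever
    [b]. The 3 counts the data terms. *)
Lemma a_priori_damped (b : R) w z y F1 F3 g (n f : R) : wave_solution (-1) b w z y F1 F3 g ->
  0 <= n -> n ^+ 2 = L2_norm w ^+ 2 + L2_norm z ^+ 2 + L2_norm y ^+ 2 ->
  L2_norm F1 <= f -> L2_norm F3 <= f -> L2_norm g <= f -> n <= 3 * f.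
Proof.
move=> sol n0 n2 F1f F3f gf.
have f0 : 0 <= f := le_trans (ipnorm_ge0 _ _) gf.
have ge (u : L2 R) : 0 <= L2_norm u := ipnorm_ge0 _ _.
have [l1 l2 l3] := norm_le_of_sum n0 (ge _) (ge _) (ge _) n2.
have [E _] := wave_identity_cst sol l1 l2 l3 F1f F3f gf.
have s4 := sqr_ge0 (L2_norm (dsA w)).
have {}E : n * n <= n * (3 * f).
  rewrite mulrCA; apply: le_trans E; apply: le_trans (ler_norm _).
  by rewrite opprK mul1r -expr2 n2; exact: damped_arith.
have [->|n1] := eqVneq n 0; first by rewrite mulr_ge0.
by rewrite -(ler_pM2l (_ : 0 < n))// lt_neqAle eq_sym n1.
Qed.

Lemma a_priori (kap : R) : 0 <= kap -> exists b0 M : R, [/\ 1 <= b0, 0 < M &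
  forall c b w z y F1 F3 g (n f : R), wave_data kap c b w z y F1 F3 g n f -> b0 <= `|b| ->
  n ^+ 2 = L2_norm w ^+ 2 + L2_norm z ^+ 2 + L2_norm y ^+ 2 -> n <= M * f].
Proof.
move=> k0; pose A : R := 32 * (kap + 1).
have A0 : 0 < A by rewrite mulr_gt0// ltr_wpDl.
have [r r0 ra] := damping_large A.
have e0 : (0 : R) < 32^-1 by rewrite invr_gt0.
have [chi sc [N [C [[rN C0] c01 c1 c0 int]]]] := interior_estimate k0 e0 r0.
exists (1 + 32 * C), (2 * (2 * C + 5)); split.
- by rewrite lerDl mulr_ge0// ltW.
- by rewrite mulr_gt0// addr_gt0// mulr_gt0.
move=> c b w z y F1 F3 g n f D b0 n2.
have n0 := n_ge0 D; have f0 := f_ge0 D.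
have h1 := int _ _ _ _ _ _ _ _ _ _ D.
have h2 := exterior_estimate w A0 (fun x h => ra x (le_trans rN h)) sc c01 c1.
have [ha hw] := wave_identity_cst (wave_sol D) (wave_w_le D) (wave_z_le D) (wave_y_le D)
  (wave_F1_le D) (wave_F3_le D) (wave_g_le D).
have bchi : bdd chi := bdd_continuous_supp (smooth_continuous sc) c0.
have ge (u : L2 R) : 0 <= L2_norm u := ipnorm_ge0 _ _.
have h3 : 2 * L2_norm (dsA w) ^+ 2 <= kap * n ^+ 2 + 3 * (n * f).
  have E : L2_norm z ^+ 2 + L2_norm y ^+ 2 + L2_norm w ^+ 2 = n ^+ 2 by rewrite n2 addrC addrA.
  have := le_trans (ler_norm _) ha; rewrite E mulNr addrC lerBlDl => h; apply: le_trans h _.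
  rewrite lerD2r ler_wpM2r ?sqr_ge0//; exact: le_trans (ler_norm _) (wave_c D).
have h4 : n ^+ 2 <= 2 * L2_norm w ^+ 2 + 3 * (n * f).
  have : `|L2_norm w ^+ 2 - L2_norm z ^+ 2 - L2_norm y ^+ 2| <= 3 * (n * f).
    apply: le_trans hw; rewrite normrM ler_peMl//; exact: wave_b D.
  rewrite n2 ler_norml => /andP[+ _].
  exact: equipartition_arith.
have h5 : L2_norm w ^+ 2 = complex.Re (wip chi w w) + complex.Re (wip (fun x => 1 - chi x) w w).
  rewrite -cReD -(wipDm _ _ bchi); last exact: bddD (bdd_cst 1) (bddN bchi).
  rewrite (_ : (fun x => _) = fun=> 1); first by rewrite wip_cst mul1r (sqr_ipnorm P).
  by apply/funext => x; rewrite addrC subrK.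
have h6 : (Num.sqrt A)^-1 ^+ 2 * (32 * (kap + 1)) = 1.
  by rewrite exprVn sqr_sqrtr ?(ltW A0)// mulVf// gt_eqF.
have sA0 : 0 <= (Num.sqrt A)^-1 by rewrite invr_ge0 sqrtr_ge0.
have h7 := le_trans h2 (damping_arith k0 n0 f0 sA0 (ge _) (wave_w_le D) h6 h3).
have h8 : 32 * C <= `|b| by apply: le_trans b0; rewrite lerDr.
exact: (a_priori_arith n0 f0 C0 h8 erefl h4 h5 h1 h7).
Qed.

End global_estimate.

(** * The energy space H1 and the generator *)

Section extension.
Context {R : realType} {V X Y : lmodType R[i]} (nX : X -> R) (nY : Y -> R) (j : V -> X).
Hypotheses (nXP : is_norm nX) (nYP : is_norm nY) (cY : cauchy_complete nY).
Hypotheses (jL : linear j) (jd : forall x e, 0 < e -> exists v, nX (j v - x) < e).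

Lemma lin_sub (Z W : lmodType R[i]) (T : Z -> W) : linear T -> forall x y, T (x - y) = T x - T y.
Proof. by move=> TL x y; rewrite addrC -scaleN1r TL scaleN1r addrC. Qed.

Lemma norm_subC (Z : lmodType R[i]) (n : Z -> R) : is_norm n -> forall x y, n (x - y) = n (y - x).
Proof. by move=> nP x y; rewrite -opprB (normN nP). Qed.

Lemma norm_tri3 (Z : lmodType R[i]) (n : Z -> R) : is_norm n ->
  forall x y z, n (x - z) <= n (x - y) + n (y - z).
Proof. by move=> nP x y z; have := norm_tri nP (x - y) (y - z); rewrite addrA subrK. Qed.

Lemma eps_le (x y k : R) : 0 <= k -> (forall e, 0 < e -> x <= y + k * e) -> x <= y.
Proof.
move=> k0 H; apply/ler_addgt0Pl => e e0; have k1 : 0 < k + 1 by rewrite ltr_wpDl.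
apply: le_trans (H (e / (k + 1)) (divr_gt0 e0 k1)) _; rewrite addrC lerD2r.
by rewrite mulrCA ler_piMr ?(ltW e0)// ler_pdivrMr// mul1r lerDl.
Qed.

Lemma bounded_extension (T0 : V -> Y) (M : R) : 0 <= M -> linear T0 ->
  (forall v, nY (T0 v) <= M * nX (j v)) ->
  exists T : X -> Y, [/\ linear T, forall x, nY (T x) <= M * nX x & forall v, T (j v) = T0 v].
Proof.
move=> M0 T0L T0b.
have app x : exists s : nat -> V, forall k, nX (j (s k) - x) < k.+1%:R^-1.
  have h k : exists v, nX (j v - x) < k.+1%:R^-1 by apply: jd; rewrite invr_gt0.
  by exists (fun k => projT1 (cid (h k))) => k; case: cid.
pose s x := projT1 (cid (app x)).
have sE x k : nX (j (s x k) - x) < k.+1%:R^-1 by rewrite /s; case: cid.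
have small e : 0 < e -> exists N, forall k, (N <= k)%N -> k.+1%:R^-1 < e :> R.
  move=> e0; have [N] := ltr_add_invr e0; rewrite add0r => HN; exists N => k Nk.
  by apply: le_lt_trans HN; rewrite lef_pV2 ?posrE// ler_nat.
have lip v v' x : nY (T0 v - T0 v') <= M * (nX (j v - x) + nX (j v' - x)).
  rewrite -(lin_sub T0L); apply: le_trans (T0b _) _; rewrite (lin_sub jL) ler_wpM2l//.
  by rewrite (norm_subC nXP (j v')); exact: norm_tri3.
have M1 : 0 < 2 * (M + 1) by rewrite mulr_gt0// ltr_wpDl.
have cau x : exists l, forall e, 0 < e -> exists N, forall i, (N <= i)%N -> nY (T0 (s x i) - l) < e.
  apply: cY => e e0; have [N HN] := small _ (divr_gt0 e0 M1); exists N => i i' Ni Ni'.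
  apply: le_lt_trans (lip _ _ x) _.
  have h := ltrD (lt_trans (sE x i) (HN i Ni)) (lt_trans (sE x i') (HN i' Ni')).
  apply: le_lt_trans (ler_wpM2l M0 (ltW h)) _.
  have M10 : 0 < M + 1 by rewrite ltr_wpDl.
  have -> : M * (e / (2 * (M + 1)) + e / (2 * (M + 1))) = e * (M / (M + 1)) by field; rewrite gt_eqF.
  by rewrite gtr_pMr// ltr_pdivrMr// mul1r ltrDl.
pose T x := projT1 (cid (cau x)).
have TE x : forall e, 0 < e -> exists N, forall i, (N <= i)%N -> nY (T0 (s x i) - T x) < e.
  by rewrite /T; case: cid.
(* This estimate frees [T x] from the sequence chosen to define it: linearity, the bound and the
   values on [j v] all follow from it. *)
have key x v : nY (T0 v - T x) <= M * nX (j v - x).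
  apply: (@eps_le _ _ (M + 1)); first by rewrite addr_ge0.
  move=> e e0; have [N1 H1] := TE x e e0; have [N2 H2] := small e e0.
  pose k := maxn N1 N2.
  have h1 := H1 k (leq_maxl _ _); have h2 := lt_trans (sE x k) (H2 k (leq_maxr _ _)).
  apply: le_trans (norm_tri3 nYP _ (T0 (s x k)) _) _.
  have l := le_trans (lip v (s x k) x) (ler_wpM2l M0 (lerD (lexx _) (ltW h2))).
  by apply: le_trans (lerD l (ltW h1)) _; rewrite mulrDr mulrDl mul1r addrA.
have nz x y : nY (x - y) <= 0 -> x = y.
  move=> h; apply/eqP; rewrite -subr_eq0; apply/eqP/(norm_eq0 nYP)/eqP.
  by rewrite eq_le h (norm_pos nYP).
have Tj v : T (j v) = T0 v.
  by apply/esym/nz; apply: le_trans (key (j v) v) _; rewrite subrr (norm0 nXP) mulr0.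
exists T; split => // [c x y|x].
  apply: nz; apply: (@eps_le _ _ (M * (2 * (cabs c + 1)))).
    by rewrite mulr_ge0// mulr_ge0// addr_ge0 ?cabs_ge0.
  move=> e e0; rewrite add0r.
  have [v hv] := jd x e0; have [u hu] := jd y e0.
  have h1 : nX (j (c *: v + u) - (c *: x + y)) <= (cabs c + 1) * e.
    rewrite jL opprD addrACA -scalerBr mulrDl mul1r; apply: le_trans (norm_tri nXP _ _) _.
    by rewrite (norm_scale nXP); apply: lerD (ltW hu); rewrite ler_wpM2l ?cabs_ge0// ltW.
  have h2 : nY (T0 (c *: v + u) - (c *: T x + T y)) <= M * ((cabs c + 1) * e).
    rewrite T0L opprD addrACA -scalerBr; apply: le_trans (norm_tri nYP _ _) _.
    rewrite (norm_scale nYP) mulrDl mul1r mulrDr; apply: lerD.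
      rewrite mulrCA ler_wpM2l ?cabs_ge0//; apply: le_trans (key _ _) _.
      by rewrite ler_wpM2l// ltW.
    by apply: le_trans (key _ _) _; rewrite ler_wpM2l// ltW.
  apply: le_trans (norm_tri3 nYP _ (T0 (c *: v + u)) _) _.
  rewrite (norm_subC nYP); apply: le_trans (lerD (le_trans (key _ _) (ler_wpM2l M0 h1)) h2) _.
  by rewrite -mulr2n -mulr_natl; lra.
apply: (@eps_le _ _ (2 * M)); first by rewrite mulr_ge0.
move=> e e0; have [v hv] := jd x e0.
have h1 : nY (T x) <= nY (T0 v) + M * nX (j v - x).
  have := norm_tri nYP (T x - T0 v) (T0 v); rewrite subrK addrC => h; apply: le_trans h _.
  by rewrite lerD2l (norm_subC nYP) key.
have h2 : nX (j v) <= nX x + e.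
  have := norm_tri nXP (j v - x) x; rewrite subrK addrC => h; apply: le_trans h _.
  by rewrite lerD2l ltW.
apply: le_trans h1 _; apply: le_trans (lerD (le_trans (T0b v) (ler_wpM2l M0 h2)) (ler_wpM2l M0 (ltW hv))) _.
by rewrite mulrDr; lra.
Qed.

Lemma bounded_extension_unique (T T' : X -> Y) (M M' : R) : linear T -> linear T' ->
  (forall x, nY (T x) <= M * nX x) -> (forall x, nY (T' x) <= M' * nX x) ->
  (forall v, T (j v) = T' (j v)) -> forall x, T x = T' x.
Proof.
move=> TL TL' Tb Tb' E x; apply/eqP; rewrite -subr_eq0; apply/eqP/(norm_eq0 nYP)/eqP.
rewrite eq_le (norm_pos nYP) andbT; apply: (@eps_le _ _ (`|M| + `|M'|)); first exact: addr_ge0.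
move=> e e0; rewrite add0r; have [v hv] := jd x e0.
have -> : T x - T' x = (T (x - j v) - T' (x - j v)) by rewrite (lin_sub TL) (lin_sub TL') E opprB addrA subrK.
have b (S : X -> Y) (m : R) : (forall x, nY (S x) <= m * nX x) -> nY (S (x - j v)) <= `|m| * e.
  move=> Sb; apply: le_trans (Sb _) _; apply: le_trans (ler_wpM2r (norm_pos nXP _) (ler_norm m)) _.
  by rewrite ler_wpM2l// (norm_subC nXP) ltW.
apply: le_trans (norm_tri nYP _ _) _; rewrite (normN nYP) mulrDl; apply: lerD; exact: b.
Qed.

End extension.

(** * The energy space and the extended operators *)

Section energy_space.
Context {R : realType}.
Variables a q : R -> R.
Hypotheses (sa : smooth a) (sq : smooth q).
Hypotheses (a0 : forall x, 0 <= a x) (q0 : forall x, 0 <= q x).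
Variables (H1 : completeNormedModType R[i]) (iota : {linear test R -> H1}).
Hypothesis H1_completion : completion_of (W_norm q) iota.
Local Opaque L2_ip smooth.
Let P := @L2_is_ip R.
Implicit Types (f g phi : test R) (u : H1).
Local Notation nH := (@H1_norm R H1).
Local Notation sqq := (fun x => Num.sqrt (q x)).
Local Notation sqa := (fun x => Num.sqrt (a x)).

Lemma H1_normC u : `|u| = (nH u)%:C.
Proof. by rewrite /H1_norm RRe_real// normr_real. Qed.

Lemma H1_is_norm : is_norm nH.
Proof.
split=> [u v|c u|u u0].
- by rewrite -lecR rmorphD /= -!H1_normC ler_normD.
- by apply: complexI; rewrite rmorphM /= -!H1_normC normrZ cabsC.
- by apply/eqP; rewrite -normr_eq0 H1_normC u0.
Qed.

Lemma H1_complete : cauchy_complete nH.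
Proof.
move=> u Hu.
have cu : cvgn u.
  apply/cauchy_cvgP/cauchy_ballP => e; rewrite ltcE /= => /andP[/eqP ei e0].
  have [N HN] := Hu _ e0.
  exists ([set u i | i in [set i | (N <= i)%N]], [set u i | i in [set i | (N <= i)%N]]).
    by split; exists N => // i Ni; exists i.
  move=> [_ _] /= [[i Ni <-] [j Nj <-]]; rewrite -ball_normE /=.
  rewrite H1_normC (_ : e = (complex.Re e)%:C); last by apply: complexP.
  by rewrite ltcR; exact: HN.
exists (lim (u @ \oo)) => e e0.
have /cvgrPdist_lt/(_ e%:C) := cu; rewrite ltcR => /(_ e0)[N _ HN].
exists N => i Ni; rewrite (norm_subC H1_is_norm) -ltcR -H1_normC; exact: HN.
Qed.

Lemma iota_dense u e : 0 < e -> exists f, nH (iota f - u) < e.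
Proof.
move=> e0; have [_ den] := H1_completion.
have b0 : ball u e%:C !=set0 by exists u; apply: ballxx; rewrite ltcR.
have [v [h [f _ fv]]] := den _ b0 (ball_open _ _).
exists f; rewrite fv.
by move: h; rewrite -ball_normE /= H1_normC ltcR (norm_subC H1_is_norm).
Qed.

Lemma iota_linear : linear iota.
Proof. exact: linearP. Qed.

Lemma L2_is_norm : is_norm (@L2_norm R).
Proof.
split=> [u v|c u|u]; [exact: ipnormD P _ _|exact: ipnormZ P _ _|exact: L2_norm_eq0].
Qed.

Lemma weight_integral_test (m : R -> R) f g : smooth m -> (forall x, 0 <= m x) ->
  weight_integral m f g = L2_ip (mulop (fun x => Num.sqrt (m x)) (test_L2 f))
    (mulop (fun x => Num.sqrt (m x)) (test_L2 g)).
Proof.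
move=> sm m0; have cm := continuous_sqrt sm.
rewrite (L2_ip_eq (mul_test_L2fun f cm) (mul_test_L2fun g cm)).
- congr cintegral; apply/funext => x.
  rewrite -{1}(sqr_sqrtr (m0 x)); move: (Num.sqrt (m x)) => k.
  by apply: complexP; rewrite !(cReZ, cImZ, cReIm, expr2) /=; ring.
- by apply: ae_imply2 (mulopP (mul_dom_test f cm)) (repr_test_L2 f) => x -> ->.
- by apply: ae_imply2 (mulopP (mul_dom_test g cm)) (repr_test_L2 g) => x -> ->.
Qed.

Lemma W_ipE f g : W_ip q f g = L2_ip (test_L2 (test_derive f)) (test_L2 (test_derive g)) +
  L2_ip (mulop sqq (test_L2 f)) (mulop sqq (test_L2 g)).
Proof.
rewrite /W_ip (weight_integral_test _ _ sq q0); congr (_ + _).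
rewrite (L2_ip_eq (test_L2fun (test_derive f)) (test_L2fun (test_derive g)))//.
- exact: repr_test_L2.
- exact: repr_test_L2.
Qed.

Lemma H1_norm_iota f : nH (iota f) ^+ 2 =
  L2_norm (test_L2 (test_derive f)) ^+ 2 + L2_norm (mulop sqq (test_L2 f)) ^+ 2.
Proof.
have [iso _] := H1_completion; rewrite /H1_norm iso /= /W_norm W_ipE cReD -!(sqr_ipnorm P).
by rewrite sqr_sqrtr// addr_ge0// sqr_ge0.
Qed.

Lemma test_derive_L2_lin c f g : test_L2 (test_derive (c *: f + g)) =
  c *: test_L2 (test_derive f) + test_L2 (test_derive g).
Proof. by rewrite -!(dsD_test sa sq) (test_DS_lin sa sq) dsD_lin. Qed.

(** An element of the abstract completion [H1] is not given as a function, but its two energy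
    components are elements of [L2]. *)
Lemma H1_grad_exists : exists h : (H1 -> L2 R) * (H1 -> L2 R), [/\ linear h.1, linear h.2,
  forall u, L2_norm (h.1 u) <= nH u /\ L2_norm (h.2 u) <= nH u &
  forall f, h.1 (iota f) = test_L2 (test_derive f) /\ h.2 (iota f) = mulop sqq (test_L2 f)].
Proof.
have ge (u : L2 R) : 0 <= L2_norm u := ipnorm_ge0 _ _.
have ng := norm_pos H1_is_norm.
have [||hD [DL Db DE]] := @bounded_extension _ _ _ _ _ _ iota H1_is_norm L2_is_norm
  (@L2_complete R) iota_linear iota_dense (fun f => test_L2 (test_derive f)) 1 ler01.
- exact: test_derive_L2_lin.
- by move=> f; rewrite mul1r -ler_sqr ?nnegrE// H1_norm_iota lerDl sqr_ge0.
have [||hQ [QL Qb QE]] := @bounded_extension _ _ _ _ _ _ iota H1_is_norm L2_is_norm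
  (@L2_complete R) iota_linear iota_dense (fun f => mulop sqq (test_L2 f)) 1 ler01.
- move=> c f g; rewrite test_L2_lin mulop_lin//; exact: mul_dom_test (continuous_sqrt sq).
- by move=> f; rewrite mul1r -ler_sqr ?nnegrE// H1_norm_iota lerDr sqr_ge0.
exists (hD, hQ); split => // u; have := Db u; have := Qb u; rewrite !mul1r; by split.
Qed.

(* [hD u] and [hQ u] stand for u' and sqrt q u: the bounded extensions to H1 of
   f |-> f' and f |-> sqrt q f on test functions. *)
Definition hD := (projT1 (cid H1_grad_exists)).1.
Definition hQ := (projT1 (cid H1_grad_exists)).2.

Lemma H1_gradP : [/\ linear hD, linear hQ,
  forall u, L2_norm (hD u) <= nH u /\ L2_norm (hQ u) <= nH u &
  forall f, hD (iota f) = test_L2 (test_derive f) /\ hQ (iota f) = mulop sqq (test_L2 f)].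
Proof. exact: (projT2 (cid H1_grad_exists)). Qed.

Lemma hD_lin : linear hD. Proof. by case: H1_gradP. Qed.
Lemma hQ_lin : linear hQ. Proof. by case: H1_gradP. Qed.
Lemma hD_le u : L2_norm (hD u) <= nH u. Proof. by case: H1_gradP => _ _ /(_ u)[]. Qed.
Lemma hQ_le u : L2_norm (hQ u) <= nH u. Proof. by case: H1_gradP => _ _ /(_ u)[]. Qed.
Lemma hD_iota f : hD (iota f) = test_L2 (test_derive f).
Proof. by case: H1_gradP => _ _ _ /(_ f)[]. Qed.
Lemma hQ_iota f : hQ (iota f) = mulop sqq (test_L2 f).
Proof. by case: H1_gradP => _ _ _ /(_ f)[]. Qed.

Let ipH u v : R[i] := L2_ip (hD u) (hD v) + L2_ip (hQ u) (hQ v).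

Lemma ipH_is_ip : is_ip ipH.
Proof.
split=> [c u v w|u v|u].
- rewrite /ipH hD_lin hQ_lin (ip_lin P c (hD u)) (ip_lin P c (hQ u)).
  move: (L2_ip _ _) (L2_ip _ _) (L2_ip _ _) (L2_ip _ _) => x1 x2 x3 x4; ring.
- by rewrite /ipH rmorphD /= -!(ipC P).
- by rewrite /ipH cReD addr_ge0// ip_ge0.
Qed.

Lemma ipH_norm u : ipnorm ipH u ^+ 2 = L2_norm (hD u) ^+ 2 + L2_norm (hQ u) ^+ 2.
Proof. by rewrite (sqr_ipnorm ipH_is_ip) /ipH cReD -!(sqr_ipnorm P). Qed.

(** True on tests, and both sides are continuous. Hence [H1], given only as a normed space, is a
    Hilbert space whose elements are determined by [hD] and [hQ]. *)
Lemma H1_normE u : nH u ^+ 2 = L2_norm (hD u) ^+ 2 + L2_norm (hQ u) ^+ 2.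
Proof.
rewrite -ipH_norm; congr (_ ^+ 2).
have ng := norm_pos H1_is_norm; have pg v : 0 <= ipnorm ipH v := ipnorm_ge0 _ _.
have E f : nH (iota f) = ipnorm ipH (iota f).
  by apply/eqP; rewrite -(@eqrXn2 _ 2)// H1_norm_iota ipH_norm hD_iota hQ_iota.
have le2 v : ipnorm ipH v <= 2 * nH v.
  have h1 := hD_le v; have h2 := hQ_le v.
  have ge (u : L2 R) : 0 <= L2_norm u := ipnorm_ge0 _ _.
  rewrite -ler_sqr ?nnegrE// ?mulr_ge0// ipH_norm.
  have := ler_pM (ge _) (ge _) h1 h1; have := ler_pM (ge _) (ge _) h2 h2.
  rewrite -!expr2 exprMn => e1 e2; apply: le_trans (lerD e2 e1) _.
  by have := sqr_ge0 (nH v); move: (nH v ^+ 2) => x x0; lra.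
have close e : 0 < e -> `|nH u - ipnorm ipH u| <= 3 * e.
  move=> e0; have [f hf] := iota_dense u e0.
  have t1 := norm_tri H1_is_norm (iota f - u) u; rewrite subrK in t1.
  have t2 := norm_tri H1_is_norm (u - iota f) (iota f); rewrite subrK (norm_subC H1_is_norm) in t2.
  have t3 := ipnormD ipH_is_ip (iota f - u) u; rewrite subrK in t3.
  have t4 := ipnormD ipH_is_ip (u - iota f) (iota f); rewrite subrK (ipnormBC ipH_is_ip) in t4.
  have t5 := le2 (iota f - u); rewrite E in t1, t2.
  move: (nH (iota f - u)) (nH u) (ipnorm ipH u) (ipnorm ipH (iota f)) (ipnorm ipH (iota f - u)) hf t1 t2 t3 t4 t5.
  clear; move=> x1 x2 x3 x4 x5 *; rewrite ler_norml; apply/andP; split; lra.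
apply/eqP; rewrite -subr_eq0 -normr_eq0 eq_le normr_ge0 andbT.
by apply: (@eps_le _ _ _ 3) => // e /close; rewrite add0r.
Qed.

Lemma H1_eq u v : hD u = hD v -> hQ u = hQ v -> u = v.
Proof.
move=> h1 h2; apply/eqP; rewrite -subr_eq0; apply/eqP/(norm_eq0 H1_is_norm)/eqP.
rewrite -sqrf_eq0 H1_normE (lin_sub hD_lin) (lin_sub hQ_lin) h1 h2 !subrr.
by rewrite (norm0 L2_is_norm) expr0n addr0.
Qed.

Local Notation nDS := (ipnorm (@DSip R a q 1)).
Let P1 := @DSip_is_ip R a q 1 ler01.
Implicit Types (d psi : DS a q).

Lemma DS_is_norm : is_norm nDS.
Proof.
split=> [u v|c u|u u0]; [exact: ipnormD P1 _ _|exact: ipnormZ P1 _ _|].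
have [_ _ _ h] := DSnorm_ge u (lexx 1); rewrite u0 in h.
apply: DS_val_inj; apply: L2_norm_eq0; apply/eqP; rewrite eq_le h.
exact: (ipnorm_ge0 _ (DS_val u)).
Qed.

Lemma DSdual_lin (l : DSdual a q) c d psi : l (c *: d + psi) = c^*%C * l d + l psi.
Proof. by have /asboolP[h _] := DSdualP l. Qed.

Lemma DSdual_bound (l : DSdual a q) psi : cabs (l psi) <= DSdual_norm l * nDS psi.
Proof.
have /asboolP[lL [M lM]] := DSdualP l.
have {}lM d : cabs (l d) <= M * nDS d by rewrite -(DS_normE sa sq a0 q0) -lecR -cabsC.
have l0 : l 0 = 0.
  apply: cabs_eq0; apply/eqP; rewrite eq_le cabs_ge0 andbT.
  by apply: le_trans (lM 0) _; rewrite (norm0 DS_is_norm) mulr0.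
have [n0|n0] := eqVneq (nDS psi) 0.
  by rewrite (norm_eq0 DS_is_norm n0) l0 cabs0 (norm0 DS_is_norm) mulr0.
have np : 0 < nDS psi by rewrite lt_neqAle eq_sym n0 (norm_pos DS_is_norm).
pose e : DS a q := ((nDS psi)^-1)%:C *: psi.
have E : psi = (nDS psi)%:C *: e by rewrite scalerA -rmorphM /= divff// scale1r.
have ne : nDS e <= 1.
  by rewrite (norm_scale DS_is_norm) cabs_real ger0_norm ?invr_ge0 ?(norm_pos DS_is_norm)// mulVf.
have lZ : l psi = (nDS psi)%:C * l e.
  have := lL (nDS psi)%:C e 0; rewrite addr0 -E l0 addr0 => ->; by rewrite conjc_real.
rewrite lZ cabsM cabs_real ger0_norm ?(norm_pos DS_is_norm)// mulrC ler_wpM2r ?(norm_pos DS_is_norm)//.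
apply: ub_le_sup; last by exists e => //=; rewrite (DS_normE sa sq a0 q0).
exists `|M| => _ [d /= dn <-]; rewrite (DS_normE sa sq a0 q0) in dn.
apply: le_trans (lM d) _; apply: le_trans (ler_wpM2r (norm_pos DS_is_norm _) (ler_norm M)) _.
by rewrite ler_piMr.
Qed.

Lemma DSdual_norm_le (l : DSdual a q) (B : R) : 0 <= B ->
  (forall d, cabs (l d) <= B * nDS d) -> DSdual_norm l <= B.
Proof.
move=> B0 lB; apply: ge_sup.
  exists (cabs (l 0)), 0 => //=; rewrite (DS_normE sa sq a0 q0) (norm0 DS_is_norm)//.
move=> _ [d /= dn <-]; rewrite (DS_normE sa sq a0 q0) in dn.
by apply: le_trans (lB d) _; rewrite ler_piMr.
Qed.

Lemma DSdual_of (l : DS a q -> R[i]) (M : R) :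
  (forall c d e, l (c *: d + e) = c^*%C * l d + l e) ->
  (forall d, cabs (l d) <= M * nDS d) -> l \in @in_DSdual R a q.
Proof.
move=> lL lM; apply/asboolP; split => //.
by exists M => d; rewrite cabsC lecR (DS_normE sa sq a0 q0).
Qed.

(** Evaluation at [psi] reduces the claim to scalar-valued maps. Density is used twice: of the image
    of [j] in [X], and of tests in [DS]. *)
Lemma DSdual_linear_ext (X : lmodType R[i]) (nX : X -> R) (j : test R -> X) (T T' : X -> DSdual a q)
  (M M' : R) : is_norm nX -> linear j -> (forall x e, 0 < e -> exists v, nX (j v - x) < e) ->
  linear T -> linear T' -> (forall x, DSdual_norm (T x) <= M * nX x) ->
  (forall x, DSdual_norm (T' x) <= M' * nX x) ->
  (forall f g, T (j f) (test_DS a q g) = T' (j f) (test_DS a q g)) -> T = T'.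
Proof.
move=> nXP jL jd TL TL' Tb Tb' E; apply/funext => x; apply: val_inj; apply/funext => psi.
have Cn : is_norm (@cabs R).
  by split; [exact: cabsD|exact: cabsM|exact: cabs_eq0].
have lin (S : X -> DSdual a q) : linear S -> linear (fun x => S x psi : R[i]^o).
  by move=> SL c u v; rewrite SL.
have bd (S : X -> DSdual a q) (m : R) : (forall x, DSdual_norm (S x) <= m * nX x) ->
    forall x, cabs (S x psi) <= (m * nDS psi) * nX x.
  move=> Sb y; apply: le_trans (DSdual_bound _ _) _.
  by rewrite mulrAC; apply: ler_wpM2r => //; exact: (norm_pos DS_is_norm).
apply: (@bounded_extension_unique _ _ _ _ nX (@cabs R : R[i]^o -> R) j nXP Cn jd (fun x => T x psi) (fun x => T' x psi)
  _ _ (lin _ TL) (lin _ TL') (bd _ _ Tb) (bd _ _ Tb')).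
move=> v; suff h e : T (j v) e - T' (j v) e = 0 :> R[i].
  by apply/eqP; rewrite -subr_eq0; apply/eqP; exact: h.
move: e; apply: (@DS_ext0 _ _ _ sa sq (fun psi => T (j v) psi - T' (j v) psi) (DSdual_norm (T (j v)) + DSdual_norm (T' (j v)))).
- have B (l : DSdual a q) x1 x2 : l (x1 - x2) = l x1 - l x2.
    by rewrite addrC -scaleN1r DSdual_lin rmorphN1 mulN1r addrC.
  move=> x1 x2; rewrite !B; move: (T (j v) x1) (T (j v) x2) (T' (j v) x1) (T' (j v) x2).
  by move=> y1 y2 y3 y4; ring.
- move=> x1; apply: le_trans (cabsD _ _) _; rewrite cabsN mulrDl; apply: lerD; exact: DSdual_bound.
- by move=> g; rewrite E subrr.
Qed.

Lemma tests_linear : linear (@test_DS R a q).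
Proof. exact: test_DS_lin. Qed.

Lemma dsD_le d : L2_norm (dsD d) <= nDS d.
Proof. by have [h1 h2 h3 _] := DSnorm_ge d (lexx 1); exact: h1. Qed.
Lemma dsQ_le d : L2_norm (dsQ d) <= nDS d.
Proof. by have [h1 h2 h3 _] := DSnorm_ge d (lexx 1); exact: h2. Qed.
Lemma dsA_le d : L2_norm (dsA d) <= nDS d.
Proof. by have [h1 h2 h3 _] := DSnorm_ge d (lexx 1); exact: h3. Qed.

Lemma L2_ip_le (u v : L2 R) (x y : R) : L2_norm u <= x -> L2_norm v <= y ->
  cabs (L2_ip u v) <= x * y.
Proof.
move=> ux vy; apply: le_trans (cauchy_schwarz P _ _) _.
by apply: ler_pM => //; exact: ipnorm_ge0.
Qed.

Lemma L2_ip_linr c (u v : L2 R) (w : L2 R) : L2_ip w (c *: u + v) = c^*%C * L2_ip w u + L2_ip w v.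
Proof. by rewrite (ipDr P) (ipZr P). Qed.

(** The functional on the right satisfies the conditions that define [dxxq], so [xget] does not
    return its default value, and uniqueness of the extension identifies the two. [mul_a] and
    [DS_H1] are unfolded in the same way. *)
Lemma dxxqE u psi :
  dxxq a q iota u psi = - (L2_ip (hD u) (dsD psi) + L2_ip (hQ u) (dsQ psi)).
Proof.
pose l u psi := - (L2_ip (hD u) (dsD psi) + L2_ip (hQ u) (dsQ psi)).
have lL v c d e : l v (c *: d + e) = c^*%C * l v d + l v e.
  rewrite /l dsD_lin dsQ_lin !L2_ip_linr; move: (L2_ip _ _) (L2_ip _ _) (L2_ip _ _) (L2_ip _ _).
  by move=> x1 x2 x3 x4; ring.
have lM v d : cabs (l v d) <= (2 * nH v) * nDS d.
  rewrite cabsN; apply: le_trans (cabsD _ _) _; rewrite -mulrA mulr_natl mulr2n; apply: lerD.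
    exact: L2_ip_le (hD_le _) (dsD_le _).
  exact: L2_ip_le (hQ_le _) (dsQ_le _).
pose T v : DSdual a q := MkDSdual (DSdual_of (lL v) (lM v)).
have TL : linear T.
  move=> c v w; apply: val_inj; apply/funext => d /=; rewrite !fctE /= /l hD_lin hQ_lin.
  rewrite (ip_lin P c (hD v)) (ip_lin P c (hQ v)) /GRing.scale /=.
  by move: (L2_ip _ _) (L2_ip _ _) (L2_ip _ _) (L2_ip _ _) => x1 x2 x3 x4; ring.
have Tb v : DSdual_norm (T v) <= 2 * nH v.
  by apply: DSdual_norm_le; [rewrite mulr_ge0// (norm_pos H1_is_norm)|exact: lM].
have TE f g : T (iota f) (test_DS a q g) = - W_ip q f g.
  by rewrite /= /l hD_iota hQ_iota (dsD_test sa sq) (dsQ_test sa sq) W_ipE.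
have [[SL [M SM]] SE] : bounded_linear nH (@DSdual_norm R a q) (dxxq a q iota) /\
    forall f g, dxxq a q iota (iota f) (test_DS a q g) = - W_ip q f g.
  exact: (@xgetPex _ (fun=> 0) [set T : H1 -> DSdual a q |
    bounded_linear nH (@DSdual_norm R a q) T /\
    forall f g, T (iota f) (test_DS a q g) = - W_ip q f g]
    (ex_intro _ T (conj (conj TL (ex_intro _ 2 Tb)) TE))).
have -> : dxxq a q iota = T; last by [].
apply: (DSdual_linear_ext H1_is_norm iota_linear iota_dense SL TL SM Tb).
by move=> f g; rewrite SE TE.
Qed.

Lemma mul_aE d psi : mul_a d psi = L2_ip (dsA d) (dsA psi).
Proof.
pose l d psi : R[i] := L2_ip (dsA d) (dsA psi).
have lL v c d' e : l v (c *: d' + e) = c^*%C * l v d' + l v e.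
  by rewrite /l dsA_lin L2_ip_linr.
have lM v e : cabs (l v e) <= (1 * nDS v) * nDS e.
  rewrite mul1r; exact: L2_ip_le (dsA_le _) (dsA_le _).
pose T v : DSdual a q := MkDSdual (DSdual_of (lL v) (lM v)).
have TL : linear T.
  move=> c v w; apply: val_inj; apply/funext => e /=; rewrite !fctE /= /l dsA_lin.
  by rewrite (ip_lin P c (dsA v)).
have Tb v : DSdual_norm (T v) <= 1 * nDS v.
  by apply: DSdual_norm_le; [rewrite mul1r (norm_pos DS_is_norm)|exact: lM].
have TE f g : T (test_DS a q f) (test_DS a q g) = weight_integral a f g.
  by rewrite /= /l !(dsA_test sa sq) (weight_integral_test _ _ sa a0).
have dsn : @DS_norm R a q = nDS by apply/funext => e; exact: DS_normE.
have bT : bounded_linear (@DS_norm R a q) (@DSdual_norm R a q) T.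
  by split; [exact: TL|exists 1; rewrite dsn; exact: Tb].
have [[SL [M SM]] SE] : bounded_linear (@DS_norm R a q) (@DSdual_norm R a q) (@mul_a R a q) /\
    forall f g, mul_a (test_DS a q f) (test_DS a q g) = weight_integral a f g.
  exact: (@xgetPex _ (fun=> 0) [set T : DS a q -> DSdual a q |
    bounded_linear (@DS_norm R a q) (@DSdual_norm R a q) T /\
    forall f g, T (test_DS a q f) (test_DS a q g) = weight_integral a f g]
    (ex_intro _ T (conj bT TE))).
have -> : @mul_a R a q = T; last by [].
rewrite dsn in SM.
have E f g : @mul_a R a q (test_DS a q f) (test_DS a q g) = T (test_DS a q f) (test_DS a q g).
  by rewrite SE TE.
exact: (@DSdual_linear_ext (DS a q) nDS (@test_DS R a q) (@mul_a R a q) T M 1 DS_is_norm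
  tests_linear (tests_dense_DS sa sq) SL TL SM Tb E).
Qed.

Lemma DS_H1_spec : linear (DS_H1 iota : DS a q -> H1) /\
  forall d, hD (DS_H1 iota d) = dsD d /\ hQ (DS_H1 iota d) = dsQ d.
Proof.
have dsn : @DS_norm R a q = nDS by apply/funext => e; exact: DS_normE.
have ng := norm_pos H1_is_norm; have dg := norm_pos DS_is_norm.
have b f : nH (iota f) <= 1 * nDS (test_DS a q f).
  rewrite mul1r -ler_sqr ?nnegrE// H1_norm_iota DSnorm_le// (dsD_test sa sq) (dsQ_test sa sq).
  by rewrite -!addrA lerD2l lerDl addr_ge0// ?mul1r sqr_ge0.
have [T [TL Tb TE]] := @bounded_extension _ _ _ _ _ _ _ DS_is_norm H1_is_norm H1_complete
  tests_linear (tests_dense_DS sa sq) _ 1 ler01 iota_linear b.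
have bT : bounded_linear (@DS_norm R a q) nH T.
  by split; [exact: TL|exists 1; rewrite dsn; exact: Tb].
have [[SL [M SM]] SE] : bounded_linear (@DS_norm R a q) nH (DS_H1 iota : DS a q -> H1) /\
    forall f, DS_H1 iota (test_DS a q f) = iota f.
  exact: (@xgetPex _ (fun=> 0) [set T : DS a q -> H1 | bounded_linear (@DS_norm R a q) nH T /\
    forall f, T (test_DS a q f) = iota f] (ex_intro _ T (conj bT TE))).
rewrite dsn in SM; split; first exact: SL.
have M0 : 0 <= `|M| := normr_ge0 _.
have SM' d : nH (DS_H1 iota d) <= `|M| * nDS d.
  by apply: le_trans (SM d) _; rewrite ler_wpM2r// ler_norm.
move=> d; split.
- apply: (@bounded_extension_unique _ _ _ _ nDS (@L2_norm R) (@test_DS R a q) DS_is_norm L2_is_norm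
    (tests_dense_DS sa sq) (fun d => hD (DS_H1 iota d)) (@dsD R a q) `|M| 1).
  + by move=> c e e'; rewrite SL hD_lin.
  + exact: dsD_lin.
  + by move=> x; apply: le_trans (hD_le _) (SM' _).
  + by move=> x; rewrite mul1r dsD_le.
  + by move=> f; rewrite SE hD_iota (dsD_test sa sq).
- apply: (@bounded_extension_unique _ _ _ _ nDS (@L2_norm R) (@test_DS R a q) DS_is_norm L2_is_norm
    (tests_dense_DS sa sq) (fun d => hQ (DS_H1 iota d)) (@dsQ R a q) `|M| 1).
  + by move=> c e e'; rewrite SL hQ_lin.
  + exact: dsQ_lin.
  + by move=> x; apply: le_trans (hQ_le _) (SM' _).
  + by move=> x; rewrite mul1r dsQ_le.
  + by move=> f; rewrite SE hQ_iota (dsQ_test sa sq).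
Qed.

End energy_space.

(** * Resolvent equation of the generator *)

Section generator_resolvent.
Context {R : realType}.
Variables a q : R -> R.
Hypotheses (sa : smooth a) (sq : smooth q).
Hypotheses (a0 : forall x, 0 <= a x) (q0 : forall x, 0 <= q x).
Variables (H1 : completeNormedModType R[i]) (iota : {linear test R -> H1}).
Hypothesis H1_completion : completion_of (W_norm q) iota.
Local Opaque L2_ip smooth.
Let P := @L2_is_ip R.
Local Notation zD := (hD sa sq q0 H1_completion).
Local Notation zQ := (hQ sa sq q0 H1_completion).
Local Notation nH := (H_norm H1).
Local Notation G := (wave_generator a q iota).
Implicit Types (d psi : DS a q) (w g : L2 R) (u v : H1 * L2 R).

(** Makes the element of [L2] selected by [xget] in [wave_generator] unique. *)
Lemma L2_ip_DS_inj w w' : (forall psi, L2_ip w psi = L2_ip w' psi) -> w = w'.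
Proof.
by move=> E; apply: ip_tests_ext => phi; have := E (test_DS a q phi); rewrite (test_DSE phi sa sq).
Qed.

Lemma embeds_H2E (u1 : H1) d w : embeds_H2 (dxxq a q iota u1 - 2%:R *: mul_a d) w <->
  forall psi, L2_ip (zD u1) (dsD psi) + L2_ip (zQ u1) (dsQ psi) +
    2%:R * L2_ip (dsA d) (dsA psi) + L2_ip w psi = 0.
Proof.
have E psi : (dxxq a q iota u1 - 2%:R *: mul_a d) psi = - (L2_ip (zD u1) (dsD psi) +
    L2_ip (zQ u1) (dsQ psi) + 2%:R * L2_ip (dsA d) (dsA psi)).
  rewrite opprD -(dxxqE sa sq a0 q0 H1_completion) -(mul_aE sa sq a0 q0).
  by [].
split=> h psi.
  by rewrite -(h psi) E subrr.
by rewrite E; apply/eqP; rewrite eq_sym -addr_eq0 addrC; apply/eqP; exact: h.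
Qed.

Lemma gen_intro (u1 : H1) d w : embeds_H2 (dxxq a q iota u1 - 2%:R *: mul_a d) w ->
  opdom G (u1, DS_val d) /\ opmap G (u1, DS_val d) = (DS_H1 iota d, w).
Proof.
move=> h; split; first by exists d; split => //; exists w.
have E : insubd (0 : DS a q) (DS_val d) = d.
  by rewrite -[DS_val d]/(val d) valKd.
rewrite /= E; congr pair.
have h' : embeds_H2 (dxxq a q iota u1 - 2%:R *: mul_a d)
    (xget 0 [set w | embeds_H2 (dxxq a q iota u1 - 2%:R *: mul_a d) w]).
  exact: (@xgetPex _ 0 [set w | embeds_H2 (dxxq a q iota u1 - 2%:R *: mul_a d) w] (ex_intro _ w h)).
by apply: L2_ip_DS_inj => psi; rewrite -(h psi) -(h' psi).
Qed.

Lemma gen_elim u : opdom G u -> exists d w, [/\ u = (u.1, DS_val d),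
  embeds_H2 (dxxq a q iota u.1 - 2%:R *: mul_a d) w & opmap G u = (DS_H1 iota d, w)].
Proof.
move=> [d [ud [w h]]]; exists d, w.
have E : u = (u.1, DS_val d) by rewrite ud; case: u {ud h}.
by split => //; rewrite E; exact: (gen_intro h).2.
Qed.

Lemma gen_lin c u v : opdom G u -> opdom G v ->
  opdom G (c *: u + v) /\ opmap G (c *: u + v) = c *: opmap G u + opmap G v.
Proof.
move=> /gen_elim[d [w [-> h ->]]] /gen_elim[d' [w' [-> h' ->]]].
move: (u.1) (v.1) h h' => u1 v1 {u v} h h'.
have E : embeds_H2 (dxxq a q iota (c *: u1 + v1) - 2%:R *: mul_a (c *: d + d')) (c *: w + w').
  move/embeds_H2E: h => h; move/embeds_H2E: h' => h'; apply/embeds_H2E => psi.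
  rewrite hD_lin hQ_lin dsA_lin (ip_lin P c (zD u1)) (ip_lin P c (zQ u1)) (ip_lin P c (dsA d)).
  rewrite (ip_lin P c w).
  transitivity (c * 0 + 0 : R[i]); last by rewrite mulr0 addr0.
  rewrite -{1}(h psi) -(h' psi).
  move: (L2_ip (zD u1) _) (L2_ip (zQ u1) _) (L2_ip (dsA d) _) (L2_ip w _) => x1 x2 x3 x4.
  move: (L2_ip (zD v1) _) (L2_ip (zQ v1) _) (L2_ip (dsA d') _) (L2_ip w' _) => y1 y2 y3 y4.
  ring.
have [i1 i2] := gen_intro E.
have El : c *: (u1, DS_val d) + (v1, DS_val d') = (c *: u1 + v1, DS_val (c *: d + d')) by [].
rewrite El; split => //; rewrite i2; congr pair.
exact: ((DS_H1_spec sa sq a0 q0 H1_completion).1 c d d').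
Qed.

(** The bridge from the abstract operator on [H1 * L2] to the identities between elements of
    [L2]. *)
Lemma gen_wave (c b : R) u : opdom G u -> exists2 d : DS a q, u.2 = DS_val d &
  let v := shifted G ((- c) +i* b) u in
  wave_solution c b d (zD u.1) (zQ u.1) (zD v.1) (zQ v.1) v.2.
Proof.
move=> /gen_elim[d [w [E /embeds_H2E h Gu]]]; exists d; first by rewrite E.
rewrite /shifted Gu.
have -> : ((DS_H1 iota d, w) - ((- c) +i* b) *: u).1 = DS_H1 iota d - ((- c) +i* b) *: u.1 by [].
have -> : ((DS_H1 iota d, w) - ((- c) +i* b) *: u).2 = w - ((- c) +i* b) *: DS_val d by rewrite E.
have [_ /(_ d)[e1 e2]] := DS_H1_spec sa sq a0 q0 H1_completion.
have sc (T : H1 -> L2 R) k x : linear T -> T (k *: x) = k *: T x.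
  move=> TL; have T0 : T 0 = 0 by rewrite -(subrr (0 : H1)) (lin_sub TL) subrr.
  by rewrite -[k *: x]addr0 TL T0 addr0.
split.
- by rewrite (lin_sub (hD_lin _ _ _ _)) e1 (sc _ _ _ (hD_lin _ _ _ _)) addrC subrK.
- by rewrite (lin_sub (hQ_lin _ _ _ _)) e2 (sc _ _ _ (hQ_lin _ _ _ _)) addrC subrK.
- move=> psi; rewrite -(h psi) (ipBl P) (ipZl P).
  move: (L2_ip (zD u.1) _) (L2_ip (zQ u.1) _) (L2_ip (dsA d) _) (L2_ip w _) (L2_ip d psi) => x1 x2 x3 x4 x5.
  ring.
Qed.

Definition H_ip u v : R[i] := L2_ip (zD u.1) (zD v.1) + L2_ip (zQ u.1) (zQ v.1) + L2_ip u.2 v.2.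

Lemma H_is_ip : is_ip H_ip.
Proof.
split=> [c u v w|u v|u].
- rewrite /H_ip /= hD_lin hQ_lin (ip_lin P c (zD u.1)) (ip_lin P c (zQ u.1)) (ip_lin P c u.2).
  by move: (L2_ip _ _) (L2_ip _ _) (L2_ip _ _) (L2_ip _ _) (L2_ip _ _) (L2_ip _ _) => *; ring.
- by rewrite /H_ip !rmorphD /= -!(ipC P).
- by rewrite /H_ip !cReD !addr_ge0// ip_ge0.
Qed.

Lemma H_norm_ip u : nH u = ipnorm H_ip u.
Proof.
rewrite /H_norm (H1_normE sa sq q0 H1_completion) /ipnorm /H_ip !cReD.
by rewrite -!(sqr_ipnorm P).
Qed.

Lemma H_normE u : nH u ^+ 2 = L2_norm u.2 ^+ 2 + L2_norm (zD u.1) ^+ 2 + L2_norm (zQ u.1) ^+ 2.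
Proof.
rewrite H_norm_ip (sqr_ipnorm H_is_ip) /H_ip !cReD -!(sqr_ipnorm P).
by rewrite addrC addrA.
Qed.

Lemma H_is_norm : is_norm nH.
Proof.
have E : nH = ipnorm H_ip by apply/funext => u; exact: H_norm_ip.
split=> [u v|c u|u]; first by rewrite E; exact: ipnormD H_is_ip _ _.
  by rewrite E; exact: ipnormZ H_is_ip _ _.
move=> u0; have s := H_normE u; rewrite u0 expr0n /= in s.
have h1 := sqr_ge0 (L2_norm u.2); have h2 := sqr_ge0 (L2_norm (zD u.1)).
have h3 := sqr_ge0 (L2_norm (zQ u.1)).
have /and3P[/eqP z1 /eqP z2 /eqP z3] : [&& L2_norm u.2 ^+ 2 == 0, L2_norm (zD u.1) ^+ 2 == 0 & L2_norm (zQ u.1) ^+ 2 == 0].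
  by move/eqP: s; rewrite eq_sym paddr_eq0 ?addr_ge0// paddr_eq0// -andbA.
have k (x : L2 R) : L2_norm x ^+ 2 = 0 -> x = 0 by move/eqP; rewrite sqrf_eq0 => /eqP /L2_norm_eq0.
have e1 : u.1 = 0.
  apply: (norm_eq0 (H1_is_norm H1)); apply/eqP; rewrite -sqrf_eq0 (H1_normE sa sq q0 H1_completion).
  by rewrite z2 z3 addr0.
by have e2 := k _ z1; case: u e1 e2 {s h1 h2 h3 z1 z2 z3 u0} => ? ? /= -> ->.
Qed.

Lemma H_norm_le u : [/\ H1_norm u.1 <= nH u, L2_norm u.2 <= nH u & nH u <= H1_norm u.1 + L2_norm u.2].
Proof.
have n1 := norm_pos (H1_is_norm H1) u.1; have n2 : 0 <= L2_norm u.2 := ipnorm_ge0 _ _.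
have n3 := norm_pos H_is_norm u.
have E : nH u ^+ 2 = H1_norm u.1 ^+ 2 + L2_norm u.2 ^+ 2.
  by rewrite /H_norm sqr_sqrtr// addr_ge0// sqr_ge0.
split; rewrite -ler_sqr ?nnegrE ?addr_ge0// E ?lerDl ?lerDr ?sqr_ge0//.
by rewrite sqrrD lerD2r lerDl mulrn_wge0// mulr_ge0.
Qed.

Lemma H_complete : cauchy_complete nH.
Proof.
move=> u Hu.
have [l1 L1] : exists l, forall e, 0 < e -> exists N, forall i, (N <= i)%N -> H1_norm ((u i).1 - l) < e.
  apply: H1_complete => e e0; have [N HN] := Hu e e0; exists N => i j Ni Nj.
  by apply: le_lt_trans (HN i j Ni Nj); have [h _ _] := H_norm_le (u i - u j).
have [l2 L2'] : exists l, forall e, 0 < e -> exists N, forall i, (N <= i)%N -> L2_norm ((u i).2 - l) < e.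
  apply: L2_complete => e e0; have [N HN] := Hu e e0; exists N => i j Ni Nj.
  by apply: le_lt_trans (HN i j Ni Nj); have [_ h _] := H_norm_le (u i - u j).
exists (l1, l2) => e e0; have e2 : 0 < e / 2 by rewrite divr_gt0.
have [N1 h1] := L1 _ e2; have [N2 h2] := L2' _ e2; exists (maxn N1 N2) => i.
rewrite geq_max => /andP[/h1 k1 /h2 k2]; rewrite (splitr e).
by apply: le_lt_trans (ltrD k1 k2); have [_ _ h] := H_norm_le (u i - (l1, l2)).
Qed.

(** The first equation gives [u1 = d - F]. Inserted in the second one, it leaves
    [DSip 2 d psi = l psi], a hermitian coercive problem to which Riesz' theorem applies. *)
Lemma solvable_one : solvable (opdom G) (opmap G) 1.
Proof.
move=> [F g].
have two : (0 : R) <= 2 by []. have two1 : (1 : R) <= 2 by rewrite ler1n.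
have P2 := @DSip_is_ip R a q 2 two.
pose l psi : R[i] := L2_ip (zD F) (dsD psi) + L2_ip (zQ F) (dsQ psi) - L2_ip g psi.
have lL c d psi : l (c *: d + psi) = c^*%C * l d + l psi.
  rewrite /l dsD_lin dsQ_lin DS_valE (L2_ip_linr c (dsD d)) (L2_ip_linr c (dsQ d)) (L2_ip_linr c (DS_val d)).
  by move: (L2_ip _ _) (L2_ip _ _) (L2_ip _ _) (L2_ip _ _) (L2_ip _ _) (L2_ip _ _) => *; ring.
have lM d : cabs (l d) <= (L2_norm (zD F) + L2_norm (zQ F) + L2_norm g) * ipnorm (DSip 2) d.
  have [h1 h2 _ h4] := DSnorm_ge d two1.
  apply: le_trans (cabsD _ _) _; rewrite cabsN mulrDl; apply: lerD; last exact: L2_ip_le.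
  apply: le_trans (cabsD _ _) _; rewrite mulrDl; apply: lerD; exact: L2_ip_le.
have [d dE] := riesz P2 (DS_complete sa sq two1) lL lM.
have [_ /(_ d)[e1 e2]] := DS_H1_spec sa sq a0 q0 H1_completion.
have E : embeds_H2 (dxxq a q iota (DS_H1 iota d - F) - 2%:R *: mul_a d) (DS_val d + g).
  apply/embeds_H2E => psi; rewrite (lin_sub (hD_lin _ _ _ _)) (lin_sub (hQ_lin _ _ _ _)) e1 e2.
  rewrite (ipBl P (dsD d)) (ipBl P (dsQ d)) (ipDl P (DS_val d)).
  have := dE psi; rewrite /DSip /l (_ : (2 : R)%:C = 2%:R); last by rewrite rmorph_nat.
  move: (L2_ip _ _) (L2_ip _ _) (L2_ip _ _) (L2_ip _ _) (L2_ip _ _) (L2_ip _ _) (L2_ip _ _).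
  move=> x1 x2 x3 x4 x5 x6 x7 /eqP; rewrite -subr_eq0 => /eqP h.
  by rewrite -[RHS]h; ring.
have [i1 i2] := gen_intro E; exists (DS_H1 iota d - F, DS_val d); first exact: i1.
rewrite i2 scale1r.
have -> : (DS_H1 iota d, DS_val d + g) - (DS_H1 iota d - F, DS_val d) =
  (DS_H1 iota d - (DS_H1 iota d - F), DS_val d + g - DS_val d) by [].
by rewrite opprB addrC subrK addrC addKr.
Qed.

Lemma H_norm_sum u : [/\ L2_norm (zD u.1) <= nH u, L2_norm (zQ u.1) <= nH u & L2_norm u.2 <= nH u].
Proof.
have g (x : L2 R) : 0 <= L2_norm x := ipnorm_ge0 _ _.
by have [h1 h2 h3] := norm_le_of_sum (norm_pos H_is_norm u) (g _) (g _) (g _) (H_normE u).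
Qed.

Lemma gen_bound_damped (b : R) u : opdom G u -> nH u <= 3 * nH (shifted G (1 +i* b) u).
Proof.
move=> Du; have [d ud] := gen_wave (-1) b Du; rewrite opprK => /= sol.
have [h1 h2 h3] := H_norm_sum (shifted G (1 +i* b) u).
have E := H_normE u; rewrite ud in E.
exact: (a_priori_damped sol (norm_pos H_is_norm u) E h1 h2 h3).
Qed.

Lemma gen_bound (kap : R) : a x @[x --> +oo] --> +oo -> a x @[x --> -oo] --> +oo ->
  0 <= kap -> exists b0 M : R, [/\ 1 <= b0, 0 < M &
  forall c b u, `|c| <= kap -> b0 <= `|b| -> opdom G u ->
    nH u <= M * nH (shifted G ((- c) +i* b) u)].
Proof.
move=> ap an k0; have [b0 [M [b1 M0 H]]] := a_priori sa sq a0 q0 ap an k0.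
exists b0, M; split => // c b u ck bb Du.
have [d ud sol] := gen_wave c b Du.
have [h1 h2 h3] := H_norm_sum (shifted G ((- c) +i* b) u).
have [g1 g2 g3] := H_norm_sum u; rewrite ud in g3.
have E := H_normE u; rewrite ud in E.
exact: (H _ _ _ _ _ _ _ _ _ _ (WaveData sol ck (le_trans b1 bb) g3 g1 g2 h1 h2 h3) bb E).
Qed.

(* The continuity method starts at lambda = 1, where Riesz' theorem solves the equation,
   and follows 1 -> 1 + ib -> -c + ib; the estimate needs |b| large on the second segment
   only. *)
Lemma gen_solvable (kap : R) : a x @[x --> +oo] --> +oo -> a x @[x --> -oo] --> +oo ->
  0 <= kap -> exists b0 M : R, [/\ 1 <= b0, 0 < M &
  forall c b, `|c| <= kap -> b0 <= `|b| -> solvable (opdom G) (opmap G) ((- c) +i* b) /\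
  forall u, opdom G u -> nH u <= M * nH (shifted G ((- c) +i* b) u)].
Proof.
(* On the segment from [1 + ib] to [- c + ib], the opposite of the real part runs from -1 to [c];
   its modulus stays below [kap + 1]. *)
move=> ap an k0; have k1 : 0 <= kap + 1 by rewrite addr_ge0.
have [b0 [M [b1 M0 H]]] := gen_bound ap an k1.
have DL c u v (Du : opdom G u) (Dv : opdom G v) := (gen_lin c Du Dv).1.
have TL c u v (Du : opdom G u) (Dv : opdom G v) := (gen_lin c Du Dv).2.
exists b0, M; split => // c b ck bb.
have cM (x y k l t : R) : (x +i* y : R[i]) + t%:C * ((k +i* l) - (x +i* y)) =
    (x + t * (k - x)) +i* (y + t * (l - y)).
  by apply: complexP; rewrite /= mul0r ?subr0 ?addr0.
have s1 : solvable (opdom G) (opmap G) (1 +i* b).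
  apply: (solvable_path H_is_norm H_complete DL TL (ltr0n R 3)) solvable_one.
  move=> t u t01 Du; rewrite -[1 : R[i]]/(1 +i* 0) cM subrr mulr0 addr0.
  exact: gen_bound_damped.
have sc : solvable (opdom G) (opmap G) ((- c) +i* b).
  apply: (solvable_path H_is_norm H_complete DL TL M0) s1.
  move=> t u /andP[t0 t1] Du; rewrite cM subrr mulr0 addr0.
  have -> : 1 + t * (- c - 1) = - (t * c + t - 1) by ring.
  apply: H => //.
  have h1 : `|t * c| <= kap.
    by rewrite normrM ger0_norm//; apply: le_trans ck; rewrite ler_piMl.
  move: h1; rewrite !ler_norml => /andP[l1 l2]; apply/andP; split; lra.
split => // u Du; apply: H => //; apply: le_trans ck _; rewrite lerDl//.
Qed.

End generator_resolvent.

(** * Quasimodes and resolvent bounds *)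

Section plane_waves.
Context {R : realType}.
Implicit Types (phi : test R) (b : R).
Local Opaque L2_ip smooth.

Definition wave b (x : R) : R[i] := cos (b * x) +i* sin (b * x).

Lemma wave_conj b x : wave b x * (wave b x)^*%C = 1.
Proof.
apply: complexP; rewrite !cReIm /=; last by ring.
by rewrite mulrN opprK -!expr2 cos2Dsin2.
Qed.

Lemma smooth_cos_sin_mul b : smooth (fun x => cos (b * x)) /\ smooth (fun x => sin (b * x)).
Proof.
have [sc ss] := @smooth_cos_sin R.
split; [have := smooth_affine (al := b) (be := 0) sc|have := smooth_affine (al := b) (be := 0) ss];
  by congr (smooth _); apply/funext => x; rewrite addr0.
Qed.

Lemma test_wave_subproof b phi : (fun x => wave b x * phi x) \in is_test.
Proof.
have [fr fi fc] := test_smooth phi; have [sc ss] := smooth_cos_sin_mul b; apply/asboolP; split.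
- rewrite (_ : (fun x => _) = fun x => cos (b * x) * complex.Re (phi x) - sin (b * x) * complex.Im (phi x)).
    exact: smoothB (smoothM sc fr) (smoothM ss fi).
  by apply/funext => x; rewrite cReM.
- rewrite (_ : (fun x => _) = fun x => cos (b * x) * complex.Im (phi x) + sin (b * x) * complex.Re (phi x)).
    exact: smoothD (smoothM sc fi) (smoothM ss fr).
  by apply/funext => x; rewrite cImM.
- apply: (subclosed_compact _ fc); first exact: closed_closure.
  by apply: closure_subset => x /=; apply: contra => /eqP ->; rewrite mulr0.
Qed.

(* Multiplication by e^(ibx), hence an isometry for the L2 norm. *)
Definition test_wave b phi : test R := Test (test_wave_subproof b phi).

Lemma test_wave_norm b phi : L2_norm (test_L2 (test_wave b phi)) = L2_norm (test_L2 phi).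
Proof.
rewrite /L2_norm; congr (Num.sqrt (complex.Re _)).
rewrite (L2_ip_eq (test_L2fun (test_wave b phi)) (test_L2fun (test_wave b phi)) (repr_test_L2 _) (repr_test_L2 _)).
rewrite (L2_ip_eq (test_L2fun phi) (test_L2fun phi) (repr_test_L2 _) (repr_test_L2 _)).
congr cintegral; apply/funext => x /=.
have -> : (wave b x * phi x)^*%C = (wave b x)^*%C * (phi x)^*%C by rewrite rmorphM.
by rewrite mulrACA wave_conj mul1r.
Qed.

Lemma test_wave_derive b phi :
  test_derive (test_wave b phi) = (0 +i* b) *: test_wave b phi + test_wave b (test_derive phi).
Proof.
apply: val_inj; apply/funext => x.
have [fr fi _] := test_smooth phi.
have dr := smooth_is_derive x fr; have di := smooth_is_derive x fi.
have db : is_derive x 1 (fun x => b * x) b.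
  have := is_deriveZ b (is_derive_id x 1) => h.
  by apply: is_derive_ext h _ _ => //; rewrite /GRing.scale /= mulr1.
have dc : is_derive x 1 (fun x => cos (b * x)) (- sin (b * x) * b).
  exact: (@is_derive1_comp _ cos (fun x => b * x) x _ _ (is_derive_cos _) db).
have ds : is_derive x 1 (fun x => sin (b * x)) (cos (b * x) * b).
  exact: (@is_derive1_comp _ sin (fun x => b * x) x _ _ (is_derive_sin _) db).
have eR : (fun y => complex.Re (test_wave b phi y)) =
    fun y => cos (b * y) * complex.Re (phi y) - sin (b * y) * complex.Im (phi y).
  by apply/funext => y; rewrite cReM.
have eI : (fun y => complex.Im (test_wave b phi y)) =
    fun y => cos (b * y) * complex.Im (phi y) + sin (b * y) * complex.Re (phi y).
  by apply/funext => y; rewrite cImM.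
have DR := derive1_is (is_deriveB (is_deriveM dc dr) (is_deriveM ds di)).
have DI := derive1_is (is_deriveD (is_deriveM dc di) (is_deriveM ds dr)).
change (cderive (test_wave b phi) x = (0 +i* b) * (wave b x * phi x) + wave b x * cderive phi x).
apply: complexP; rewrite /cderive /= ?eR ?eI.
- transitivity (((fun x => cos (b * x)) * (fun y => complex.Re (phi y)) -
    (fun x => sin (b * x)) * (fun y => complex.Im (phi y)))^`()%classic x); first by [].
  by rewrite DR !cReIm /= /GRing.scale /=; ring.
- transitivity (((fun x => cos (b * x)) * (fun y => complex.Im (phi y)) +
    (fun x => sin (b * x)) * (fun y => complex.Re (phi y)))^`()%classic x); first by [].
  by rewrite DI !cReIm /= /GRing.scale /=; ring.
Qed.

Lemma test_wave_mul b phi (m : R -> R) (sm : smooth m) :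
  test_mul sm (test_wave b phi) = test_wave b (test_mul sm phi).
Proof. by apply: val_inj; apply/funext => x /=; exact: mulrCA. Qed.

Lemma nonzero_test : exists phi : test R, 0 < L2_norm (test_L2 phi).
Proof.
have [k k0 /(_ 1 ltr01)[g sg [_ g1 g0 _]]] := @smooth_cutoff R.
exists (Test (real_is_test sg g0)); rewrite lt_neqAle ipnorm_ge0 andbT eq_sym.
apply/eqP => /L2_norm_eq0 f0.
have : {ae lebesgue_measure, forall x : R, (g x)%:C = 0 :> R[i]}.
  apply: ae_imply2 (repr_test_L2 (Test (real_is_test sg g0))) (@repr_L2_0 R) => x.
  by rewrite f0 => -> .
(* A null set containing all points where [g] is nonzero would contain the unit interval. *)
move=> [A [mA A0 sA]].
have : (lebesgue_measure (`[0%R, 1%R] : set R) <= lebesgue_measure A)%E.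
  apply: le_measure; rewrite ?inE//; move=> x /=; rewrite in_itv /= => /andP[x0 x1].
  apply: sA => /=; rewrite g1 ?ger0_norm// => /(congr1 (fun c => complex.Re c)) /= /eqP.
  by rewrite oner_eq0.
rewrite A0 (lebesgue_measure_itv (Interval (BLeft 0) (BRight 1))) /= lte_fin ltr01.
by rewrite oppr0 adde0 lee_fin ler10.
Qed.

End plane_waves.

(** * Quasimodes for the generator *)

Section quasimode.
Context {R : realType}.
Variables a q : R -> R.
Hypotheses (sa : smooth a) (sq : smooth q).
Hypotheses (a0 : forall x, 0 <= a x) (q0 : forall x, 0 <= q x).
Variables (H1 : completeNormedModType R[i]) (iota : {linear test R -> H1}).
Hypothesis H1_completion : completion_of (W_norm q) iota.
Local Opaque L2_ip smooth.
Let P := @L2_is_ip R.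
Local Notation zD := (hD sa sq q0 H1_completion).
Local Notation zQ := (hQ sa sq q0 H1_completion).
Local Notation nH := (H_norm H1).
Local Notation G := (wave_generator a q iota).
Implicit Types (f phi : test R).

Lemma sqrt_weight_ip (m : R -> R) (sm : smooth m) f (v : L2 R) : (forall x, 0 <= m x) ->
  mul_dom (fun x => Num.sqrt (m x)) v ->
  L2_ip (mulop (fun x => Num.sqrt (m x)) (test_L2 f)) (mulop (fun x => Num.sqrt (m x)) v) =
  L2_ip (test_L2 (test_mul sm f)) v.
Proof.
move=> m0 dv; have df := mul_dom_test f (continuous_sqrt sm).
have E : (fun x => Num.sqrt (m x) * Num.sqrt (m x)) = m.
  by apply/funext => x; rewrite -expr2 sqr_sqrtr.
have dd : mul_dom (fun x => Num.sqrt (m x)) (mulop (fun x => Num.sqrt (m x)) (test_L2 f)).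
  exists (mulop m (test_L2 f)).
  apply: ae_imply2 (mulopP df) (mulopP (mul_dom_test f (smooth_continuous sm))) => x -> ->.
  by rewrite mulrA -rmorphM /= -expr2 sqr_sqrtr.
by rewrite -(mulop_ipC dd dv) (mulop_comp df dd) E mulop_test.
Qed.

Lemma DS_H1_test f : DS_H1 iota (test_DS a q f) = iota f.
Proof.
have [_ /(_ (test_DS a q f))[e1 e2]] := DS_H1_spec sa sq a0 q0 H1_completion.
apply: (@H1_eq _ _ _ sa sq q0 _ _ H1_completion).
  by rewrite e1 hD_iota (dsD_test sa sq).
by rewrite e2 hQ_iota (dsQ_test sa sq).
Qed.

(** The choice [lam f] of the second component annihilates the first component of [(G - lam) u].
    There remains the quadratic pencil [f'' - q f - 2 lam a f - lam^2 f]. *)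
Lemma gen_test (lam : R[i]) f :
  let g := test_L2 (test_derive (test_derive f)) - test_L2 (test_mul sq f) -
    (2%:R * lam) *: test_L2 (test_mul sa f) in
  let u := (iota f, lam *: test_L2 f) in
  opdom G u /\ shifted G lam u = (0, g - (lam * lam) *: test_L2 f).
Proof.
move=> g u.
have Lf (F : DS a q -> L2 R) : (forall c d e, F (c *: d + e) = c *: F d + F e) ->
    F (lam *: test_DS a q f) = lam *: F (test_DS a q f).
  move=> FL; have F0 : F 0 = 0 by rewrite -(subrr (0 : DS a q)) (dsB FL) subrr.
  by rewrite -[lam *: _]addr0 FL F0 addr0.
have E : embeds_H2 (dxxq a q iota (iota f) - 2%:R *: mul_a (lam *: test_DS a q f)) g.
  apply/(embeds_H2E sa sq a0 q0 H1_completion) => psi; have [_ dq da] := dsP psi.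
  rewrite hD_iota hQ_iota (Lf _ (@dsA_lin _ _ _)) (dsA_test sa sq) (ipZl P).
  rewrite (sqrt_weight_ip sq f q0 dq) (sqrt_weight_ip sa f a0 da).
  have -> : L2_ip (test_L2 (test_derive f)) (dsD psi) =
      - L2_ip (test_L2 (test_derive (test_derive f))) (DS_val psi).
    rewrite -(test_DSE (test_derive f) sa sq) (DS_by_parts sa sq).
    by rewrite (dsD_test sa sq).
  rewrite /g (ipBl P (_ - _)) (ipBl P (test_L2 _)) (ipZl P (2%:R * lam)).
  by move: (L2_ip _ _) (L2_ip _ _) (L2_ip _ _) => x1 x2 x3; ring.
have [i1 i2] := gen_intro sa sq E.
have vE : DS_val (lam *: test_DS a q f) = lam *: test_L2 f by rewrite -(test_DSE f sa sq).
rewrite vE in i1 i2; split; first exact: i1.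
rewrite /shifted i2.
have DH := (DS_H1_spec sa sq a0 q0 H1_completion).1.
have -> : DS_H1 iota (lam *: test_DS a q f) = lam *: iota f.
  have D0 : DS_H1 iota (0 : DS a q) = 0 by rewrite -(subrr (0 : DS a q)) (lin_sub DH) subrr.
  by rewrite -[lam *: test_DS a q f]addr0 DH D0 addr0 DS_H1_test.
have -> : (lam *: iota f, g) - lam *: u = (lam *: iota f - lam *: iota f, g - lam *: (lam *: test_L2 f)) by [].
by rewrite subrr scalerA.
Qed.

(** The second derivative of [e^(ibx) phi] is expanded on the left. The factorisation
    [(ib)^2 - lam^2 = c (ib + lam)] removes the terms quadratic in the large parameter, so that
    every coefficient on the right is [O(|lam|)]. *)
Lemma quasimode_algebra (V : lmodType R[i]) (ib lam c : R[i]) (X0 X1 X2 Xq Xa : V) :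
  lam + c = ib ->
  ib *: (ib *: X0 + X1) + (ib *: X1 + X2) - Xq - (2%:R * lam) *: Xa - (lam * lam) *: X0 =
  (c * (ib + lam)) *: X0 + (2%:R * ib) *: X1 + X2 - Xq - (2%:R * lam) *: Xa.
Proof.
move=> E; have -> : c * (ib + lam) = ib * ib - lam * lam by rewrite -E; ring.
have -> : (2%:R * ib) *: X1 = ib *: X1 + ib *: X1 by rewrite mulr_natl mulr2n scalerDl.
rewrite scalerDr !scalerA scalerBl.
move: ((ib * ib) *: X0) ((lam * lam) *: X0) (ib *: X1) (_ *: Xa) => A L B D.
rewrite [LHS]addrAC; congr (_ - _); rewrite [LHS]addrAC; congr (_ - _).
by rewrite [LHS]addrAC [A + B - L]addrAC !addrA.
Qed.

Lemma quasimode (kap : R) : 0 <= kap -> exists2 m : R, 0 < m &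
  forall c b, `|c| <= kap -> 1 <= `|b| -> exists u, [/\ opdom G u, 0 < nH u &
    m * nH (shifted G ((- c) +i* b) u) <= nH u].
Proof.
move=> k0; have [phi n0] := @nonzero_test R.
pose N f := L2_norm (test_L2 f).
have Ng f : 0 <= N f := ipnorm_ge0 _ _.
pose C := 2 * kap * N phi + 2 * N (test_derive phi) + N (test_derive (test_derive phi)) +
  N (test_mul sq phi) + 2 * N (test_mul sa phi).
have C0 : 0 <= C by rewrite /C !addr_ge0 ?mulr_ge0.
have C1 : 0 < C + 1 by rewrite ltr_wpDl.
(* The residual is at most [C |lam|] and the quasimode has norm at least [|lam| N phi]: the factor
   [|lam|] cancels in the quotient. *)
exists (N phi / (C + 1)) => [|c b ck b1]; first by rewrite divr_gt0.
pose lam : R[i] := (- c) +i* b; pose h := test_wave b phi.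
have [Du Su] := gen_test lam h.
exists (iota h, lam *: test_L2 h); rewrite Su.
have nS v : nH (0, v) = L2_norm v.
  by rewrite /H_norm /= (norm0 (H1_is_norm H1)) expr0n /= add0r sqrtr_sqr ger0_norm// ipnorm_ge0.
have lb : `|b| <= cabs lam := le_Im_cabs lam.
have l1 : 1 <= cabs lam := le_trans b1 lb.
have low : cabs lam * N phi <= nH (iota h, lam *: test_L2 h).
  have [_ l _] := H_norm_le sa sq q0 H1_completion (iota h, lam *: test_L2 h).
  by apply: le_trans l; rewrite /= (norm_scale L2_is_norm) test_wave_norm.
have Nw f : L2_norm (test_L2 (test_wave b f)) = N f := test_wave_norm b f.
split; first exact: Du.
  by apply: lt_le_trans low; rewrite mulr_gt0// (lt_le_trans ltr01).
rewrite nS; apply: le_trans low.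
rewrite mulrAC ler_pdivrMr// [cabs lam * _]mulrC -mulrA ler_wpM2l//.
apply: (@le_trans _ _ (cabs lam * C)); last by rewrite ler_wpM2l ?cabs_ge0// lerDl.
rewrite test_wave_derive (test_derive_L2_lin sa sq) !test_wave_derive !test_wave_mul !test_L2_lin.
rewrite (@quasimode_algebra _ (0 +i* b) lam c%:C); last first.
  by apply: complexP; rewrite /= ?addr0// addNr.
have T := norm_tri (@L2_is_norm R).
have S := norm_scale (@L2_is_norm R).
apply: le_trans (T _ _) _; rewrite (normN L2_is_norm) S Nw.
apply: le_trans (lerD (T _ _) (lexx _)) _; rewrite (normN L2_is_norm) Nw.
apply: le_trans (lerD (lerD (T _ _) (lexx _)) (lexx _)) _; rewrite Nw.
apply: le_trans (lerD (lerD (lerD (T _ _) (lexx _)) (lexx _)) (lexx _)) _; rewrite !S !Nw !cabsM.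
have cb : cabs (0 +i* b) = `|b| by rewrite cabsE /= expr0n add0r sqrtr_sqr.
have c2 : cabs (2%:R : R[i]) = 2 by rewrite -(rmorph_nat (real_complex R)) cabs_real ger0_norm.
have h1 : `|c| * cabs ((0 +i* b) + lam) <= 2 * kap * cabs lam.
  rewrite -mulrA mulrCA; apply: ler_pM => //; first exact: cabs_ge0.
  by apply: le_trans (cabsD _ _) _; rewrite cb mulr_natl mulr2n lerD2r.
rewrite cb c2 cabs_real.
have g0 := Ng phi; have g1 := Ng (test_derive phi); have g2 := Ng (test_derive (test_derive phi)).
have g3 := Ng (test_mul sq phi); have g4 := Ng (test_mul sa phi).
have e1 := ler_wpM2r g0 h1.
have e2 : 2 * `|b| * N (test_derive phi) <= 2 * cabs lam * N (test_derive phi).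
  by rewrite ler_wpM2r// ler_wpM2l.
have e3 := ler_wpM2r g2 l1; have e4 := ler_wpM2r g3 l1.
rewrite !mul1r in e3 e4.
apply: le_trans (lerD (lerD (lerD (lerD e1 e2) e3) e4) (lexx _)) _.
rewrite /C le_eqVlt; apply/orP; left; apply/eqP.
by move: (cabs lam) (N _) (N _) (N _) (N _) (N _) => *; ring.
Qed.

End quasimode.

(** * From solvability and estimates to the norm of the resolvent *)

Section resolvent_bounds.
Context {R : realType} {V : lmodType R[i]} (nV : V -> R) (T : operator V).
Hypothesis nP : is_norm nV.
Hypothesis DL : forall c u v, opdom T u -> opdom T v -> opdom T (c *: u + v).
Hypothesis TL : forall c u v, opdom T u -> opdom T v -> T (c *: u + v) = c *: T u + T v.
Variables (z : R[i]) (M : R).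
Hypothesis M0 : 0 < M.
Hypothesis sz : solvable (opdom T) T z.
Hypothesis bz : forall u, opdom T u -> nV u <= M * nV (shifted T z u).

Lemma shifted_lin c u v : opdom T u -> opdom T v ->
  shifted T z (c *: u + v) = c *: shifted T z u + shifted T z v.
Proof.
move=> Du Dv; rewrite /shifted TL// !scalerDr scalerN !scalerA (mulrC z c).
by rewrite opprD addrACA.
Qed.

Lemma shifted_inj : {in opdom T &, injective (shifted T z)}.
Proof.
move=> u v; rewrite !inE => Du Dv E.
have D1 : opdom T (u - v) by rewrite addrC -scaleN1r; exact: DL.
have E1 : shifted T z (u - v) = 0.
  by rewrite addrC -scaleN1r shifted_lin// E scaleN1r addNr.
apply/eqP; rewrite -subr_eq0; apply/eqP/(norm_eq0 nP)/eqP.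
by rewrite eq_le (norm_pos nP) andbT; have := bz D1; rewrite E1 (norm0 nP) mulr0.
Qed.

Lemma shifted_bij : set_bij (opdom T) setT (shifted T z).
Proof. by split=> // [|y _]; [exact: shifted_inj|have [x Dx xy] := sz y; exists x]. Qed.

Lemma resolventK u : opdom T u -> resolvent T z (shifted T z u) = u.
Proof. by move=> Du; apply: (pinvKV _ shifted_inj); rewrite inE. Qed.

Lemma resolvent_le : (opnorm nV (resolvent T z) <= M%:E)%E.
Proof.
apply: ge_ereal_sup => _ [y /= y1 <-].
have [x Dx xy] := sz y; rewrite -{}xy -/(shifted T z x) in y1 *.
by rewrite lee_fin resolventK//; apply: le_trans (bz Dx) _; rewrite ler_piMr ?(ltW M0).
Qed.

(** With [s] the norm of [(T - z) u], the resolvent maps the unit vector [s^-1 (T - z) u] to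
    [s^-1 u]. The a priori bound guarantees [s > 0]. *)
Lemma resolvent_ge (m : R) u : opdom T u -> 0 < nV u -> m * nV (shifted T z u) <= nV u ->
  (m%:E <= opnorm nV (resolvent T z))%E.
Proof.
move=> Du u0 mu; set s := nV (shifted T z u) in mu.
have s0 : 0 < s by have := lt_le_trans u0 (bz Du); rewrite pmulr_rgt0.
have D0 : opdom T 0.
  by have := DL (-1) Du Du; rewrite scaleN1r addNr.
have Dk : opdom T (s^-1%:C *: u) by have := DL s^-1%:C Du D0; rewrite addr0.
have sh0 : shifted T z 0 = 0.
  have := shifted_lin (-1) Du Du; by rewrite !scaleN1r !addNr.
have E : shifted T z (s^-1%:C *: u) = s^-1%:C *: shifted T z u.
  by have := shifted_lin s^-1%:C Du D0; rewrite sh0 !addr0.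
have cs : cabs s^-1%:C = s^-1 by rewrite cabs_real ger0_norm// invr_ge0 ltW.
apply: (@le_trans _ _ (nV (resolvent T z (shifted T z (s^-1%:C *: u))))%:E).
  by rewrite resolventK// lee_fin (norm_scale nP) cs mulrC ler_pdivlMr.
apply: ereal_sup_ubound; exists (shifted T z (s^-1%:C *: u)) => //=.
by rewrite E (norm_scale nP) cs mulVf ?gt_eqF.
Qed.

End resolvent_bounds.

Theorem theorem3p5 (R : realType) (a q : R -> R) (x0 : R)
  (a_smooth : smooth a) (q_smooth : smooth q)
  (a_ge0 : forall x, 0 <= a x) (q_ge0 : forall x, 0 <= q x)
  (x0_gt0 : 0 < x0)
  (a_pinfty : a x @[x --> +oo] --> +oo) (a_ninfty : a x @[x --> -oo] --> +oo)
  (a_symbol : symbol_like a) (q_symbol : symbol_like q)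
  (q_le_a : exists2 K0 : R, 0 < K0 & forall x, x0 < `|x| -> q x <= K0 * a x)
  (H1 : completeNormedModType R[i]) (iota : {linear test R -> H1})
  (H1_completion : completion_of (W_norm q) iota)
  (K : set R) (K_bounded : bounded_set K) (K_ge0 : forall c, K c -> 0 <= c) :
  let G := wave_generator a q iota in
  exists b0 m M : R, [/\ 0 < b0, 0 < m, m <= M &
    forall c b : R, K c -> b0 <= `|b| ->
      let lambda : R[i] := (- c) +i* b in
      resolvent_set (H_norm H1) G lambda /\
      (m%:E <= opnorm (H_norm H1) (resolvent G lambda) <= M%:E)%E].
Proof.
move=> G.
have [kap kap0 Kk] : exists2 kap : R, 0 <= kap & forall c, K c -> `|c| <= kap.
  have [k [_ kK]] := K_bounded; exists (`|k| + 1); first by rewrite addr_ge0.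
  by move=> c Kc; apply: kK Kc; rewrite (le_lt_trans (ler_norm k))// ltrDl.
have nP := H_is_norm a_smooth q_smooth q_ge0 H1_completion.
have lin c u v (Du : opdom G u) (Dv : opdom G v) :=
  gen_lin a_smooth q_smooth a_ge0 q_ge0 H1_completion c Du Dv.
have DL c u v Du Dv := (lin c u v Du Dv).1; have TL c u v Du Dv := (lin c u v Du Dv).2.
have [b0 [M [b1 M0 H]]] :=
  gen_solvable a_smooth q_smooth a_ge0 q_ge0 H1_completion a_pinfty a_ninfty kap0.
have [m m0 Q] := quasimode a_smooth q_smooth a_ge0 q_ge0 H1_completion kap0.
(* For an empty [K] the inequality between the two constants cannot be read off the estimates; the
   maximum provides it in all cases. *)
exists b0, m, (Num.max m M); split => //.
- exact: lt_le_trans ltr01 b1.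
- by rewrite le_max lexx.
move=> c b /Kk ck bb lambda; have [sol bd] := H c b ck bb.
have [u [Du u0 mu]] := Q c b ck (le_trans b1 bb).
have le := resolvent_le nP DL TL M0 sol bd.
split; first split.
- exact: (shifted_bij nP DL TL sol bd).
- exact: le_lt_trans le (ltry _).
apply/andP; split; first exact: (resolvent_ge nP DL TL M0 bd Du u0 mu).
by apply: le_trans le _; rewrite lee_fin le_max lexx orbT.
Qed.
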